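(* Let $L>0$, let $L_0>L$ and let $\alpha:[-L_0,L_0]\to\mathbb{R}$ be a continuous function. For $h\in L^2(-L_0,L_0)$, define $$g(t,x)=\frac{1}{t^{3/2}}\exp\left(\frac{x^2-L_0^2}{4t}-\mathbf{i}\,\frac{\alpha(x)}{4t}\right)h(x),\qquad (t,x)\in(0,\infty)\times(-L_0,L_0).$$ Then the state $w_0$ defined on $(-L,L)$ by $$w_0(x)=\int_0^\infty\int_{-L_0}^{L_0}\frac{1}{\sqrt{4\pi t}}\exp\left(-\frac{(x-\tilde x)^2}{4t}\right)g(t,\tilde x)\,d\tilde x\,dt,\qquad x\in(-L,L),$$ is well-defined and belongs to the reachable set $\mathscr{R}_L$. Besides, $w_0$ can alternatively be written as $$w_0(x)=\frac{2}{\sqrt{\pi}}\int_{-L_0}^{L_0}\frac{h(\tilde x)}{(x-\tilde x)^2+L_0^2-\tilde x^2+\mathbf{i}\,\alpha(\tilde x)}\,d\tilde x,\qquad x\in(-L,L).$$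
   Context: All functions are complex valued unless stated otherwise. For $T>0$ and controls $v_-,v_+\in L^2(0,T)$, consider the solution $u$ (in the standard transposition sense) of $$\partial_t u-\partial_{xx}u=0 \text{ in }(0,T)\times(-L,L),\quad u(t,-L)=v_-(t),\ u(t,L)=v_+(t)\text{ in }(0,T),\quad u(0,x)=0\text{ in }(-L,L).$$ Define $\mathscr{R}_L(T)=\{u(T,\cdot): u \text{ is such a solution for some } v_-,v_+\in L^2(0,T)\}$. The set $\mathscr{R}_L(T)$ is a vector space which does not depend on $T>0$ (a known fact, a consequence of null-controllability of the heat equation in arbitrarily small time), and it is denoted by $\mathscr{R}_L$. *)

(* Defs.v *)
From HB Require Import structures.
From mathcomp Require Import all_boot all_order all_algebra.
From mathcomp Require Import all_classical all_reals all_analysis.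
From mathcomp.real_closed Require Import complex.
Set Implicit Arguments.
Unset Strict Implicit.
Unset Printing Implicit Defensive.
Import Order.TTheory GRing.Theory Num.Theory.
Import numFieldNormedType.Exports.
Local Open Scope classical_set_scope.
Local Open Scope ring_scope.
Local Open Scope complex_scope.

Definition cexp {R : realType} (z : R[i]) : R[i] :=
  (expR (complex.Re z) * cos (complex.Im z)) +i* (expR (complex.Re z) * sin (complex.Im z)).

Definition sqmod {R : realType} (z : R[i]) : R := complex.Re z ^+ 2 + complex.Im z ^+ 2.

Definition cintegrable {d : measure_display} {T : measurableType d}
    {R : realType} (mu : {measure set T -> \bar R}) (D : set T)
    (f : T -> R[i]) : Prop :=
  mu.-integrable D (fun x => (complex.Re (f x))%:E) /\
  mu.-integrable D (fun x => (complex.Im (f x))%:E).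

(* Only meaningful together with [cintegrable]: [Rintegral] returns a junk
   value on non-integrable functions. *)
Definition cintegral {d : measure_display} {T : measurableType d}
    {R : realType} (mu : {measure set T -> \bar R}) (D : set T)
    (f : T -> R[i]) : R[i] :=
  (Rintegral mu D (fun x => complex.Re (f x))) +i*
  (Rintegral mu D (fun x => complex.Im (f x))).

Notation leb R := (@lebesgue_measure R) (only parsing).

Definition cL2 {R : realType} (D : set R) (f : R -> R[i]) : Prop :=
  [/\ measurable_fun D (fun x => complex.Re (f x)),
      measurable_fun D (fun x => complex.Im (f x)) &
      (leb R).-integrable D (fun x => (sqmod (f x))%:E)].

Definition cL2norm {R : realType} (D : set R) (f : R -> R[i]) : R :=
  Num.sqrt (Rintegral (leb R) D (fun x => sqmod (f x))).

Definition cderive1 {R : realType} (f : R -> R[i]) (x : R) : R[i] :=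
  (derive1 (fun y => complex.Re (f y)) x) +i*
  (derive1 (fun y => complex.Im (f y)) x).

(* In dimension one, H^1_0(-L, L) consists of the primitives of L^2 functions
   that vanish at both end points; [psi] is the weak derivative of [phi].
   The values of [phi] outside [-L, L] are irrelevant. *)
Definition H10_deriv {R : realType} (L : R) (phi psi : R -> R[i]) : Prop :=
  [/\ cL2 `]-L, L[ psi,
      (forall x, x \in `[-L, L] -> phi x = cintegral (leb R) `]-L, x[ psi) &
      phi L = 0].

Definition H10 {R : realType} (L : R) : set (R -> R[i]) :=
  [set phi | exists psi, H10_deriv L phi psi].

(* ||F||_{H^-1} <= M, where H^1_0 carries the norm ||phi'||_{L^2}. *)
Definition Hm1_norm_le {R : realType} (L : R) (F : (R -> R[i]) -> R[i])
    (M : R) : Prop :=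
  forall phi psi, H10_deriv L phi psi ->
    Num.sqrt (sqmod (F phi)) <= M * cL2norm `]-L, L[ psi.

(* H^-1(-L, L), the dual of H^1_0(-L, L). The duality is bilinear: a function
   w acts by phi |-> \int w phi, without complex conjugation. *)
Definition Hm1 {R : realType} (L : R) : set ((R -> R[i]) -> R[i]) :=
  [set F | (forall (a : R[i]) (phi1 phi2 : R -> R[i]),
              H10 L phi1 -> H10 L phi2 ->
              F (fun x => a * phi1 x + phi2 x) = a * F phi1 + F phi2) /\
           exists M : R, Hm1_norm_le L F M].

Definition continuous_Hm1 {R : realType} (L T : R)
    (u : R -> (R -> R[i]) -> R[i]) : Prop :=
  (forall t, t \in `[0, T] -> Hm1 L (u t)) /\
  (forall t, t \in `[0, T] -> forall eps : R, 0 < eps ->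
    exists2 delta : R, 0 < delta &
      forall s, s \in `[0, T] -> `|s - t| < delta ->
        Hm1_norm_le L (fun phi => u s phi - u t phi) eps).

Definition C12 {R : realType} (f : R -> R -> R) : Prop :=
  [/\ (forall t x, [/\ derivable (fun s => f s x) t 1,
                       derivable (f t) x 1 & derivable (derive1 (f t)) x 1]),
      continuous (fun p : R * R => f p.1 p.2),
      continuous (fun p : R * R => derive1 (fun s => f s p.2) p.1),
      continuous (fun p : R * R => derive1 (f p.1) p.2) &
      continuous (fun p : R * R => derive1 (derive1 (f p.1)) p.2)].

(* Classical solutions, C^{1,2} up to the boundary, of the adjoint problem
   - z_t - z_xx = 0 in (0, tau) x (-L, L), z = 0 at x = -L and x = L.
   Such a [z] is given here through an extension to the whole plane, which is
   not required to solve the equation outside the rectangle. *)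
Definition adjoint_state {R : realType} (L tau : R) (z : R -> R -> R[i]) :
    Prop :=
  [/\ C12 (fun t x => complex.Re (z t x)),
      C12 (fun t x => complex.Im (z t x)),
      (forall t x, t \in `]0, tau[ -> x \in `]-L, L[ ->
         - cderive1 (fun s => z s x) t - cderive1 (cderive1 (z t)) x = 0) &
      (forall t, t \in `[0, tau] -> z t (- L) = 0 /\ z t L = 0)].

(* u in C([0, T]; H^-1(-L, L)) is the solution by transposition of
     u_t - u_xx = 0,  u(t, -L) = vm(t),  u(t, L) = vp(t),  u(0, x) = 0 :
   multiplying by an adjoint state z and integrating by parts over
   (0, tau) x (-L, L) gives
     <u(tau), z(tau)> = \int_0^tau (vm z_x(., -L) - vp z_x(., L)) dt.
   The final data z(tau) contain all test functions on (-L, L), which are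
   dense in H^1_0, so u is unique. For tau = 0 the identity is the initial
   condition. *)
Definition transposition_solution {R : realType} (L T : R)
    (vm vp : R -> R[i]) (u : R -> (R -> R[i]) -> R[i]) : Prop :=
  continuous_Hm1 L T u /\
  forall tau, tau \in `[0, T] -> forall z, adjoint_state L tau z ->
    u tau (z tau) =
    cintegral (leb R) `]0, tau[
      (fun t => vm t * cderive1 (z t) (- L) - vp t * cderive1 (z t) L).

Definition Hm1_represents {R : realType} (L : R) (F : (R -> R[i]) -> R[i])
    (w : R -> R[i]) : Prop :=
  forall phi, H10 L phi ->
    cintegrable (leb R) `]-L, L[ (fun x => w x * phi x) /\
    F phi = cintegral (leb R) `]-L, L[ (fun x => w x * phi x).

Definition reachable_in {R : realType} (L T : R) : set (R -> R[i]) :=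
  [set w | exists vm vp u,
     [/\ cL2 `]0, T[ vm, cL2 `]0, T[ vp,
         transposition_solution L T vm vp u & Hm1_represents L (u T) w]].

(* [reachable_in L T] does not depend on T > 0, so that this intersection is
   their common value. *)
Definition reachable {R : realType} (L : R) : set (R -> R[i]) :=
  [set w | forall T : R, 0 < T -> reachable_in L T w].

Definition heat_kernel {R : realType} (t x : R) : R :=
  (Num.sqrt (4 * pi * t))^-1 * expR (- (x ^+ 2 / (4 * t))).

Definition source {R : realType} (L0 : R) (alpha : R -> R) (h : R -> R[i])
    (t x : R) : R[i] :=
  ((t `^ (3 / 2))^-1)%:C *
  cexp (((x ^+ 2 - L0 ^+ 2) / (4 * t))%:C - 'i%C * (alpha x / (4 * t))%:C) *
  h x.

(* Main.v *)
(* Since \int_0^oo t^-2 exp (- X / 4 t) dt = 4 / X for Re X > 0, Fubini's theorem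
   turns [w0] into a superposition over [y] of the functions
   x |-> h y / ((x - y)^2 + S), S = L0^2 - y^2 + i alpha y.

   Reachability rests on the same formula. If [l] lies outside [-L, L] and
   Re zeta >= 0, then (H0 + H1 (x - l)) / ((x - l)^2 + zeta) is a superposition
   over [s > 0] of the Gaussians s^-2 exp (- (x - l)^2 / 4 s), multiplied by 1 or
   by x - l, with bounded weights exp (- zeta / 4 s). Each Gaussian is the value at
   time [T] of an explicit solution that vanishes at time 0: for [s <= T], a heat
   kernel emitted at [l] at time T - s; for [s > T], a heat kernel times the Appell
   transform of a power series sum_i phi^(i) x^(2 i + p) / (2 i + p)!, where [phi]
   is a Gevrey step vanishing for early times. The bounds decay like 1 / (1 + s^2),
   so that the superposition is again a solution.

   For |y| >= L' > L one takes l = y and zeta = S. For |y| < L' let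
   S = (p + i q)^2 with p > 0: the quotient is a combination of the simple poles
   1 / (x - z) at z = y -+ q +- i p, and 1 / (x - z) =
   ((x - l) + (z - l)) / ((x - l)^2 + zeta) with zeta = - (z - l)^2; for l = L0 or
   l = - L0 according to the sign of Re z, Re zeta = 2 (L0 |Re z| - y Re z) >= 0. *)

Require Import Defs.
From HB Require Import structures.
From mathcomp Require Import all_boot all_order all_algebra.
From mathcomp Require Import all_classical all_reals all_analysis.
From mathcomp Require Import measurable_realfun.
From mathcomp.real_closed Require Import complex.
From mathcomp Require Import ring lra zify.
Import Order.TTheory GRing.Theory Num.Theory.
Import numFieldNormedType.Exports.
Set Implicit Arguments.
Unset Strict Implicit.
Unset Printing Implicit Defensive.
Local Open Scope classical_set_scope.
Local Open Scope ring_scope.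

(** * Integration and calculus on the line and in the plane *)

(** Every real solution below carries one constant [M] that bounds it together with its Lipschitz
    quotients in t and x. This notion survives superposition: integrating over a parameter only
    needs an integrable bound, Lipschitz continuity in t gives continuity in H^-1, and bounded
    traces are admissible L^2 controls. Since the transposition identity contains no derivative of
    the solution, it passes to integrals by Fubini's theorem and to uniform limits.

    Two constraints fix the case distinctions. A centre [l] must keep a distance from [-L, L]: this
    tames s^-2 as s tends to 0, and it permits l = y only when |y| >= L'. The simple poles have the
    weight 1 / (2 i (p + i q)), controlled only while L0^2 - y^2 stays away from 0, hence the cut at
    L' < L0. For s > T the Gaussian would have to be emitted before time 0; the flat correction has
    derivatives growing like n!^2, which (2 n)! absorbs if the Gevrey rate is small, and s^-2
    remains as decay. *)

Section fubini_dominated.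
Context d1 d2 (X : measurableType d1) (Y : measurableType d2) (R : realType).
Variables (m1 : {sigma_finite_measure set X -> \bar R})
          (m2 : {sigma_finite_measure set Y -> \bar R}).

Let fubini_dominatedT (f : X * Y -> R) (g : X -> R) (k : Y -> R) :
  measurable_fun setT f -> m1.-integrable setT (EFin \o g) ->
  m2.-integrable setT (EFin \o k) ->
  (forall x y, `|f (x, y)| <= g x * k y) ->
  [/\ (m1 \x m2)%E.-integrable setT (EFin \o f),
      m1.-integrable setT (fun x => (\int[m2]_y f (x, y))%:E) &
      \int[m1]_x (\int[m2]_y f (x, y)) = \int[m2]_y (\int[m1]_x f (x, y))].
Proof.
move=> mf ig ik fgk.
have i2 x : m2.-integrable setT (fun y => (f (x, y))%:E).
  have := integrableZl measurableT (g x) ik; apply: le_integrable => //=.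
    apply/measurable_EFinP.
    by apply: (measurableT_comp mf); exact: measurable_pair1.
  move=> y _; rewrite lee_fin (le_trans (fgk x y))//; exact: ler_norm.
have i1 y : m1.-integrable setT (fun x => (f (x, y))%:E).
  have := integrableZl measurableT (k y) ig; apply: le_integrable => //=.
    apply/measurable_EFinP.
    by apply: (measurableT_comp mf); exact: measurable_pair2.
  move=> x _; rewrite lee_fin (le_trans (fgk x y))// mulrC; exact: ler_norm.
have ikn : m2.-integrable setT (fun y => `|k y|%:E) by exact: (integrable_norm ik).
have ign : m1.-integrable setT (fun y => `|g y|%:E) by exact: (integrable_norm ig).
have ipf : (m1 \x m2)%E.-integrable setT (EFin \o f).
  apply/integrable12ltyP; first exact/measurable_EFinP.
  have kfin : (\int[m2]_y `|k y|%:E)%E \is a fin_num.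
    by have := integrable_fin_num measurableT ikn.
  apply: (@le_lt_trans _ _ (\int[m1]_x (`|g x|%:E * \int[m2]_y `|k y|%:E))%E).
    apply: ge0_le_integral => //=.
    - by move=> x _; exact: integral_ge0.
    - apply: (measurable_fun_fubini_tonelli_F (abse \o (EFin \o f))) => //=.
      by apply: measurableT_comp => //; exact/measurable_EFinP.
    - by apply: emeasurable_funM => //; case/integrableP: ign.
    - move=> x _; rewrite -ge0_integralZl//; last by case/integrableP: ikn.
      apply: ge0_le_integral => //=.
      + by case/integrableP: (integrable_norm (i2 x)).
      + by apply: emeasurable_funM => //; case/integrableP: ikn.
      + by move=> y _; rewrite lee_fin -normrM (le_trans (fgk x y))// ler_norm.
  rewrite ge0_integralZr//.
  - rewrite lte_mul_pinfty//; first exact: integral_ge0.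
      by have := integrable_fin_num measurableT ign.
    by rewrite -ge0_fin_numE// integral_ge0.
  - by case/integrableP: ign.
  - exact: integral_ge0.
have F1 : (fun x => (\int[m2]_y f (x, y))%:E) = fubini_F m2 (EFin \o f).
  by apply/funext => x; rewrite /fubini_F /Rintegral fineK//; exact: integrable_fin_num.
have F2 : (fun y => (\int[m1]_x f (x, y))%:E) = fubini_G m1 (EFin \o f).
  by apply/funext => x; rewrite /fubini_G /Rintegral fineK//; exact: integrable_fin_num.
split => //.
- rewrite F1; exact: integrable_fubini_F.
- rewrite /Rintegral; congr fine.
  have := Fubini ipf.
  rewrite -[X in (X = _)%E -> _]/(\int[m1]_x (fubini_F m2 (EFin \o f) x))%E -F1.
  by rewrite -[X in (_ = X)%E -> _]/(\int[m2]_x (fubini_G m1 (EFin \o f) x))%E -F2.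
Qed.

(** A product majorant makes every section integrable, not merely almost every one, so that no inner
    [Rintegral] is a junk value and Fubini's theorem holds between real iterated integrals. General
    domains reduce to the whole space by extension by zero. *)
Lemma fubini_dominated (D1 : set X) (D2 : set Y)
    (f : X * Y -> R) (g : X -> R) (k : Y -> R) :
  measurable D1 -> measurable D2 ->
  measurable_fun (D1 `*` D2) f -> m1.-integrable D1 (EFin \o g) ->
  m2.-integrable D2 (EFin \o k) ->
  (forall x y, D1 x -> D2 y -> `|f (x, y)| <= g x * k y) ->
  [/\ (m1 \x m2)%E.-integrable (D1 `*` D2) (EFin \o f),
      (forall x, D1 x -> m2.-integrable D2 (fun y => (f (x, y))%:E)),
      m1.-integrable D1 (fun x => (\int[m2]_(y in D2) f (x, y))%:E) &
      \int[m1]_(x in D1) (\int[m2]_(y in D2) f (x, y)) =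
      \int[m2]_(y in D2) (\int[m1]_(x in D1) f (x, y))].
Proof.
move=> mD1 mD2 mf ig ik fgk.
have mD : measurable (D1 `*` D2) by exact: measurableX.
have i2 x : D1 x -> m2.-integrable D2 (fun y => (f (x, y))%:E).
  move=> xD.
  have := integrableZl mD2 (g x) ik; apply: le_integrable => //=.
    apply/measurable_EFinP.
    rewrite (_ : (fun y => f (x, y)) = f \o (pair x))//.
    apply: measurable_comp mf _ => //; first by move=> _ [y yD <-].
    by apply: measurable_funTS; exact: measurable_pair1.
  by move=> y yD; rewrite lee_fin (le_trans (fgk x y xD yD))// ler_norm.
have [] := @fubini_dominatedT (f \_ (D1 `*` D2)) (g \_ D1) (k \_ D2).
- exact/(measurable_restrictT _ mD).
- by rewrite -restrict_EFin; apply/(integrable_mkcond _ mD1).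
- by rewrite -restrict_EFin; apply/(integrable_mkcond _ mD2).
- move=> x y; rewrite !patchE.
  have -> : ((x, y) \in D1 `*` D2) = (x \in D1) && (y \in D2).
    by apply/idP/andP; rewrite !inE.
  have [xD|xD] := boolP (x \in D1); have [yD|yD] := boolP (y \in D2) => /=;
    rewrite ?normr0 ?mulr0 ?mul0r//.
  by apply: fgk; exact/set_mem.
have E x y : (f \_ (D1 `*` D2)) (x, y) =
    if x \in D1 then ((fun y => f (x, y)) \_ D2) y else 0.
  rewrite !patchE.
  have -> : ((x, y) \in D1 `*` D2) = (x \in D1) && (y \in D2).
    by apply/idP/andP; rewrite !inE.
  by case: (x \in D1); case: (y \in D2).
have J1 : (fun x => \int[m2]_y (f \_ (D1 `*` D2)) (x, y)) =
    (fun x => \int[m2]_(y in D2) f (x, y)) \_ D1.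
  apply/funext => x; rewrite patchE; under eq_Rintegral do rewrite E.
  case: ifPn => xD; first by rewrite [RHS]Rintegral_mkcond.
  by rewrite Rintegral_cst// mul0r.
have J2 : (fun y => \int[m1]_x (f \_ (D1 `*` D2)) (x, y)) =
    (fun y => \int[m1]_(x in D1) f (x, y)) \_ D2.
  apply/funext => y; rewrite patchE.
  case: ifPn => yD.
    rewrite [RHS]Rintegral_mkcond; apply: eq_Rintegral => x _.
    by rewrite E !patchE yD.
  under eq_Rintegral do rewrite E patchE (negbTE yD) if_same.
  by rewrite Rintegral_cst// mul0r.
move=> H1 H2 H3; split => //.
- by apply/(integrable_mkcond _ mD); rewrite restrict_EFin.
- apply/(integrable_mkcond _ mD1); move: H2.
  by rewrite -[X in integrable _ _ X -> _]/(EFin \o (fun x => \int[m2]_y (f \_ (D1 `*` D2)) (x, y))) J1 -restrict_EFin.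
- by rewrite [LHS]Rintegral_mkcond [RHS]Rintegral_mkcond -J1 -J2.
Qed.

End fubini_dominated.

Lemma cvg_plane (R : realType) (T : Type) (F : set_system T) {FF : Filter F}
    (f : R * R -> R) (g h : T -> R) (a b : R) :
  {for (a, b), continuous f} -> g @ F --> a -> h @ F --> b ->
  f (g x, h x) @[x --> F] --> f (a, b).
Proof.
move=> cf ga hb; apply: (cvg_comp2 ga hb (h := fun a b => f (a, b))).
rewrite (_ : (fun x => f (x.1, x.2)) = f); first exact: cf.
by apply/funext => -[].
Qed.

(* Discretising the first variable makes [f] a pointwise limit of functions
   that are measurable on each of countably many strips. *)
Lemma continuous_plane_measurable (R : realType) (f : R * R -> R) :
  continuous f -> measurable_fun [set: R * R] f.
Proof.
move=> cf.
pose q (n : nat) (t : R) : R := (Num.floor (n.+1%:R * t))%:~R / n.+1%:R.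
have qt (t : R) : q ^~ t @ \oo --> t.
  apply/cvgrPdist_le => /= e e0; near=> n.
  have n0 : 0 < n.+1%:R :> R by rewrite ltr0n.
  have /andP[a b] := floor_itv (n.+1%:R * t).
  have -> : t - q n t = (n.+1%:R * t - (Num.floor (n.+1%:R * t))%:~R) / n.+1%:R.
    by rewrite /q mulrBl [n.+1%:R * t]mulrC mulfK ?gt_eqF.
  rewrite normrM normfV (gtr0_norm n0) ger0_norm ?subr_ge0//.
  apply: (@le_trans _ _ (n.+1%:R^-1)).
    rewrite ler_pdivrMr// mulVf ?gt_eqF//.
    by rewrite lerBlDl; move: b; rewrite intrD => /ltW.
  rewrite -[leRHS]invrK lef_pV2 ?posrE ?invr_gt0//.
  by rewrite -natr1 ler_wpDr//; near: n; exact: nbhs_infty_ger.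
pose fn n (p : R * R) := f (q n p.1, p.2).
apply: (@measurable_fun_cvg _ _ _ _ fn) => [n|p _]; last first.
  rewrite [in f p](surjective_pairing p).
  by apply: cvg_plane; [exact: cf|exact: qt|exact: cvg_cst].
pose g (p : R * R) := Num.floor (n.+1%:R * p.1).
pose E (k : nat) : set (R * R) :=
  if unpickle k is Some m then [set p | g p = m] else set0.
have -> : [set: R * R] = \bigcup_k E k.
  apply/esym; rewrite -subTset => p _; exists (pickle (g p)); first exact: I.
  by rewrite /E pickleK.
have mE k : measurable (E k).
  rewrite /E; case: (unpickle k) => // m.
  have -> : [set p | g p = m] = (fun p : R * R => n.+1%:R * p.1) @^-1` `[m%:~R, (m + 1)%:~R[.
    apply/seteqP; split => p /=; rewrite in_itv/= /g.
      by move=> <-; exact: floor_itv.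
    by rewrite -floor_eq => /eqP.
  rewrite -[X in measurable X]setTI.
  have : measurable_fun [set: R * R] (fun p : R * R => n.+1%:R * p.1).
    by apply: measurable_funM => //; exact: measurable_fst.
  by apply => //; exact: measurable_itv.
apply/measurable_fun_bigcup => // k; rewrite /E.
have := mE k; rewrite /E; case: (unpickle k) => [m|] mEk; last exact: measurable_fun_set0.
apply: (@eq_measurable_fun _ _ _ _ _ (fun p : R * R => f (m%:~R / n.+1%:R, p.2))).
  by move=> p; rewrite inE/= /fn /q -/(g p) => ->.
apply: measurable_funTS.
apply: (measurableT_comp (f := fun x => f (m%:~R / n.+1%:R, x))); last exact: measurable_snd.
apply: continuous_measurable_fun => x.
by apply: cvg_plane; [exact: cf|exact: cvg_cst|exact: cvg_id].
Unshelve. all: by end_near. Qed.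

Lemma is_derive_continuous (R : realType) (f : R -> R) (x d : R) :
  is_derive x 1 f d -> {for x, continuous f}.
Proof.
by move=> fd; apply: differentiable_continuous; apply/derivable1_diffP.
Qed.

Lemma measurable_plane_comp (R : realType) d (T : measurableType d)
    (f : R -> R -> R) (g h : T -> R) :
  measurable_fun setT (fun p : R * R => f p.1 p.2) ->
  measurable_fun setT g -> measurable_fun setT h ->
  measurable_fun setT (fun w => f (g w) (h w)).
Proof.
move=> mf mg mh.
exact: (measurableT_comp mf (measurable_fun_pair mg mh)).
Qed.

Section continuous_arith.
Context {R : realType} {T : topologicalType} {f g : T -> R} {x : T}.
Hypotheses (cf : {for x, continuous f}) (cg : {for x, continuous g}).

Lemma continuous_mul : {for x, continuous (fun y => f y * g y)}.
Proof. exact: cvgM. Qed.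

Lemma continuous_add : {for x, continuous (fun y => f y + g y)}.
Proof. exact: cvgD. Qed.

Lemma continuous_sub : {for x, continuous (fun y => f y - g y)}.
Proof. exact: cvgB. Qed.

End continuous_arith.

Lemma is_derive_mul (R : realType) (f g : R -> R) (x a b : R) :
  is_derive x 1 f a -> is_derive x 1 g b ->
  is_derive x 1 (fun y => f y * g y) (a * g x + f x * b).
Proof.
by move=> fa gb; apply: is_derive_eq; rewrite /GRing.scale/= addrC [g x * a]mulrC.
Qed.

Lemma is_derive_add (R : realType) (f g : R -> R) (x a b : R) :
  is_derive x 1 f a -> is_derive x 1 g b ->
  is_derive x 1 (fun y => f y + g y) (a + b).
Proof. by move=> fa gb; exact: is_deriveD. Qed.

Lemma is_derive_sub (R : realType) (f g : R -> R) (x a b : R) :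
  is_derive x 1 f a -> is_derive x 1 g b ->
  is_derive x 1 (fun y => f y - g y) (a - b).
Proof. by move=> fa gb; exact: is_deriveB. Qed.

Lemma is_derive_cast (R : realType) (f : R -> R) (x a b : R) :
  is_derive x 1 f a -> a = b -> is_derive x 1 f b.
Proof. by move=> + <-. Qed.

Lemma mem_itv_oo_cc (R : realType) (a b x : R) : x \in `]a, b[ -> x \in `[a, b].
Proof. by rewrite !in_itv/= => /andP[/ltW -> /ltW ->]. Qed.

Lemma bounded_integrable_oo (R : realType) (a b M : R) (f : R -> R) :
  measurable_fun `]a, b[ f -> (forall x, x \in `]a, b[ -> `|f x| <= M) ->
  (leb R).-integrable `]a, b[ (EFin \o f).
Proof.
move=> mf fM; apply: measurable_bounded_integrable => //.
  by rewrite /= lebesgue_measure_itv/=; case: ifP => // _; rewrite -EFinB ltry.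
exists M; split; first exact: num_real.
by move=> r Mr x /= xab; rewrite (le_trans (fM x xab))// ltW.
Qed.

Lemma Rintegral_bound_oo (R : realType) (a b M : R) (f : R -> R) :
  a <= b ->
  measurable_fun `]a, b[ f -> (forall x, x \in `]a, b[ -> `|f x| <= M) ->
  `|\int[leb R]_(x in `]a, b[) f x| <= M * (b - a).
Proof.
move=> ab mf fM; apply: le_trans (le_normr_Rintegral _ _) _ => //.
  exact: bounded_integrable_oo fM.
have -> : M * (b - a) = \int[leb R]_(x in `]a, b[) cst M x.
  rewrite Rintegral_cst//= lebesgue_measure_itv/= lte_fin.
  move: ab; rewrite le_eqVlt => /predU1P[->|->]; last by [].
  by rewrite ltxx subrr.
apply: le_Rintegral => //.
- by apply: integrable_norm; exact: bounded_integrable_oo fM.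
- by apply: (@bounded_integrable_oo _ _ _ `|M|) => // x _.
Qed.

Lemma within_oo_measurable (R : realType) (a b : R) (f : R -> R) :
  (forall x, x \in `]a, b[ -> {for x, continuous f}) ->
  measurable_fun `]a, b[ f.
Proof.
move=> cf; apply: open_continuous_measurable_fun => //.
by move=> x; rewrite inE => xab; apply: cf.
Qed.

Lemma Rintegral_FTC2_oo (R : realType) (a b : R) (f F : R -> R) : a < b ->
  (forall x, x \in `[a, b] -> is_derive x 1 F (f x)) ->
  (forall x, x \in `[a, b] -> {for x, continuous f}) ->
  \int[leb R]_(x in `]a, b[) f x = F b - F a.
Proof.
move=> ab dF cf.
have sub := @mem_itv_oo_cc R a b.
have := @continuous_FTC2 R f F a b ab.
rewrite -[X in _ -> _ -> _ -> X]/(_ = (F b - F a)%:E) integral_itv_bndoo; last first.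
  apply/measurable_EFinP; apply: within_oo_measurable => x /sub; exact: cf.
rewrite /Rintegral => -> //.
- by apply: continuous_in_subspaceT => x; rewrite inE => /cf.
- split.
  + by move=> x /sub /dF [].
  + have aab : a \in `[a, b] by rewrite in_itv/= lexx ltW.
    by apply: cvg_at_right_filter; exact: is_derive_continuous (dF _ aab).
  + have aab : b \in `[a, b] by rewrite in_itv/= lexx ltW.
    by apply: cvg_at_left_filter; exact: is_derive_continuous (dF _ aab).
- by move=> x /sub /dF H; rewrite derive1E; exact: derive_val.
Qed.

(** * Real solutions of the heat equation in transposition form *)

Section trajectories.
Context {R : realType}.
Implicit Types (L T M eps : R) (U z : R -> R -> R).

Definition real_adjoint L tau z : Prop :=
  [/\ C12 z,
      (forall t x, t \in `]0, tau[ -> x \in `]-L, L[ ->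
         derive1 (fun s => z s x) t = - derive1 (derive1 (z t)) x) &
      (forall t, t \in `[0, tau] -> z t (- L) = 0 /\ z t L = 0)].

(** The boundary integrand of the transposition identity when the controls are the traces of [U] at
    the two ends. *)
Definition flux L U z (t : R) : R :=
  U t (- L) * derive1 (z t) (- L) - U t L * derive1 (z t) L.

Definition in_rect L T (t x : R) := (t \in `[0, T]) && (x \in `[-L, L]).

(** A single constant serves the three bounds, so that an integral over a parameter has only one
    quantity to dominate. The bound in t will give continuity with values in H^-1; the two Lipschitz
    bounds also make time slices and traces measurable. *)
Definition bounded_lipschitz L T M U : Prop :=
  [/\ (forall t x, in_rect L T t x -> `|U t x| <= M),
      (forall s t x, in_rect L T s x -> in_rect L T t x ->
         `|U s x - U t x| <= M * `|s - t|) &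
      (forall t x y, in_rect L T t x -> in_rect L T t y ->
         `|U t x - U t y| <= M * `|x - y|)].

Definition bounded_adjoint L tau (Z : R) z : Prop := real_adjoint L tau z /\
  forall t x, in_rect L tau t x -> `|z t x| <= Z /\ `|derive1 (z t) x| <= Z.

Definition green_gap L U z tau : R :=
  \int[leb R]_(x in `]-L, L[) (U tau x * z tau x) -
  \int[leb R]_(t in `]0, tau[) flux L U z t.

(* [eps] is the defect in the transposition identity, relative to a bound [Z]
   on the test function. *)
Definition trajectory L T M eps U : Prop := bounded_lipschitz L T M U /\
  forall tau z Z, tau \in `[0, T] -> bounded_adjoint L tau Z z ->
    `|green_gap L U z tau| <= eps * Z.

Lemma mvt_lipschitz (f f' : R -> R) (a b M : R) :
  (forall x, x \in `[a, b] -> is_derive x 1 f (f' x)) ->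
  (forall x, x \in `[a, b] -> `|f' x| <= M) ->
  forall x y, x \in `[a, b] -> y \in `[a, b] -> `|f x - f y| <= M * `|x - y|.
Proof.
move=> df fM x y; wlog xy : x y / x <= y => [H xI yI|xI yI].
  have /orP[xy|yx] := le_total x y; first exact: H.
  by rewrite distrC [`|x - y|]distrC; exact: H.
have sub u : u \in `[x, y] -> u \in `[a, b].
  move: xI yI; rewrite !in_itv/= => /andP[ax xb] /andP[ay yb] /andP[xu uy].
  by rewrite (le_trans ax xu) (le_trans uy yb).
have [c cI E] : exists2 c, c \in `[x, y] & f y - f x = f' c * (y - x).
  have := @MVT_segment R f f' x y xy.
  have H u : u \in `]x, y[ -> is_derive u 1 f (f' u) by move/mem_itv_oo_cc/sub/df.
  move=> /(_ H); apply.
  by apply: derivable_within_continuous => u /sub /df [].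
by rewrite distrC E normrM distrC ler_wpM2r// fM//; exact: sub.
Qed.

Lemma derivable_is_derive1 (f : R -> R) (x : R) :
  derivable f x 1 -> is_derive x 1 f (derive1 f x).
Proof. by rewrite derive1E => /derivableP. Qed.

Lemma C12_derive z : C12 z -> forall t x : R,
  [/\ is_derive t 1 (z ^~ x) (derive1 (z ^~ x) t),
      is_derive x 1 (z t) (derive1 (z t) x) &
      is_derive x 1 (derive1 (z t)) (derive1 (derive1 (z t)) x)].
Proof.
by move=> [dz _ _ _ _] t x; have [d1 d2 d3] := dz t x; split; exact: derivable_is_derive1.
Qed.

Lemma continuous_plane1 (f : R -> R -> R) (x : R) :
  continuous (fun p : R * R => f p.1 p.2) -> continuous (f ^~ x).
Proof.
move=> cf t; apply: (@cvg_plane _ _ _ _ _ id (cst x) t x (cf (t, x))).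
  exact: cvg_id.
exact: cvg_cst.
Qed.

Lemma continuous_plane2 (f : R -> R -> R) (t : R) :
  continuous (fun p : R * R => f p.1 p.2) -> continuous (f t).
Proof.
move=> cf x; apply: (@cvg_plane _ _ _ _ _ (cst t) id t x (cf (t, x))).
  exact: cvg_cst.
exact: cvg_id.
Qed.

End trajectories.

Lemma continuous_rect_bounded (R : realType) (a b c d : R) (f : R * R -> R) :
  continuous f -> exists B, forall t x, t \in `[a, b] -> x \in `[c, d] ->
    `|f (t, x)| <= B.
Proof.
move=> cf.
have K : compact (`[a, b]%classic `*` `[c, d]%classic).
  by apply: compact_setX; exact: segment_compact.
have := @continuous_compact _ _ f _ (continuous_subspaceT cf) K.
move=> /compact_bounded [B [_ HB]]; exists (B + 1) => t x tI xI.
by apply: (HB (B + 1)); [rewrite ltrDl|exists (t, x)].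
Qed.

(** * Green's formula for smooth approximate solutions *)

Section classical.
Context {R : realType}.
Variables (L T M e : R) (A At Ax Axx : R -> R -> R).
Hypotheses (L_gt0 : 0 < L) (T_ge0 : 0 <= T).
Hypothesis mA : measurable_fun setT (fun p : R * R => A p.1 p.2).
Hypothesis mAt : measurable_fun setT (fun p : R * R => At p.1 p.2).
Hypothesis dA : forall t x, in_rect L T t x ->
  [/\ is_derive t 1 (A ^~ x) (At t x), is_derive x 1 (A t) (Ax t x) &
      is_derive x 1 (Ax t) (Axx t x)].
Hypothesis cAt : forall t x, in_rect L T t x -> {for t, continuous (At ^~ x)}.
Hypothesis cAxx : forall t x, in_rect L T t x -> {for x, continuous (Axx t)}.
Hypothesis bA : forall t x, in_rect L T t x ->
  [/\ `|A t x| <= M, `|At t x| <= M & `|Ax t x| <= M].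
Hypothesis bE : forall t x, in_rect L T t x -> `|At t x - Axx t x| <= e.
Hypothesis A0 : forall x : R, x \in `[-L, L] -> A 0 x = 0.

(** The t-derivative of A z is integrated over the rectangle. At fixed t the adjoint equation turns
    At z + A z_t into (Ax z - A z_x)_x + (At - Axx) z. The first term integrates to [flux], because
    z vanishes at both ends; the second is at most [e * Z]. Integrating in t first leaves only the
    pairing at time [tau], because A vanishes at time 0. *)
Let green (tau : R) (z : R -> R -> R) (Z : R) :
  0 < tau -> tau <= T -> real_adjoint L tau z ->
  (forall t x, in_rect L tau t x -> `|z t x| <= Z /\ `|derive1 (z t) x| <= Z) ->
  `| \int[leb R]_(x in `]-L, L[) (A tau x * z tau x) -
     \int[leb R]_(t in `]0, tau[) flux L A z t | <= e * (2 * L) * T * Z.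
Proof.
move=> tau_gt0 tauT [Cz eqz z0] bz.
have [_ cz czt czx czxx] := Cz; have dz := C12_derive Cz.
have LL : - L < L by rewrite gtrN.
have sub (t x : R) : t \in `[0, tau] -> x \in `[-L, L] -> in_rect L T t x.
  move=> tI xI; rewrite /in_rect xI andbT; move: tI.
  by rewrite !in_itv/= => /andP[-> /le_trans ->].
have subo (t x : R) : t \in `]0, tau[ -> x \in `]-L, L[ -> in_rect L T t x.
  by move=> /mem_itv_oo_cc tI /mem_itv_oo_cc; exact: sub.
have rct (t x : R) : t \in `]0, tau[ -> x \in `]-L, L[ -> in_rect L tau t x.
  by move=> tI xI; rewrite /in_rect (mem_itv_oo_cc tI) (mem_itv_oo_cc xI).
have LI : L \in `[-L, L] by rewrite in_itv/= lexx ltW.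
have NLI : -L \in `[-L, L] by rewrite in_itv/= lexx ltW.
have tauI : tau \in `[0, tau] by rewrite in_itv/= lexx ltW.
have Z_ge0 : 0 <= Z.
  have rI : in_rect L tau tau L by rewrite /in_rect tauI LI.
  by have [H _] := bz _ _ rI; exact: (le_trans (normr_ge0 _) H).
have e_ge0 : 0 <= e by exact: (le_trans (normr_ge0 _) (bE (sub _ _ tauI LI))).
have M_ge0 : 0 <= M by have [H _ _] := bA (sub _ _ tauI LI); exact: (le_trans (normr_ge0 _) H).
pose zt t x := derive1 (fun s => z s x) t.
have [B bzt] := @continuous_rect_bounded R 0 tau (-L) L _ czt.
pose f x t := At t x * z t x + A t x * zt t x.
have mz : measurable_fun setT (fun p : R * R => z p.1 p.2) by exact: (continuous_plane_measurable cz).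
have mzt : measurable_fun setT (fun p : R * R => zt p.1 p.2) by exact: (continuous_plane_measurable czt).
have mf : measurable_fun setT (fun p : R * R => f p.2 p.1).
  by apply: measurable_funD; apply: measurable_funM.
have mf' : measurable_fun setT (fun p : R * R => f p.1 p.2).
  apply: (measurableT_comp mf (g := fun p : R * R => (p.2, p.1))).
  exact: measurable_swap.
have bf (x t : R) : t \in `]0, tau[ -> x \in `]-L, L[ -> `|f x t| <= M * Z + M * B.
  move=> tI xI; rewrite (le_trans (ler_normD _ _))// !normrM.
  have [b1 b2 _] := bA (subo _ _ tI xI).
  have [b3 _] := bz _ _ (rct _ _ tI xI).
  by rewrite lerD// ler_pM// (bzt t x)//; apply: mem_itv_oo_cc.
have [||||_ _ _ fub] := @fubini_dominated _ _ _ _ R (leb R) (leb R) `]-L, L[%classic `]0, tau[%classic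
  (fun p => f p.1 p.2) (cst (M * Z + M * B)) (cst 1) (measurable_itv _) (measurable_itv _).
- exact: measurable_funTS.
- by apply: (@bounded_integrable_oo _ _ _ `|M * Z + M * B|).
- by apply: (@bounded_integrable_oo _ _ _ `|1|).
- by move=> x t /= xI tI; rewrite mulr1; exact: bf.
have inner1 (x : R) : x \in `]-L, L[ -> \int[leb R]_(t in `]0, tau[) f x t = A tau x * z tau x.
  move=> xI; have xI' := mem_itv_oo_cc xI.
  transitivity (A tau x * z tau x - A 0 x * z 0 x); last by rewrite (A0 xI') mul0r subr0.
  apply: (@Rintegral_FTC2_oo _ _ _ _ (fun t => A t x * z t x) tau_gt0).
  + move=> t tI; have [dAt _ _] := dA (sub _ _ tI xI').
    have [dzt _ _] := dz t x.
    exact: is_derive_mul.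
  + move=> t tI; have [dAt _ _] := dA (sub _ _ tI xI').
    apply: continuous_add; apply: continuous_mul.
    * exact: (cAt (sub _ _ tI xI')).
    * exact: (@continuous_plane1 _ z x cz t).
    * exact: is_derive_continuous dAt.
    * exact: (@continuous_plane1 _ zt x czt t).
have Elhs : \int[leb R]_(x in `]-L, L[) (A tau x * z tau x) =
    \int[leb R]_(t in `]0, tau[) \int[leb R]_(x in `]-L, L[) f x t.
  rewrite -fub; apply: eq_Rintegral => x; rewrite inE => xI.
  by rewrite -inner1.
have inner2 (t : R) : t \in `]0, tau[ ->
    `|\int[leb R]_(x in `]-L, L[) f x t - flux L A z t| <= e * Z * (2 * L).
  move=> tI; have tI' := mem_itv_oo_cc tI.
  have [zL zR] := z0 t tI'.
  pose g x := Axx t x * z t x - A t x * derive1 (derive1 (z t)) x.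
  have Eg : \int[leb R]_(x in `]-L, L[) g x = flux L A z t.
    pose G x := Ax t x * z t x - A t x * derive1 (z t) x.
    transitivity (G L - G (- L)); last by rewrite /G zL zR !mulr0 /flux; ring.
    apply: (@Rintegral_FTC2_oo _ _ _ _ G LL).
    - move=> x xI; have [_ dAx dAxx] := dA (sub _ _ tI' xI).
      have [_ dzx dzxx] := dz t x.
      apply: (is_derive_cast (is_derive_sub (is_derive_mul dAxx dzx) (is_derive_mul dAx dzxx))).
      by rewrite /g; ring.
    - move=> x xI; have [_ dAx dAxx] := dA (sub _ _ tI' xI).
      apply: continuous_sub; apply: continuous_mul.
      + exact: (cAxx (sub _ _ tI' xI)).
      + exact: (@continuous_plane2 _ z t cz x).
      + exact: is_derive_continuous dAx.
      + exact: (@continuous_plane2 _ (fun t => derive1 (derive1 (z t))) t czxx x).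
  have mft : measurable_fun `]-L, L[ (f ^~ t).
    by apply: measurable_funTS; exact: (measurable_plane_comp mf').
  have Ef (x : R) : x \in `]-L, L[ -> f x t - g x = (At t x - Axx t x) * z t x.
    by move=> xI; rewrite /f /g /zt (eqz _ _ tI xI); ring.
  have mg : measurable_fun `]-L, L[ g.
    apply: within_oo_measurable => x /mem_itv_oo_cc xI.
    have [_ dAx dAxx] := dA (sub _ _ tI' xI).
    apply: continuous_sub; apply: continuous_mul.
    + exact: (cAxx (sub _ _ tI' xI)).
    + exact: (@continuous_plane2 _ z t cz x).
    + exact: is_derive_continuous dAx.
    + exact: (@continuous_plane2 _ (fun t => derive1 (derive1 (z t))) t czxx x).
  have bfg (x : R) : x \in `]-L, L[ -> `|f x t - g x| <= e * Z.
    move=> xI; rewrite (Ef _ xI) normrM; have [bzx _] := bz _ _ (rct _ _ tI xI).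
    by apply: (ler_pM (normr_ge0 _) (normr_ge0 _) _ bzx); exact: bE (subo _ _ tI xI).
  have ift : (leb R).-integrable `]-L, L[ (EFin \o f ^~ t).
    by apply: bounded_integrable_oo mft _ => x xI; exact: bf.
  have ig : (leb R).-integrable `]-L, L[ (EFin \o g).
    apply: (bounded_integrable_oo (M := M * Z + M * B + e * Z) mg) => x xI.
    rewrite [g x](_ : _ = f x t - (f x t - g x)); last by ring.
    by apply: le_trans (ler_normB _ _) _; apply: lerD; [exact: bf|exact: bfg].
  rewrite -Eg -(RintegralB _ ift ig); last exact: measurable_itv.
  rewrite [2 * L](_ : _ = L - - L); last by ring.
  by apply: Rintegral_bound_oo bfg; [exact: ltW|exact: measurable_funB].
pose I t := \int[leb R]_(x in `]-L, L[) f x t.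
have bI (t : R) : t \in `]0, tau[ -> `|I t| <= (M * Z + M * B) * (L - - L).
  move=> tI; apply: Rintegral_bound_oo; first exact: ltW.
    by apply: measurable_funTS; exact: (measurable_plane_comp mf').
  by move=> x xI; exact: bf.
have mI : measurable_fun `]0, tau[ I.
  have [||||_ _ /integrableP[/measurable_EFinP + _] _] := @fubini_dominated _ _ _ _ R (leb R) (leb R) `]0, tau[%classic `]-L, L[%classic
    (fun p => f p.2 p.1) (cst (M * Z + M * B)) (cst 1) (measurable_itv _) (measurable_itv _).
  - exact: measurable_funTS.
  - by apply: (@bounded_integrable_oo _ _ _ `|M * Z + M * B|).
  - by apply: (@bounded_integrable_oo _ _ _ `|1|).
  - by move=> t x /= tI xI; rewrite mulr1; exact: bf.
  - by [].
have mflux : measurable_fun `]0, tau[ (flux L A z).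
  apply: within_oo_measurable => t /mem_itv_oo_cc tI.
  have [d1 _ _] := dA (sub _ _ tI NLI); have [d2 _ _] := dA (sub _ _ tI LI).
  apply: continuous_sub; apply: continuous_mul.
  + exact: is_derive_continuous d1.
  + exact: (@continuous_plane1 _ (fun t => derive1 (z t)) (-L) czx t).
  + exact: is_derive_continuous d2.
  + exact: (@continuous_plane1 _ (fun t => derive1 (z t)) L czx t).
have iI : (leb R).-integrable `]0, tau[ (EFin \o I) by exact: bounded_integrable_oo bI.
have iflux : (leb R).-integrable `]0, tau[ (EFin \o flux L A z).
  apply: (bounded_integrable_oo (M := (M * Z + M * B) * (L - - L) + e * Z * (2 * L)) mflux) => t tI.
  rewrite [flux L A z t](_ : _ = I t - (I t - flux L A z t)); last by ring.
  by apply: le_trans (ler_normB _ _) _; apply: lerD; [exact: bI|exact: inner2].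
rewrite Elhs -(RintegralB _ iI iflux); last exact: measurable_itv.
apply: le_trans (Rintegral_bound_oo (ltW tau_gt0) _ inner2) _.
  exact: measurable_funB.
rewrite subr0 [X in _ <= X](_ : _ = e * Z * (2 * L) * T); last by ring.
apply: ler_wpM2l tauT; apply: mulr_ge0; first exact: mulr_ge0.
  exact: (mulr_ge0 (ler0n _ 2) (ltW L_gt0)).
Qed.

Lemma classical_trajectory : trajectory L T M (e * (2 * L) * T) A.
Proof.
have LI : L \in `[-L, L] by rewrite in_itv/= lexx andbT ltW ?gtrN.
have TI : T \in `[0, T] by rewrite in_itv/= lexx T_ge0.
have e_ge0 : 0 <= e by apply: (le_trans (normr_ge0 _) (bE (t := T) (x := L) _)); rewrite /in_rect TI LI.
split.
  split.
- by move=> t x /bA[].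
- move=> s t x /andP[sI xI] /andP[tI _].
  apply: (@mvt_lipschitz _ (A ^~ x) (At ^~ x) 0 T) => // u uI;
    have uxI : in_rect L T u x by rewrite /in_rect uI.
    by have [] := dA uxI.
  by have [] := bA uxI.
- move=> t x y /andP[tI xI] /andP[_ yI].
  apply: (@mvt_lipschitz _ (A t) (Ax t) (- L) L) => // u uI;
    have uxI : in_rect L T t u by rewrite /in_rect tI.
    by have [] := dA uxI.
  by have [] := bA uxI.
- move=> tau z Z; rewrite in_itv/= => /andP[+ tauT] [az bz].
  (* For [tau = 0] there is no time integral, and the pairing vanishes with the initial state. *)
  rewrite le_eqVlt => /predU1P[tau0|tau_gt0]; last exact: green.
  rewrite /green_gap -tau0 set_itvoo0 Rintegral_set0 subr0.
  have Z_ge0 : 0 <= Z.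
    have rI : in_rect L tau 0 L by rewrite /in_rect LI andbT -tau0 in_itv/= lexx.
    by have [H _] := bz _ _ rI; exact: (le_trans (normr_ge0 _) H).
  rewrite [X in `|X|](_ : _ = 0) ?normr0; first by rewrite !mulr_ge0// ltW.
  under eq_Rintegral => x do [rewrite inE => xI; rewrite A0 ?mul0r; last exact: mem_itv_oo_cc].
  by rewrite Rintegral_cst// mul0r.
Qed.

End classical.

Lemma lipschitz_continuous_oo (R : realType) (f : R -> R) (a b M : R) :
  (forall x y, x \in `[a, b] -> y \in `[a, b] -> `|f x - f y| <= M * `|x - y|) ->
  forall x, x \in `]a, b[ -> {for x, continuous f}.
Proof.
move=> fM x xI; have M0 : 0 < `|M| + 1 by exact: ltr_wpDl.
apply/cvgrPdist_le => /= e e0; near=> y.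
have yI : y \in `]a, b[ by near: y; exact: near_in_itvoo.
apply: le_trans (fM _ _ (mem_itv_oo_cc xI) (mem_itv_oo_cc yI)) _.
apply: (@le_trans _ _ ((`|M| + 1) * `|x - y|)).
  by apply: ler_wpM2r => //; rewrite (le_trans (ler_norm M))// lerDl.
rewrite mulrC -ler_pdivlMr//.
near: y; exact: (cvgrPdist_le _ _).1 cvg_id _ (divr_gt0 e0 M0).
Unshelve. all: by end_near. Qed.

Lemma le0_of_all_eps (R : realType) (x C : R) :
  (forall e, 0 < e -> x <= e * C) -> x <= 0.
Proof.
move=> xe; apply/ler_addgt0Pr => e e0; rewrite add0r.
have C0 : 0 < `|C| + 1 by exact: ltr_wpDl.
apply: le_trans (xe (e / (`|C| + 1)) (divr_gt0 e0 C0)) _.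
rewrite mulrAC ler_pdivrMr// ler_pM2l// (le_trans (ler_norm C))// lerDl.
by [].
Qed.

(** * Uniform limits of approximate trajectories *)

Section trajectory_closure.
Context {R : realType}.
Variables (L T : R).
Hypotheses (L_gt0 : 0 < L) (T_ge0 : 0 <= T).

Let LL : - L < L. Proof. by rewrite gtrN. Qed.
Let LI : L \in `[- L, L]. Proof. by rewrite in_itv/= lexx ltW. Qed.
Let NLI : - L \in `[- L, L]. Proof. by rewrite in_itv/= lexx ltW. Qed.

Lemma rect_le (tau t x : R) : tau \in `[0, T] -> in_rect L tau t x -> in_rect L T t x.
Proof.
rewrite /in_rect !in_itv/= => /andP[_ tT] /andP[/andP[-> tx] ->].
by rewrite andbT /= (le_trans tx).
Qed.

Lemma rect_oo (tau t x : R) : t \in `]0, tau[ -> x \in `[- L, L] -> in_rect L tau t x.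
Proof. by move=> /mem_itv_oo_cc tI xI; rewrite /in_rect tI. Qed.

Lemma rect_last (tau x : R) : 0 <= tau -> x \in `]- L, L[ -> in_rect L tau tau x.
Proof. by move=> t0 /mem_itv_oo_cc xI; rewrite /in_rect xI in_itv/= lexx t0. Qed.

Section fixed.
Variables (M : R) (U : R -> R -> R).
Hypothesis TU : bounded_lipschitz L T M U.

Lemma bounded_lipschitz_ge0 : 0 <= M.
Proof.
have [H _ _] := TU.
by apply: (le_trans (normr_ge0 _) (H 0 L _)); rewrite /in_rect LI in_itv/= lexx T_ge0.
Qed.

Lemma bounded_lipschitz_measurable_x t : t \in `[0, T] -> measurable_fun `]- L, L[ (U t).
Proof.
move=> tI; have [_ _ H] := TU.
apply: within_oo_measurable => x xI.
apply: (lipschitz_continuous_oo (a := - L) (b := L) (M := M)) xI => u v uI vI.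
by apply: H; rewrite /in_rect tI ?uI ?vI.
Qed.

Lemma bounded_lipschitz_measurable_t x : x \in `[- L, L] -> measurable_fun `]0, T[ (U ^~ x).
Proof.
move=> xI; have [_ H _] := TU.
apply: within_oo_measurable => t tI.
apply: (lipschitz_continuous_oo (a := 0) (b := T) (M := M)) tI => u v uI vI.
by apply: H; rewrite /in_rect xI ?uI ?vI.
Qed.

Variables (tau : R) (z : R -> R -> R) (Z : R).
Hypotheses (tauI : tau \in `[0, T]) (bzz : bounded_adjoint L tau Z z).
Let az := bzz.1.
Let bz := bzz.2.

Let tau_ge0 : 0 <= tau. Proof. by move: tauI; rewrite in_itv/= => /andP[]. Qed.

Lemma adjoint_measurable_x : measurable_fun `]- L, L[ (z tau).
Proof.
have [[_ cz _ _ _] _ _] := az.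
apply: within_oo_measurable => x _; exact: (@continuous_plane2 _ z tau cz x).
Qed.

Lemma adjoint_measurable_dx x : measurable_fun `]0, tau[ (fun t => derive1 (z t) x).
Proof.
have [[_ _ _ cz _] _ _] := az.
by apply: within_oo_measurable => t _; exact: (@continuous_plane1 _ (fun t => derive1 (z t)) x cz t).
Qed.

Lemma pairing_measurable : measurable_fun `]- L, L[ (fun x => U tau x * z tau x).
Proof.
by apply: measurable_funM; [exact: bounded_lipschitz_measurable_x|exact: adjoint_measurable_x].
Qed.

Lemma flux_measurable : measurable_fun `]0, tau[ (flux L U z).
Proof.
have sub : `]0, tau[%classic `<=` `]0, T[%classic.
  by apply: subset_itvl; rewrite bnd_simp; move: tauI; rewrite in_itv/= => /andP[].
by apply: measurable_funB; apply: measurable_funM;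
  by [exact: adjoint_measurable_dx|apply: measurable_funS sub _ => //;
      exact: bounded_lipschitz_measurable_t].
Qed.

Lemma pairing_bound x : x \in `]- L, L[ -> `|U tau x * z tau x| <= M * Z.
Proof.
move=> xI; have rI := rect_last tau_ge0 xI.
have [H _ _] := TU; have [bz1 _] := bz rI.
by rewrite normrM; apply: (ler_pM (normr_ge0 _) (normr_ge0 _) _ bz1); exact: H (rect_le tauI rI).
Qed.

Lemma flux_bound t : t \in `]0, tau[ -> `|flux L U z t| <= M * (2 * Z).
Proof.
move=> tI; have [H _ _] := TU.
have r1 := rect_oo tI LI; have r2 := rect_oo tI NLI.
have [_ b1] := bz r1; have [_ b2] := bz r2.
have -> : M * (2 * Z) = M * Z + M * Z by ring.
apply: le_trans (ler_normB _ _) _; rewrite !normrM; apply: lerD.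
  by apply: (ler_pM (normr_ge0 _) (normr_ge0 _) _ b2); exact: H (rect_le tauI r2).
by apply: (ler_pM (normr_ge0 _) (normr_ge0 _) _ b1); exact: H (rect_le tauI r1).
Qed.

Lemma pairing_integrable :
  (leb R).-integrable `]- L, L[ (EFin \o (fun x => U tau x * z tau x)).
Proof. exact: bounded_integrable_oo pairing_measurable pairing_bound. Qed.

Lemma flux_integrable : (leb R).-integrable `]0, tau[ (EFin \o flux L U z).
Proof. exact: bounded_integrable_oo flux_measurable flux_bound. Qed.

End fixed.

(** Neither the pairing nor the flux involves derivatives of [U], so uniform convergence with a
    common [M] is enough. The same sequence [eps] measures the defect and the distance to the limit.
    It lets truncated series, which solve the equation only approximately, yield an exact
    trajectory. *)
Lemma trajectory_limit (M : R) (eps : nat -> R) (A : nat -> R -> R -> R) (U : R -> R -> R) :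
  eps @ \oo --> (0 : R) ->
  (forall n, trajectory L T M (eps n) (A n)) ->
  (forall n t x, in_rect L T t x -> `|U t x - A n t x| <= eps n) ->
  trajectory L T M 0 U.
Proof.
move=> eps0 TA UA.
have small (e : R) : 0 < e -> exists n, eps n <= e.
  move=> e0; have [N _ /(_ N (leqnn N))] := (cvgrPdist_le _ _).1 eps0 e e0.
  by rewrite /= sub0r normrN => /(le_trans (ler_norm _)) H; exists N.
have b1 t x : in_rect L T t x -> `|U t x| <= M.
  move=> r; rewrite -subr_le0; apply: (@le0_of_all_eps _ _ 1) => e e0; rewrite mulr1.
  have [n ne] := small _ e0.
  have [[H _ _] _] := TA n; have := H _ _ r; have := UA n _ _ r.
  have := ler_normD (U t x - A n t x) (A n t x); rewrite subrK.
  by move: ne; lra.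
have b2 s t x : in_rect L T s x -> in_rect L T t x -> `|U s x - U t x| <= M * `|s - t|.
  move=> r1 r2; rewrite -subr_le0; apply: (@le0_of_all_eps _ _ 2) => e e0.
  have [n ne] := small _ e0.
  have [[_ H _] _] := TA n; have := H _ _ _ r1 r2.
  have := UA n _ _ r1; have := UA n _ _ r2.
  have -> : U s x - U t x = (U s x - A n s x) - (U t x - A n t x) + (A n s x - A n t x) by ring.
  have := ler_normD (U s x - A n s x - (U t x - A n t x)) (A n s x - A n t x).
  have := ler_normB (U s x - A n s x) (U t x - A n t x).
  by move: ne; lra.
have b3 t x y : in_rect L T t x -> in_rect L T t y -> `|U t x - U t y| <= M * `|x - y|.
  move=> r1 r2; rewrite -subr_le0; apply: (@le0_of_all_eps _ _ 2) => e e0.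
  have [n ne] := small _ e0.
  have [[_ _ H] _] := TA n; have := H _ _ _ r1 r2.
  have := UA n _ _ r1; have := UA n _ _ r2.
  have -> : U t x - U t y = (U t x - A n t x) - (U t y - A n t y) + (A n t x - A n t y) by ring.
  have := ler_normD (U t x - A n t x - (U t y - A n t y)) (A n t x - A n t y).
  have := ler_normB (U t x - A n t x) (U t y - A n t y).
  by move: ne; lra.
have BU : bounded_lipschitz L T M U by [].
split => // tau z Z tauI bz; rewrite mul0r.
have [az bz'] := bz.
have tau_ge0 : 0 <= tau by move: tauI; rewrite in_itv/= => /andP[].
have Z_ge0 : 0 <= Z.
  have rI : in_rect L tau tau L by rewrite /in_rect LI in_itv/= lexx tau_ge0.
  by have [H _] := bz' _ _ rI; exact: (le_trans (normr_ge0 _) H).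
(* The three terms account for the defect of [A n], and for the changes in the pairing and in the
   flux when [U] is replaced by [A n]. *)
apply: (@le0_of_all_eps _ _ (Z + Z * (2 * L) + 2 * Z * tau)) => e e0.
have [n ne] := small _ e0.
have [BA GA] := TA n; have gA := GA _ _ _ tauI bz.
have -> : green_gap L U z tau = green_gap L (A n) z tau +
    \int[leb R]_(x in `]- L, L[) (U tau x * z tau x - A n tau x * z tau x) -
    \int[leb R]_(t in `]0, tau[) (flux L U z t - flux L (A n) z t).
  rewrite /green_gap.
  rewrite (RintegralB _ (pairing_integrable BU tauI bz) (pairing_integrable BA tauI bz)); last exact: measurable_itv.
  rewrite (RintegralB _ (flux_integrable BU tauI bz) (flux_integrable BA tauI bz)); last exact: measurable_itv.
  by ring.
have p1 : `|\int[leb R]_(x in `]- L, L[) (U tau x * z tau x - A n tau x * z tau x)| <= (e * Z) * (L - - L).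
  apply: Rintegral_bound_oo; first exact: ltW.
    by apply: measurable_funB; [exact: (pairing_measurable BU tauI bz)|exact: (pairing_measurable BA tauI bz)].
  move=> x xI; rewrite -mulrBl normrM.
  have rI := rect_last tau_ge0 xI; have [b _] := bz' _ _ rI.
  apply: (ler_pM (normr_ge0 _) (normr_ge0 _) _ b).
  by apply: le_trans ne; exact: UA (rect_le tauI rI).
have p2 : `|\int[leb R]_(t in `]0, tau[) (flux L U z t - flux L (A n) z t)| <= (e * Z + e * Z) * (tau - 0).
  apply: Rintegral_bound_oo; first by [].
    by apply: measurable_funB; [exact: (flux_measurable BU tauI bz)|exact: (flux_measurable BA tauI bz)].
  move=> t tI; have r1 := rect_oo tI LI; have r2 := rect_oo tI NLI.
  have [_ z1] := bz' _ _ r1; have [_ z2] := bz' _ _ r2.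
  have -> : flux L U z t - flux L (A n) z t =
    (U t (- L) - A n t (- L)) * derive1 (z t) (- L) - (U t L - A n t L) * derive1 (z t) L.
    by rewrite /flux; ring.
  apply: le_trans (ler_normB _ _) _; rewrite !normrM; apply: lerD.
    by apply: (ler_pM (normr_ge0 _) (normr_ge0 _) _ z2); apply: le_trans ne; exact: UA (rect_le tauI r2).
  by apply: (ler_pM (normr_ge0 _) (normr_ge0 _) _ z1); apply: le_trans ne; exact: UA (rect_le tauI r1).
apply: le_trans (ler_normB _ _) _.
have -> : e * (Z + Z * (2 * L) + 2 * Z * tau) =
   e * Z + (e * Z) * (L - - L) + (e * Z + e * Z) * (tau - 0) by ring.
apply: lerD p2; apply: le_trans (ler_normD _ _) _; apply: lerD p1.
by apply: le_trans gA _; exact: ler_wpM2r.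
Qed.

End trajectory_closure.

(** * Linear combinations and superpositions of trajectories *)

Section trajectory_operations.
Context {R : realType}.
Variables (L T : R).
Hypotheses (L_gt0 : 0 < L) (T_ge0 : 0 <= T).

Lemma trajectory_green (M : R) (U z : R -> R -> R) (tau Z : R) :
  trajectory L T M 0 U -> tau \in `[0, T] -> bounded_adjoint L tau Z z ->
  \int[leb R]_(x in `]- L, L[) (U tau x * z tau x) =
  \int[leb R]_(t in `]0, tau[) flux L U z t.
Proof.
move=> [_ H] tauI bz; apply/eqP; rewrite -subr_eq0 -normr_le0.
by have := H _ _ _ tauI bz; rewrite mul0r.
Qed.

Lemma trajectory_weaken (M M' : R) (U : R -> R -> R) : M <= M' ->
  trajectory L T M 0 U -> trajectory L T M' 0 U.
Proof.
move=> MM [[b1 b2 b3] g]; split => //; split.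
- by move=> t x r; exact: (le_trans (b1 _ _ r) MM).
- by move=> s t x r1 r2; apply: (le_trans (b2 _ _ _ r1 r2)); exact: ler_wpM2r.
- by move=> t x y r1 r2; apply: (le_trans (b3 _ _ _ r1 r2)); exact: ler_wpM2r.
Qed.

Lemma trajectoryZ (M c : R) (U : R -> R -> R) : trajectory L T M 0 U ->
  trajectory L T (`|c| * M) 0 (fun t x => c * U t x).
Proof.
move=> TU; have [BU _] := TU; have [b1 b2 b3] := BU.
split.
  split.
  - by move=> t x r; rewrite normrM; apply: ler_wpM2l => //; exact: b1.
  - by move=> s t x r1 r2; rewrite -mulrBr normrM -mulrA; apply: ler_wpM2l => //; exact: b2.
  - by move=> t x y r1 r2; rewrite -mulrBr normrM -mulrA; apply: ler_wpM2l => //; exact: b3.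
move=> tau z Z tauI bz; rewrite mul0r normr_le0 /green_gap subr_eq0; apply/eqP.
have -> : flux L (fun t x => c * U t x) z = (fun t => c * flux L U z t).
  by apply/funext => t; rewrite /flux; ring.
rewrite (RintegralZl _ _ (flux_integrable L_gt0 BU tauI bz)); last exact: measurable_itv.
under eq_Rintegral do rewrite -mulrA.
rewrite (RintegralZl _ _ (pairing_integrable BU tauI bz)); last exact: measurable_itv.
by rewrite (trajectory_green TU tauI bz).
Qed.

Lemma trajectoryD (M1 M2 : R) (U V : R -> R -> R) :
  trajectory L T M1 0 U -> trajectory L T M2 0 V ->
  trajectory L T (M1 + M2) 0 (fun t x => U t x + V t x).
Proof.
move=> TU TV; have [BU _] := TU; have [BV _] := TV.
have [b1 b2 b3] := BU; have [c1 c2 c3] := BV.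
split.
  split.
  - move=> t x r; apply: (le_trans (ler_normD _ _)).
    by apply: lerD; [exact: b1|exact: c1].
  - move=> s t x r1 r2; rewrite opprD addrACA mulrDl; apply: (le_trans (ler_normD _ _)).
    by apply: lerD; [exact: b2|exact: c2].
  - move=> t x y r1 r2; rewrite opprD addrACA mulrDl; apply: (le_trans (ler_normD _ _)).
    by apply: lerD; [exact: b3|exact: c3].
move=> tau z Z tauI bz; rewrite mul0r normr_le0 /green_gap subr_eq0; apply/eqP.
have -> : flux L (fun t x => U t x + V t x) z = (fun t => flux L U z t + flux L V z t).
  by apply/funext => t; rewrite /flux; ring.
rewrite (RintegralD _ (flux_integrable L_gt0 BU tauI bz) (flux_integrable L_gt0 BV tauI bz)); last exact: measurable_itv.
under eq_Rintegral do rewrite mulrDl.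
rewrite (RintegralD _ (pairing_integrable BU tauI bz) (pairing_integrable BV tauI bz)); last exact: measurable_itv.
by rewrite (trajectory_green TU tauI bz) (trajectory_green TV tauI bz).
Qed.

Section parameter_integral.
Context d (W : measurableType d) (nu : {sigma_finite_measure set W -> \bar R}).
Variables (D : set W) (g : W -> R) (A : W -> R -> R -> R).
Hypothesis mD : measurable D.
Hypothesis ig : nu.-integrable D (EFin \o g).
Hypothesis mA : measurable_fun setT (fun p : W * (R * R) => A p.1 p.2.1 p.2.2).
Hypothesis TA : forall w, D w -> trajectory L T (g w) 0 (A w).

Let U t x := \int[nu]_(w in D) A w t x.

Let mAd d' (V : measurableType d') (a b : V -> R) (c : V -> W) :
  measurable_fun setT c -> measurable_fun setT a -> measurable_fun setT b ->
  measurable_fun setT (fun v => A (c v) (a v) (b v)).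
Proof.
move=> mc ma mb.
exact: (measurableT_comp mA (measurable_fun_pair mc (measurable_fun_pair ma mb))).
Qed.

Let mAtx t x E : measurable_fun E (fun w => A w t x).
Proof. by apply: measurable_funTS; apply: mAd. Qed.

Lemma parameter_integrable t x : in_rect L T t x ->
  nu.-integrable D (fun w => (A w t x)%:E).
Proof.
move=> r; apply: (le_integrable mD _ _ ig); first exact/measurable_EFinP.
move=> w Dw /=; rewrite lee_fin; apply: le_trans (ler_norm _).
by have [[H _ _] _] := TA Dw; exact: H.
Qed.

Let norm_int (a : W -> R) (c : R) : nu.-integrable D (EFin \o a) ->
  (forall w, D w -> `|a w| <= g w * c) -> `|\int[nu]_(w in D) a w| <= (\int[nu]_(w in D) g w) * c.
Proof.
move=> ia agc; rewrite -RintegralZr//.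
apply: le_trans (le_normr_Rintegral mD ia) _; apply: le_Rintegral => //.
- exact: integrable_norm.
- by have := integrableZr mD c ig; apply: eq_integrable => // w _ /=; rewrite EFinM.
Qed.

Let bU : bounded_lipschitz L T (\int[nu]_(w in D) g w) U.
Proof.
split.
- move=> t x r; rewrite -[leRHS]mulr1; apply: norm_int; first exact: parameter_integrable.
  by move=> w Dw; rewrite mulr1; have [[H _ _] _] := TA Dw; exact: H.
- move=> s t x r1 r2.
  rewrite /U -(RintegralB mD (parameter_integrable r1) (parameter_integrable r2)).
  apply: norm_int; last by move=> w Dw; have [[_ H _] _] := TA Dw; exact: H.
  exact: (integrableB mD (parameter_integrable r1) (parameter_integrable r2)).
- move=> t x y r1 r2.
  rewrite /U -(RintegralB mD (parameter_integrable r1) (parameter_integrable r2)).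
  apply: norm_int; last by move=> w Dw; have [[_ _ H] _] := TA Dw; exact: H.
  exact: (integrableB mD (parameter_integrable r1) (parameter_integrable r2)).
Qed.

(** Since [g w] bounds [A w], the products with z and z_x are dominated by [g w] times a constant.
    Fubini's theorem then exchanges the parameter with x in the pairing and with t in the flux, and
    the identity holds for each parameter. *)
Lemma trajectory_parameter_integral :
  trajectory L T (\int[nu]_(w in D) g w) 0 U.
Proof.
split; first exact: bU.
move=> tau z Z tauI bz; rewrite mul0r normr_le0 /green_gap subr_eq0; apply/eqP.
have [az bz'] := bz; have [[_ cz _ czx _] _ _] := az.
have tau_ge0 : 0 <= tau by move: tauI; rewrite in_itv/= => /andP[].
have LI : L \in `[- L, L] by rewrite in_itv/= lexx andbT ltW ?gtrN.
have NLI : - L \in `[- L, L] by rewrite in_itv/= lexx ltW ?gtrN.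
have mz : measurable_fun setT (z tau).
  by apply: continuous_measurable_fun => x; exact: (@continuous_plane2 _ z tau cz x).
have mzx x : measurable_fun setT (fun t => derive1 (z t) x).
  by apply: continuous_measurable_fun => t; exact: (@continuous_plane1 _ (fun t => derive1 (z t)) x czx t).
have ic a b (k : R) : (leb R).-integrable `]a, b[ (EFin \o cst k).
  by apply: (@bounded_integrable_oo _ _ _ `|k|) => // x _.
pose P (p : W * R) := A p.1 tau p.2 * z tau p.2.
have mP : measurable_fun (D `*` `]- L, L[) P.
  apply: measurable_funTS; apply: measurable_funM; last exact: (measurableT_comp mz measurable_snd).
  by apply: mAd; [exact: measurable_fst|exact: measurable_cst|exact: measurable_snd].
have bP w x : D w -> `]- L, L[%classic x -> `|P (w, x)| <= g w * cst Z x.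
  by move=> Dw xI; have [H _] := TA Dw; exact: (pairing_bound H tauI bz).
have [_ _ _ fubP] := @fubini_dominated _ _ _ _ R nu (leb R) _ _ _ _ _ mD (measurable_itv _) mP ig (ic (-L) L Z) bP.
pose Q (p : W * R) := flux L (A p.1) z p.2.
have mQ : measurable_fun (D `*` `]0, tau[) Q.
  apply: measurable_funTS; apply: measurable_funB; apply: measurable_funM.
  - by apply: mAd; [exact: measurable_fst|exact: measurable_snd|exact: measurable_cst].
  - exact: (measurableT_comp (mzx _) measurable_snd).
  - by apply: mAd; [exact: measurable_fst|exact: measurable_snd|exact: measurable_cst].
  - exact: (measurableT_comp (mzx _) measurable_snd).
have bQ w t : D w -> `]0, tau[%classic t -> `|Q (w, t)| <= g w * cst (2 * Z) t.
  by move=> Dw xI; have [H _] := TA Dw; exact: (flux_bound L_gt0 H tauI bz).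
have [_ _ _ fubQ] := @fubini_dominated _ _ _ _ R nu (leb R) _ _ _ _ _ mD (measurable_itv _) mQ ig (ic 0 tau (2 * Z)) bQ.
transitivity (\int[nu]_(w in D) \int[leb R]_(x in `]- L, L[) P (w, x)).
  rewrite fubP; apply: eq_Rintegral => x; rewrite inE => xI.
  by rewrite /P /= RintegralZr//; exact: (parameter_integrable (rect_le tauI (rect_last tau_ge0 xI))).
transitivity (\int[nu]_(w in D) \int[leb R]_(t in `]0, tau[) Q (w, t)).
  by apply: eq_Rintegral => w; rewrite inE => Dw; exact: (trajectory_green (TA Dw) tauI bz).
rewrite fubQ; apply: eq_Rintegral => t; rewrite inE => tI.
have r1 := rect_le tauI (rect_oo tI LI); have r2 := rect_le tauI (rect_oo tI NLI).
have i1 := parameter_integrable r1; have i2 := parameter_integrable r2.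
rewrite /Q /flux/= /U -(RintegralZr _ mD i1) -(RintegralZr _ mD i2) -RintegralB//.
- have := integrableZr mD (derive1 (z t) (- L)) i2.
  by apply: eq_integrable => // w _ /=; rewrite EFinM.
- have := integrableZr mD (derive1 (z t) L) i1.
  by apply: eq_integrable => // w _ /=; rewrite EFinM.
Qed.

End parameter_integral.
End trajectory_operations.

Lemma is_derive_flat_at0 (R : realType) (f : R -> R) (C : R) :
  (forall h, `|f h| <= C * h ^+ 2) -> is_derive (0 : R) 1 f 0.
Proof.
move=> fC.
have f0 : f 0 = 0.
  by apply/eqP; rewrite -normr_le0; have := fC 0; rewrite expr0n mulr0.
have H : h^-1 *: ((f \o shift (0 : R)) (h *: 1) - f 0) @[h --> (0 : R)^'] --> (0 : R).
  apply/cvgrPdist_le => e e0.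
  have C0 : 0 < `|C| + 1 by exact: ltr_wpDl.
  near=> h.
  have h0 : h != 0 by near: h; exact: nbhs_dnbhs_neq.
  rewrite f0 subr0 sub0r normrN /= addr0 /GRing.scale/= mulr1 normrM normfV.
  rewrite mulrC ler_pdivrMr ?normr_gt0//.
  apply: (le_trans (fC h)); rewrite -(real_normK (num_real h)).
  rewrite expr2 mulrA; apply: ler_wpM2r => //.
  apply: (@le_trans _ _ ((`|C| + 1) * `|h|)).
    by apply: ler_wpM2r => //; rewrite (le_trans (ler_norm C))// lerDl.
  rewrite mulrC -ler_pdivlMr//.
  near: h; apply: dnbhs0_le; exact: divr_gt0.
apply: DeriveDef; first by apply/cvg_ex; exists 0.
by rewrite /derive; apply/cvg_lim.
Unshelve. all: by end_near. Qed.

(** Quadratic decay at 0 from the right forces the derivative 0 there, so that a function extended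
    by zero to negative arguments is differentiable across 0. This serves heat kernels at their
    emission time, the functions exp (- c / t), and the Laplace integrands. *)
Lemma is_derive_flat (R : realType) (f f' : R -> R) (C : R) :
  (forall r : R, r <= 0 -> f r = 0 /\ f' r = 0) ->
  (forall r : R, 0 < r -> is_derive r 1 f (f' r)) ->
  (forall r : R, 0 < r -> `|f r| <= C * r ^+ 2) ->
  forall r : R, is_derive r 1 f (f' r).
Proof.
move=> f0 df fC r; have [r0|r0|->] := ltgtP r 0; last 1 first.
- have [_ ->] := f0 0 (lexx _); apply: (@is_derive_flat_at0 _ _ `|C|) => h.
  have [h0|h0] := leP h 0.
    by have [-> _] := f0 h h0; rewrite normr0 mulr_ge0// sqr_ge0.
  by apply: (le_trans (fC h h0)); rewrite ler_wpM2r ?sqr_ge0// ler_norm.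
- have [_ ->] := f0 r (ltW r0).
  apply: near_eq_is_derive (is_derive_cst (0 : R) r 1).
  near=> s; have s0 : s <= 0 by apply/ltW; near: s; exact: lt_nbhsl.
  by have [-> _] := f0 s s0.
- exact: df.
Unshelve. all: by end_near. Qed.

(** A single term of the exponential series; the bounds of powers against exponential decay below
    reduce to it. *)
Lemma expRN_pow_le (R : realType) (n : nat) (x : R) : 0 <= x ->
  x ^+ n * expR (- x) <= n`!%:R.
Proof.
move=> x0; case: n => [|n].
  by rewrite expr0 mul1r fact0 -expR0 ler_expR oppr_le0.
have := expR_ge1Dxn n x0; rewrite expRN => H.
rewrite ler_pdivrMr ?expR_gt0// mulrC -ler_pdivrMr ?ltr0n ?fact_gt0//.
by apply: le_trans H; rewrite lerDr.
Qed.

(** * Heat kernels *)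

Section calculus.
Context {R : realType}.
Implicit Types (f g : R -> R) (x a k : R).

Lemma is_derive_scale k f x a :
  is_derive x 1 f a -> is_derive x 1 (fun y => k * f y) (k * a).
Proof. by move=> fa; exact: is_deriveZ. Qed.

Lemma is_derive_pow n f x a :
  is_derive x 1 f a -> is_derive x 1 (fun y => f y ^+ n) (n%:R * f x ^+ n.-1 * a).
Proof.
move=> fa; elim: n => [|n IH].
  by rewrite !mul0r; under eq_fun do rewrite expr0; exact: is_derive_cst.
under eq_fun do rewrite exprS; apply: (is_derive_cast (is_derive_mul fa IH)).
case: n {IH} => [|n]; first by rewrite expr0; ring.
by rewrite /= [f x ^+ n.+1]exprS -[n.+2%:R]natr1; ring.
Qed.

Lemma is_derive_inv f x a : f x != 0 ->
  is_derive x 1 f a -> is_derive x 1 (fun y => (f y)^-1) (- a / f x ^+ 2).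
Proof.
move=> fx fa; apply: is_derive_cast (is_deriveV fx fa) _.
by rewrite /GRing.scale/= !mulNr mulrC.
Qed.

Lemma is_derive_comp f g x a b :
  is_derive x 1 g a -> is_derive (g x) 1 f b ->
  is_derive x 1 (fun y => f (g y)) (b * a).
Proof. by move=> ga fb; exact: is_derive1_comp. Qed.

Lemma is_derive_exp f x a :
  is_derive x 1 f a -> is_derive x 1 (fun y => expR (f y)) (expR (f x) * a).
Proof. by move=> fa; apply: is_derive_comp fa _; exact: is_derive_expR. Qed.

End calculus.

Lemma measurable_inv (R : realType) : measurable_fun setT (@GRing.inv R).
Proof.
have -> : [set: R] = [set x | x != 0] `|` [set 0].
  by apply/esym; rewrite -subTset => x _ /=; have [->|] := eqVneq x 0; [right|left].
have o : open [set x : R | x != 0] by exact: open_neq.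
apply/measurable_funU => //; first exact: open_measurable.
split; last exact: measurable_fun_set1.
apply: open_continuous_measurable_fun => // x; rewrite inE/= => x0.
exact: inv_continuous.
Qed.

Section heat_family.
Context {R : realType}.

(* [r ^ (- j - 1/2) * exp (- xi^2 / 4r)]; since [Num.sqrt r = 0] for [r <= 0],
   it vanishes for nonpositive times. *)
Definition hk (j : nat) (r xi : R) : R :=
  r^-1 ^+ j * (Num.sqrt r)^-1 * expR (- (xi ^+ 2 / (4 * r))).

Lemma hk_le0 j r xi : r <= 0 -> hk j r xi = 0.
Proof. by move=> r0; rewrite /hk ler0_sqrtr// invr0 mulr0 mul0r. Qed.

Lemma hk_ge0 j r xi : 0 <= hk j r xi.
Proof.
have [r0|r0] := leP r 0; first by rewrite hk_le0.
by rewrite !mulr_ge0// ?expR_ge0// ?invr_ge0 ?sqrtr_ge0// exprn_ge0// invr_ge0 ltW.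
Qed.

Lemma hkS j k r xi : r^-1 ^+ k * hk j r xi = hk (k + j) r xi.
Proof. by rewrite /hk exprD; ring. Qed.

(** Bounds for r^-j exp (- d^2 / 4r) and r^-(j+1) exp (- d^2 / 4r), which appear once r^(-1/2) is
    replaced by 1 + r^-1. *)
Definition hk_bound (d : R) j : R :=
  j`!%:R * (4 / d ^+ 2) ^+ j + (j.+1)`!%:R * (4 / d ^+ 2) ^+ j.+1.

Lemma hk_bound_ge0 d j : 0 <= hk_bound d j.
Proof.
by rewrite /hk_bound addr_ge0// mulr_ge0// exprn_ge0// mulr_ge0// invr_ge0 sqr_ge0.
Qed.

Lemma hk_le j (d r xi : R) : 0 < d -> d <= `|xi| -> hk j r xi <= hk_bound d j.
Proof.
move=> d0 dxi; have [r0|r0] := leP r 0; first by rewrite hk_le0// hk_bound_ge0.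
have P k : r^-1 ^+ k * expR (- (d ^+ 2 / (4 * r))) <= k`!%:R * (4 / d ^+ 2) ^+ k.
  have -> : r^-1 = (d ^+ 2 / (4 * r)) * (4 / d ^+ 2).
    by field; rewrite !gt_eqF.
  rewrite exprMn mulrAC; apply: ler_wpM2r.
    by rewrite exprn_ge0// divr_ge0// sqr_ge0.
  by apply: expRN_pow_le; rewrite divr_ge0 ?sqr_ge0// mulr_ge0// ltW.
have S : (Num.sqrt r)^-1 <= 1 + r^-1.
  have [r1|r1] := leP 1 r.
    apply: (@le_trans _ _ 1); last by rewrite lerDl invr_ge0 ltW.
    by rewrite invf_le1 ?sqrtr_gt0// -[leLHS]sqrtr1 ler_wsqrtr.
  apply: (@le_trans _ _ r^-1); last by rewrite lerDr.
  rewrite lef_pV2 ?posrE ?sqrtr_gt0//.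
  rewrite -[leLHS](sqr_sqrtr (ltW r0)) expr2 ler_piMl ?sqrtr_ge0//.
  by rewrite -[leRHS]sqrtr1 ler_wsqrtr// ltW.
apply: (@le_trans _ _ (r^-1 ^+ j * (1 + r^-1) * expR (- (d ^+ 2 / (4 * r))))).
  apply: ler_pM.
  - by rewrite mulr_ge0 ?invr_ge0 ?sqrtr_ge0// exprn_ge0// invr_ge0 ltW.
  - exact: expR_ge0.
  - by apply: ler_wpM2l => //; rewrite exprn_ge0// invr_ge0 ltW.
  - rewrite ler_expR lerN2; apply: ler_wpM2r.
      by rewrite invr_ge0 mulr_ge0// ltW.
    by rewrite -(real_normK (num_real xi)) lerXn2r ?nnegrE// ltW.
have -> : r^-1 ^+ j * (1 + r^-1) * expR (- (d ^+ 2 / (4 * r))) =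
  r^-1 ^+ j * expR (- (d ^+ 2 / (4 * r))) + r^-1 ^+ j.+1 * expR (- (d ^+ 2 / (4 * r))).
  by rewrite [r^-1 ^+ j.+1]exprS; ring.
exact: lerD.
Qed.

Lemma is_derive_hk_x j (r xi : R) :
  is_derive xi 1 (hk j r) (- (xi / 2) * hk j.+1 r xi).
Proof.
have [r0|r0] := leP r 0.
  rewrite hk_le0// mulr0 (_ : hk j r = cst 0); first exact: is_derive_cst.
  by apply/funext => y; rewrite hk_le0.
have -> : hk j r = fun y => r^-1 ^+ j * (Num.sqrt r)^-1 * expR (- (4 * r)^-1 * y ^+ 2).
  by apply/funext => y; rewrite /hk mulNr [_^-1 * y ^+ 2]mulrC.
have H := is_derive_scale (- (4 * r)^-1) (is_derive_pow 2 (is_derive_id xi (1 : R))).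
apply: (is_derive_cast (is_derive_scale (r^-1 ^+ j * (Num.sqrt r)^-1) (is_derive_exp H))).
rewrite /hk [r^-1 ^+ j.+1]exprS mulNr [_^-1 * xi ^+ 2]mulrC /= expr1.
by field; rewrite !gt_eqF// sqrtr_gt0.
Qed.

(** Away from [xi = 0] the kernel is O(r^2) as r tends to 0, by [hk_le] at index j + 2, hence
    differentiable across the emission time. For j = 0 the right-hand side is also the second
    x-derivative, so that [hk 0] solves the heat equation for all times. *)
Lemma is_derive_hk_t j (r xi : R) : xi != 0 -> is_derive r 1 (hk j ^~ xi)
  (- (j%:R + 2^-1) * hk j.+1 r xi + xi ^+ 2 / 4 * hk j.+2 r xi).
Proof.
move=> xi0.
pose f' r := - (j%:R + 2^-1) * hk j.+1 r xi + xi ^+ 2 / 4 * hk j.+2 r xi.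
apply: (@is_derive_flat R (hk j ^~ xi) f' (hk_bound `|xi| j.+2)) => {}r r0.
- by rewrite /f' !hk_le0// !mulr0 addr0.
- have rn : r != 0 by rewrite gt_eqF.
  have sn : Num.sqrt r != 0 by rewrite gt_eqF// sqrtr_gt0.
  have Hv := is_derive_inv rn (is_derive_id r (1 : R)).
  have H1 := is_derive_pow j Hv.
  have H2 := is_derive_inv sn (is_derive1_sqrt r0).
  have H3 := is_derive_exp (is_derive_scale (- (xi ^+ 2 / 4)) Hv).
  have -> : hk j ^~ xi = fun s => s^-1 ^+ j * (Num.sqrt s)^-1 * expR (- (xi ^+ 2 / 4) * s^-1).
    by apply/funext => s; rewrite /hk invfM !mulNr mulrA.
  apply: (is_derive_cast (is_derive_mul (is_derive_mul H1 H2) H3)).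
  have Ee : - (xi ^+ 2 / (4 * r)) = - (xi ^+ 2 / 4) / r by field.
  rewrite /f' /hk Ee sqr_sqrtr ?ltW//.
  case: j {f' H1} => [|j]; rewrite /= ?[_ ^+ j.+3]exprS ?[_ ^+ j.+2]exprS ?[_ ^+ j.+1]exprS ?expr0.
    by field; rewrite sn rn.
  by rewrite -natr1; field; rewrite sn rn.
- rewrite ger0_norm ?hk_ge0//.
  have -> : hk j r xi = hk (2 + j) r xi * r ^+ 2.
    by rewrite -hkS exprVn mulrAC mulVf ?mul1r// expf_neq0// gt_eqF.
  apply: ler_wpM2r; first exact: sqr_ge0.
  by apply: hk_le => //; rewrite normr_gt0.
Qed.

Lemma measurable_hk j d (V : measurableType d) (a b : V -> R) :
  measurable_fun setT a -> measurable_fun setT b ->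
  measurable_fun setT (fun v => hk j (a v) (b v)).
Proof.
move=> ma mb.
have mV (c : V -> R) : measurable_fun setT c -> measurable_fun setT (fun v => (c v)^-1).
  by move=> mc; exact: (measurableT_comp (@measurable_inv R) mc).
apply: measurable_funM.
  apply: measurable_funM; first by apply: measurable_funX; exact: mV.
  apply: mV; apply: (measurableT_comp _ ma); apply: continuous_measurable_fun.
  exact: sqrt_continuous.
apply: (measurableT_comp (@measurable_expR R)).
apply: measurableT_comp => //.
apply: measurable_funM; first exact: measurable_funX.
by apply: mV; apply: measurable_funM.
Qed.

End heat_family.

Lemma norm_leD (R : realType) (x y a b : R) :
  `|x| <= a -> `|y| <= b -> `|x + y| <= a + b.
Proof. by move=> xa yb; apply: (le_trans (ler_normD _ _)); exact: lerD. Qed.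

Lemma norm_leB (R : realType) (x y a b : R) :
  `|x| <= a -> `|y| <= b -> `|x - y| <= a + b.
Proof. by move=> xa yb; apply: (le_trans (ler_normB _ _)); exact: lerD. Qed.

Lemma norm_leM (R : realType) (x y a b : R) :
  `|x| <= a -> `|y| <= b -> `|x * y| <= a * b.
Proof. by move=> xa yb; rewrite normrM; exact: ler_pM. Qed.

Lemma norm_leX (R : realType) n (x a : R) : `|x| <= a -> `|x ^+ n| <= a ^+ n.
Proof.
move=> xa; rewrite normrX lerXn2r// ?nnegrE//.
exact: (le_trans (normr_ge0 x) xa).
Qed.

(** * Atoms for s <= T: kernels emitted after time 0 *)

Section causal.
Context {R : realType}.
Variables (L T d X : R).
Hypotheses (L_gt0 : 0 < L) (T_gt0 : 0 < T) (d_gt0 : 0 < d) (X_ge0 : 0 <= X).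

(** The weight s^(-3/2), which completes the factor s^(-1/2) of [hk 0 s] to the s^-2 of the Laplace
    formula. *)
Definition wt (s : R) : R := s^-1 * (Num.sqrt s)^-1.

Lemma wt_ge0 s : 0 < s -> 0 <= wt s.
Proof. by move=> s0; rewrite mulr_ge0// invr_ge0 ?sqrtr_ge0// ltW. Qed.

Lemma inv_sqrt_le (r : R) : 0 < r -> (Num.sqrt r)^-1 <= 1 + r^-1.
Proof.
move=> r0; have [r1|r1] := leP 1 r.
  apply: (@le_trans _ _ 1); last by rewrite lerDl invr_ge0 ltW.
  by rewrite invf_le1 ?sqrtr_gt0// -[leLHS]sqrtr1 ler_wsqrtr.
apply: (@le_trans _ _ r^-1); last by rewrite lerDr.
rewrite lef_pV2 ?posrE ?sqrtr_gt0//.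
rewrite -[leLHS](sqr_sqrtr (ltW r0)) expr2 ler_piMl ?sqrtr_ge0//.
by rewrite -[leRHS]sqrtr1 ler_wsqrtr// ltW.
Qed.

(** Because r <= s, the weight is at most r^-1 (1 + r^-1): the kernel absorbs it by raising its
    index by one or two. The bound is therefore uniform as s tends to 0. *)
Lemma wt_hk_le j (s r xi : R) : 0 < s -> r <= s -> d <= `|xi| ->
  wt s * hk j r xi <= hk_bound d j.+1 + hk_bound d j.+2.
Proof.
move=> s0 rs dxi; have [r0|r0] := leP r 0.
  by rewrite hk_le0// mulr0 addr_ge0// hk_bound_ge0.
apply: (@le_trans _ _ (hk j.+1 r xi + hk j.+2 r xi)); last by apply: lerD; exact: hk_le.
rewrite -[j.+1]/(1 + j)%N -[j.+2]/(2 + j)%N -!hkS -mulrDl; apply: ler_wpM2r; first exact: hk_ge0.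
have sr : s^-1 <= r^-1 by rewrite lef_pV2 ?posrE.
rewrite expr1 expr2 -[X in X + _]mulr1 -mulrDr /wt; apply: ler_pM => //.
- by rewrite invr_ge0 ltW.
- by apply: (le_trans (inv_sqrt_le s0)); rewrite lerD2l.
Qed.

(** The sum of the bounds of [wt_hk_le] for j = 0, 1, 2, 3. *)
Let B : R := hk_bound d 1 + 2 * hk_bound d 2 + 2 * hk_bound d 3 + 2 * hk_bound d 4 + hk_bound d 5.

Let wt_hkB j (s r xi : R) : (j <= 3)%N -> 0 < s -> r <= s -> d <= `|xi| ->
  `|wt s * hk j r xi| <= B.
Proof.
move=> j3 s0 rs dxi; rewrite ger0_norm; last by rewrite mulr_ge0 ?hk_ge0 ?wt_ge0.
apply: le_trans (wt_hk_le j s0 rs dxi) _; rewrite /B.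
have := hk_bound_ge0 d 1; have := hk_bound_ge0 d 2; have := hk_bound_ge0 d 3.
have := hk_bound_ge0 d 4; have := hk_bound_ge0 d 5.
by case: j j3 => [|[|[|[|]]]]//= _; lra.
Qed.

Let B_ge0 : 0 <= B.
Proof. rewrite /B.
have := hk_bound_ge0 d 1; have := hk_bound_ge0 d 2; have := hk_bound_ge0 d 3.
have := hk_bound_ge0 d 4; have := hk_bound_ge0 d 5; lra. Qed.

Variables (s l : R).
Hypotheses (s_gt0 : 0 < s) (sT : s <= T).
Hypothesis lX : forall x : R, x \in `[- L, L] -> d <= `|x - l| <= X.

(** The age at time t of a kernel emitted at time T - s: it equals s at time T and is nonpositive at
    time 0, where the kernel therefore vanishes. *)
Let r t := t - T + s.

Let r_le t : t \in `[0, T] -> r t <= s.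
Proof. by rewrite in_itv/= /r => /andP[_ tT]; rewrite gerDr subr_le0. Qed.

Let xi0 x : x \in `[- L, L] -> x - l != 0.
Proof. by move=> /lX /andP[h _]; rewrite -normr_gt0 (lt_le_trans d_gt0). Qed.

Let dr (t : R) j (x : R) : x - l != 0 -> is_derive t 1 (fun t => hk j (r t) (x - l))
  (- (j%:R + 2^-1) * hk j.+1 (r t) (x - l) + (x - l) ^+ 2 / 4 * hk j.+2 (r t) (x - l)).
Proof.
move=> x0; have dr : is_derive t 1 r 1.
  apply: (is_derive_cast (is_derive_add (is_derive_sub (is_derive_id t (1 : R)) (is_derive_cst T t 1)) (is_derive_cst s t 1))).
  by rewrite subr0 addr0.
by apply: (is_derive_cast (is_derive_comp dr (is_derive_hk_t j (r t) x0))); rewrite mulr1.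
Qed.

Let dx_shift (x : R) : is_derive x 1 (fun x => x - l) 1.
Proof.
by apply: (is_derive_cast (is_derive_sub (is_derive_id x (1 : R)) (is_derive_cst l x 1))); rewrite subr0.
Qed.

Let dx j (t x : R) : is_derive x 1 (fun x => hk j (r t) (x - l))
  (- ((x - l) / 2) * hk j.+1 (r t) (x - l)).
Proof.
by apply: (is_derive_cast (is_derive_comp (dx_shift x) (is_derive_hk_x j (r t) (x - l)))); rewrite mulr1.
Qed.

Let ct j (t x : R) : x - l != 0 -> {for t, continuous (fun t => hk j (r t) (x - l))}.
Proof. by move=> x0; exact: is_derive_continuous (dr t j x0). Qed.

Let cx j (t x : R) : {for x, continuous (fun x => hk j (r t) (x - l))}.
Proof. exact: is_derive_continuous (dx j t x). Qed.

Let mhk j : measurable_fun setT (fun p : R * R => hk j (r p.1) (p.2 - l)).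
Proof.
by apply: measurable_hk; [apply: measurable_funD => //; apply: measurable_funB|apply: measurable_funB].
Qed.

Let cc (c x : R) : {for x, continuous (fun _ : R => c)}.
Proof. exact: cvg_cst. Qed.

Let cxi (x : R) : {for x, continuous (fun x => x - l)}.
Proof. exact: is_derive_continuous (dx_shift x). Qed.

Let cxi2 (x : R) : {for x, continuous (fun x => (x - l) ^+ 2)}.
Proof. by apply: continuous_mul; exact: cxi. Qed.

Let bounds t x : in_rect L T t x ->
  [/\ (forall j, (j <= 3)%N -> `|wt s * hk j (r t) (x - l)| <= B), x - l != 0 & `|x - l| <= X].
Proof.
move=> /andP[tI xI]; have /andP[h1 h2] := lX xI; split => //; last exact: xi0.
by move=> j j3; apply: wt_hkB => //; exact: r_le.
Qed.

(** The sum of the bounds for the values and the t- and x-derivatives of the two atoms below,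
    uniform in [s] and [l]. *)
Definition causal_const : R :=
  B + (2^-1 * B + X ^+ 2 / 4 * B) + X / 2 * B + T * X * B +
  T * X * ((1 + 2^-1) * B + X ^+ 2 / 4 * B) + T * (B + X ^+ 2 / 2 * B).

Let K_ge : [/\ B <= causal_const, 2^-1 * B + X ^+ 2 / 4 * B <= causal_const,
   X / 2 * B <= causal_const & [/\ T * X * B <= causal_const,
   T * X * ((1 + 2^-1) * B + X ^+ 2 / 4 * B) <= causal_const &
   T * (B + X ^+ 2 / 2 * B) <= causal_const]].
Proof.
have T0 := ltW T_gt0; have B0 := B_ge0.
have m1 : 0 <= 2^-1 * B + X ^+ 2 / 4 * B by rewrite addr_ge0 ?mulr_ge0 ?exprn_ge0.
have m2 : 0 <= X / 2 * B by rewrite !mulr_ge0.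
have m3 : 0 <= T * X * B by rewrite !mulr_ge0.
have m4 : 0 <= T * X * ((1 + 2^-1) * B + X ^+ 2 / 4 * B).
  by rewrite mulr_ge0 ?addr_ge0 ?mulr_ge0 ?exprn_ge0.
have m5 : 0 <= T * (B + X ^+ 2 / 2 * B).
  by apply: mulr_ge0 => //; apply: addr_ge0 => //; rewrite mulr_ge0// mulr_ge0// exprn_ge0.
rewrite /causal_const; split; last split; lra.
Qed.

Let n2 (k : R) : 0 <= k -> `|k| <= k. Proof. by move=> k0; rewrite ger0_norm. Qed.

Lemma causal0_trajectory :
  trajectory L T causal_const 0 (fun t x => wt s * hk 0 (t - T + s) (x - l)).
Proof.
have [k1 k2 k3 [k4 k5 k6]] := K_ge.
pose h j t x := wt s * hk j (r t) (x - l).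
pose At t x := - 2^-1 * h 1 t x + (x - l) ^+ 2 / 4 * h 2 t x.
pose Ax t x := - ((x - l) / 2) * h 1 t x.
have mh j : measurable_fun setT (fun p : R * R => h j p.1 p.2) by exact: measurable_funM.
have mx : measurable_fun setT (fun p : R * R => p.2 - l) by exact: measurable_funB.
have -> : 0 = 0 * (2 * L) * T :> R by rewrite !mul0r.
apply: (@classical_trajectory _ _ _ _ 0 (h 0) At Ax At).
- exact: L_gt0.
- exact: ltW.
- exact: mh.
- by apply: measurable_funD; apply: measurable_funM => //; apply: measurable_funM => //; exact: measurable_funX.
- move=> t x /bounds[_ x0 _]; split.
  + by apply: (is_derive_cast (is_derive_scale (wt s) (dr t 0 x0))); rewrite /At /h; ring.
  + by apply: (is_derive_cast (is_derive_scale (wt s) (dx 0 t x))); rewrite /Ax /h; ring.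
  + have D := is_derive_scale (wt s) (dx 1 t x).
    have D2 := is_derive_scale (- 2^-1) (dx_shift x).
    have -> : Ax t = fun x => (- 2^-1 * (x - l)) * h 1 t x by apply/funext => y; rewrite /Ax; ring.
    by apply: (is_derive_cast (is_derive_mul D2 D)); rewrite /At /h; field.
- move=> t x /bounds[_ x0 _].
  by apply: continuous_add; apply: continuous_mul; rewrite ?cc//;
    apply: continuous_mul; rewrite ?cc//; exact: ct.
- move=> t x _; apply: continuous_add; apply: continuous_mul; rewrite ?cc//.
  + by apply: continuous_mul; [exact: cc|exact: cx].
  + by apply: continuous_mul; [exact: cxi2|exact: cc].
  + by apply: continuous_mul; [exact: cc|exact: cx].
- move=> t x /bounds[b x0 bx]; split.
  + exact: (le_trans (b 0 _) k1).
  + apply: le_trans k2; apply: norm_leD; apply: norm_leM; rewrite ?b ?normrN ?n2//.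
    by apply: norm_leM; [exact: norm_leX|rewrite n2].
  + apply: le_trans k3; apply: norm_leM; rewrite ?b ?normrN//.
    by apply: norm_leM; rewrite ?n2.
- by move=> t x _; rewrite subrr normr0.
- move=> x _; rewrite /h hk_le0 ?mulr0//.
  by rewrite /r sub0r addrC subr_le0.
Qed.

(** A dipole: up to the factor - 2 s, this is the x-derivative of the previous atom. At time T the
    factor s turns [hk 1 s] into [hk 0 s], so that the final state is x - l times the Gaussian. *)
Lemma causal1_trajectory :
  trajectory L T causal_const 0 (fun t x => s * (x - l) * (wt s * hk 1 (t - T + s) (x - l))).
Proof.
have [k1 k2 k3 [k4 k5 k6]] := K_ge.
pose h j t x := wt s * hk j (r t) (x - l).
pose A t x := s * (x - l) * h 1 t x.
pose At t x := s * (x - l) * (- (1 + 2^-1) * h 2 t x + (x - l) ^+ 2 / 4 * h 3 t x).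
pose Ax t x := s * (h 1 t x - (x - l) ^+ 2 / 2 * h 2 t x).
have mh j : measurable_fun setT (fun p : R * R => h j p.1 p.2) by exact: measurable_funM.
have mx : measurable_fun setT (fun p : R * R => p.2 - l) by exact: measurable_funB.
have -> : 0 = 0 * (2 * L) * T :> R by rewrite !mul0r.
have ns : `|s| <= T by rewrite gtr0_norm.
apply: (@classical_trajectory _ _ _ _ 0 A At Ax At).
- exact: L_gt0.
- exact: ltW.
- by apply: measurable_funM => //; apply: measurable_funM.
- apply: measurable_funM; first exact: measurable_funM.
  by apply: measurable_funD; apply: measurable_funM => //; apply: measurable_funM => //; exact: measurable_funX.
- move=> t x /bounds[_ x0 _].
  have D2 := is_derive_scale s (dx_shift x).
  split.
  + have D := is_derive_scale (s * (x - l)) (is_derive_scale (wt s) (dr t 1 x0)).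
    by apply: (is_derive_cast D); rewrite /At /h; ring.
  + apply: (is_derive_cast (is_derive_mul D2 (is_derive_scale (wt s) (dx 1 t x)))).
    by rewrite /Ax /h; field.
  + have P2 := is_derive_scale 2^-1 (is_derive_pow 2 (dx_shift x)).
    have -> : Ax t = fun x => s * (h 1 t x - 2^-1 * (x - l) ^+ 2 * h 2 t x) by apply/funext => y; rewrite /Ax; ring.
    apply: (is_derive_cast (is_derive_scale s (is_derive_sub (is_derive_scale (wt s) (dx 1 t x)) (is_derive_mul P2 (is_derive_scale (wt s) (dx 2 t x)))))).
    by rewrite /At /h; field.
- move=> t x /bounds[_ x0 _].
  apply: continuous_mul; first exact: cc.
  by apply: continuous_add; apply: continuous_mul; rewrite ?cc//;
    apply: continuous_mul; rewrite ?cc//; exact: ct.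
- move=> t x _; apply: continuous_mul; first by apply: continuous_mul; [exact: cc|exact: cxi].
  apply: continuous_add; apply: continuous_mul; rewrite ?cc//.
  + by apply: continuous_mul; [exact: cc|exact: cx].
  + by apply: continuous_mul; [exact: cxi2|exact: cc].
  + by apply: continuous_mul; [exact: cc|exact: cx].
- move=> t x /bounds[b x0 bx]; split.
  + by apply: le_trans k4; apply: norm_leM; rewrite ?b//; exact: norm_leM.
  + apply: le_trans k5; apply: norm_leM; first exact: norm_leM.
    apply: norm_leD; apply: norm_leM; rewrite ?b ?normrN ?n2//.
    by apply: norm_leM; [exact: norm_leX|rewrite n2].
  + apply: le_trans k6; apply: norm_leM => //; apply: norm_leB; rewrite ?b//.
    by apply: norm_leM; rewrite ?b//; apply: norm_leM; [exact: norm_leX|rewrite n2].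
- by move=> t x _; rewrite subrr normr0.
- move=> x _; rewrite /A /h hk_le0 ?mulr0//.
  by rewrite /r sub0r addrC subr_le0.
Qed.

End causal.

(** * Gevrey functions and flat solutions *)

Section gevrey.
Context {R : realType}.
Implicit Types (f g : nat -> R -> R) (c : R).

Definition jet f : Prop := forall n (t : R), is_derive t 1 (f n) (f n.+1 t).

(** Gevrey order 2, the growth that the denominators (2 n)! of the power series in x can compensate
    when q is small. *)
Definition gevrey (M q : R) f : Prop :=
  forall n t, `|f n t| <= M * q ^+ n * (n`!%:R) ^+ 2.

(* For t > 0, the [n]-th derivative of exp (- c / t) is P_n (1 / t) exp (- c / t)
   with P_(n+1) = X^2 (c P_n - P_n'). *)
Fixpoint flat_poly c n : {poly R} :=
  if n is m.+1 then 'X^2 * (c *: flat_poly c m - (flat_poly c m)^`()) else 1.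

Definition flat_jet c n (t : R) : R :=
  if 0 < t then (flat_poly c n).[t^-1] * expR (- (c / t)) else 0.

Lemma flat_poly_low c n i : (i < n)%N -> (flat_poly c n)`_i = 0.
Proof.
elim: n i => [//|n IH] i iN; rewrite /= coefXnM; case: ltnP => // i2.
by rewrite coefB coefZ coef_deriv !IH ?mulr0 ?mul0rn ?subr0//; lia.
Qed.

Lemma flat_poly_high c n i : (n.*2 < i)%N -> (flat_poly c n)`_i = 0.
Proof.
elim: n i => [|n IH] i iN; first by rewrite /= coef1; case: i iN.
rewrite /= coefXnM; case: ltnP => // i2.
by rewrite coefB coefZ coef_deriv !IH ?mulr0 ?mul0rn ?subr0//; lia.
Qed.

(** The nonzero coefficients of P_n have degrees n to 2 n. In the recursion, c P_n contributes k
    times the bound for (n, k) and P_n' contributes n + k times it; the total factor is at most 3 (n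
    + 1), which produces 3^n n!. *)
Lemma flat_poly_coef c n k : 0 <= c -> (k <= n)%N ->
  `|(flat_poly c n)`_(n + k)| <= 3 ^+ n * n`!%:R * (c ^+ k / k`!%:R).
Proof.
move=> c0; elim: n k => [|n IH] k kn.
  by move: kn; rewrite leqn0 => /eqP ->; rewrite /= coef1 normr1 fact0 !expr0 !mul1r invr1.
pose u n k : R := 3 ^+ n * n`!%:R * (c ^+ k / k`!%:R).
have u0 m j : 0 <= u m j by rewrite /u !mulr_ge0 ?exprn_ge0 ?invr_ge0.
rewrite -/(u n.+1 k) /= coefXnM; case: ltnP => i2; first by rewrite normr0.
have [m mE] : exists m, (n + k = m.+1)%N by exists (n + k).-1; lia.
have -> : (n.+1 + k - 2 = m)%N by lia.
have uS : u n.+1 k = u n k * (3 * n.+1%:R) by rewrite /u exprS factS natrM; ring.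
rewrite coefB coefZ coef_deriv -mE uS.
apply: (@le_trans _ _ (u n k * k%:R + u n k * (if (k <= n)%N then (n + k)%:R else 0))); last first.
  rewrite -mulrDr; apply: ler_wpM2l => //.
  by case: ifPn => kn'; rewrite ?addr0 -?natrD -natrM ler_nat; lia.
apply: norm_leB.
  rewrite normrM (ger0_norm c0).
  case: k kn i2 mE uS => [|k] kn i2 mE uS.
    by rewrite flat_poly_low ?normr0 ?mulr0//; lia.
  have -> : m = (n + k)%N by lia.
  apply: (le_trans (ler_wpM2l c0 (IH k _))); first by lia.
  rewrite /u exprS factS natrM; set F := k`!%:R.
  have F0 : F != 0 :> R by rewrite /F pnatr_eq0 -lt0n fact_gt0.
  set K1 := k.+1%:R; have k0 : K1 != 0 :> R by rewrite /K1 pnatr_eq0.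
  by rewrite le_eqVlt; apply/orP; left; apply/eqP; clearbody F K1; field; rewrite ?F0 ?k0.
rewrite normrMn -[leLHS]mulr_natr; case: ifPn => [kn'|kn'].
  by apply: ler_wpM2r => //; exact: IH.
by rewrite flat_poly_high ?normr0 ?mul0r ?mulr0//; lia.
Qed.

Lemma horner_exp_bound c (p : {poly R}) : 0 < c ->
  exists C, forall w, 0 <= w -> `|p.[w]| * expR (- (c * w)) <= C.
Proof.
move=> c0; exists (\sum_(i < size p) `|p`_i| * (i`!%:R / c ^+ i)) => w w0.
rewrite horner_coef.
apply: (@le_trans _ _ (\sum_(i < size p) (`|p`_i| * w ^+ i) * expR (- (c * w)))).
  rewrite -mulr_suml; apply: ler_wpM2r; first exact: expR_ge0.
  apply: (le_trans (ler_norm_sum _ _ _)); apply: ler_sum => i _.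
  by rewrite normrM [`|w ^+ i|]ger0_norm// exprn_ge0.
apply: ler_sum => i _; rewrite -mulrA; apply: ler_wpM2l => //.
have := expRN_pow_le i (mulr_ge0 (ltW c0) w0).
by rewrite exprMn -mulrA ler_pdivlMr ?exprn_gt0// mulrC.
Qed.

Lemma flat_jetP c : 0 < c -> jet (flat_jet c).
Proof.
move=> c0 n t.
(* The extra factor X^2 provides the decay C t^2 required by [is_derive_flat]. *)
have [C HC] := horner_exp_bound ('X^2 * flat_poly c n) c0.
apply: (@is_derive_flat R (flat_jet c n) (flat_jet c n.+1) C) => {}t t0.
- by rewrite /flat_jet ltNge t0.
- have tn : t != 0 by rewrite gt_eqF.
  have Hv := is_derive_inv tn (is_derive_id t (1 : R)).
  have Hp := is_derive_comp Hv (is_derive_poly (flat_poly c n) t^-1).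
  have He := is_derive_exp (is_derive_scale (- c) Hv).
  have M : is_derive t 1 (fun y => (flat_poly c n).[y^-1] * expR (- c * y^-1)) (flat_jet c n.+1 t).
    apply: (is_derive_cast (is_derive_mul Hp He)).
    rewrite /flat_jet t0 [flat_poly c n.+1]/= hornerM hornerXn hornerD hornerN hornerZ.
    have -> : - c / t = - (c / t) by rewrite mulNr.
    by rewrite exprVn; ring.
  apply: near_eq_is_derive M; near=> y.
  have y0 : 0 < y by near: y; exact: lt_nbhsr.
  by rewrite /flat_jet y0 mulNr.
- rewrite /flat_jet t0 normrM (ger0_norm (expR_ge0 _)).
  have := HC t^-1; rewrite invr_ge0 => /(_ (ltW t0)).
  rewrite hornerM hornerXn normrM normrX normfV (gtr0_norm t0) exprVn -mulrA.
  by rewrite ler_pdivrMl ?exprn_gt0// [C * _]mulrC.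
Unshelve. all: by end_near. Qed.

(** With w = 1 / t, the exponential is split into two halves exp (- c w / 2). One half absorbs (c w
    / 2)^k / k! in each term, leaving 2^k with sum at most 2 2^n; the other turns w^n into (2 / c)^n
    n!. Together with 3^n n! this gives 2 (12 / c)^n n!^2. *)
Lemma flat_jet_gevrey c : 0 < c -> gevrey 2 (12 / c) (flat_jet c).
Proof.
move=> c0 n t; have K0 : 0 <= 2 * (12 / c) ^+ n * n`!%:R ^+ 2 :> R.
  by rewrite !mulr_ge0 ?exprn_ge0 ?divr_ge0// ltW.
rewrite /flat_jet; case: ifPn => [t0|_]; last by rewrite normr0.
set w := t^-1; have w0 : 0 <= w by rewrite invr_ge0 ltW.
clearbody w.
have sz : (size (flat_poly c n) <= n + n.+1)%N.
  apply/leq_sizeP => i; rewrite addnS addnn => /(flat_poly_high c); exact.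
rewrite (horner_coef_wide _ sz) big_split_ord /= big1 ?add0r; last first.
  by move=> i _; rewrite flat_poly_low ?mul0r.
rewrite normrM (ger0_norm (expR_ge0 _)).
set e := expR _.
have e0 : 0 <= e by exact: expR_ge0.
pose e2 := expR (- (c * w / 2)).
have eE : e = e2 * e2 by rewrite /e /e2 -expRD; congr expR; field.
have e20 : 0 <= e2 by exact: expR_ge0.
have cw0 : 0 <= c * w / 2 by rewrite divr_ge0// mulr_ge0// ltW.
apply: (@le_trans _ _ (\sum_(k < n.+1) 3 ^+ n * n`!%:R * (w ^+ n * e2) * 2 ^+ k)).
  rewrite -[leLHS]mulrC; apply: (@le_trans _ _ (e * \sum_(k < n.+1) 3 ^+ n * n`!%:R * (c ^+ k / k`!%:R) * w ^+ (n + k))).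
    apply: ler_wpM2l => //; apply: (le_trans (ler_norm_sum _ _ _)).
    apply: ler_sum => k _; rewrite normrM [`|w ^+ _|]ger0_norm ?exprn_ge0//.
    by apply: ler_wpM2r; [exact: exprn_ge0|apply: flat_poly_coef; [exact: ltW|rewrite -ltnS]].
  rewrite mulr_sumr; apply: ler_sum => k _.
  have H := expRN_pow_le k cw0; rewrite -/e2 in H.
  have -> : e * (3 ^+ n * n`!%:R * (c ^+ k / k`!%:R) * w ^+ (n + k)) =
     3 ^+ n * n`!%:R * (w ^+ n * e2) * (2 ^+ k * ((c * w / 2) ^+ k * e2) / k`!%:R).
    rewrite eE !exprMn exprD [2^-1 ^+ k]exprVn; set F := k`!%:R.
    have F0 : F != 0 :> R by rewrite /F pnatr_eq0 -lt0n fact_gt0.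
    have t0' : 2 ^+ k != 0 :> R by rewrite expf_neq0.
    by clearbody F; field; rewrite ?F0 ?t0'.
  apply: ler_wpM2l; first by rewrite !mulr_ge0 ?exprn_ge0.
  by rewrite -mulrA ler_piMr ?exprn_ge0// ler_pdivrMr ?mul1r// ltr0n fact_gt0.
rewrite -mulr_sumr.
have S2 : \sum_(k < n.+1) 2 ^+ k <= 2 * 2 ^+ n :> R.
  elim: (n) => [|m IHm]; first by rewrite big_ord1 expr0 mulr1 ler1n.
  by rewrite big_ord_recr /= exprS; lra.
have H := expRN_pow_le n cw0; rewrite -/e2 in H.
apply: (@le_trans _ _ (3 ^+ n * n`!%:R * (w ^+ n * e2) * (2 * 2 ^+ n))).
  by apply: ler_wpM2l => //; rewrite !mulr_ge0 ?exprn_ge0.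
have -> : 3 ^+ n * n`!%:R * (w ^+ n * e2) * (2 * 2 ^+ n) =
  2 * (12 / c) ^+ n * n`!%:R * ((c * w / 2) ^+ n * e2).
  have -> : 12 = 3 * 2 * 2 :> R by ring.
  rewrite !exprMn !exprVn.
  have t0' : 2 ^+ n != 0 :> R by rewrite expf_neq0.
  have c0' : c ^+ n != 0 :> R by rewrite expf_neq0// gt_eqF.
  by field; rewrite ?c0' ?t0' ?gt_eqF.
rewrite expr2 mulrA; apply: ler_wpM2l => //.
by rewrite !mulr_ge0 ?exprn_ge0 ?divr_ge0// ltW.
Qed.

Definition leibniz f g n (t : R) : R :=
  \sum_(i < n.+1) 'C(n, i)%:R * (f i t * g (n - i)%N t).

Lemma leibniz_jet f g : jet f -> jet g -> jet (leibniz f g).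
Proof.
move=> jf jg n t.
have D (i : 'I_n.+1) : is_derive t 1 (fun t => 'C(n, i)%:R * (f i t * g (n - i)%N t))
    ('C(n, i)%:R * (f i.+1 t * g (n - i)%N t + f i t * g (n - i).+1 t)).
  exact: is_derive_scale (is_derive_mul (jf i t) (jg (n - i)%N t)).
have -> : leibniz f g n = \sum_(i < n.+1) (fun t => 'C(n, i)%:R * (f i t * g (n - i)%N t)).
  by apply/funext => s; rewrite /leibniz fct_sumE.
apply: (is_derive_cast (is_derive_sum D)).
under eq_bigr do rewrite mulrDr.
rewrite big_split /= /leibniz.
rewrite [in RHS]big_ord_recl bin0 subn0 mul1r.
rewrite [X in _ + X = _]big_ord_recl bin0 subn0 mul1r addrCA; congr (_ + _).
rewrite [X in _ + X = _](_ : _ = \sum_(i < n.+1) 'C(n, i.+1)%:R * (f i.+1 t * g (n - i)%N t)).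
  rewrite -big_split /=; apply: eq_bigr => i _.
  by rewrite /bump leq0n add1n subSS binS natrD mulrDl addrC.
rewrite [RHS]big_ord_recr /= bin_small// mul0r addr0; apply: eq_bigr => i _.
by rewrite /bump leq0n add1n subnSK.
Qed.

(** Each term is controlled by 'C(n, i) i!^2 (n - i)!^2 = n! i! (n - i)! <= n!^2, and the n + 1 <=
    2^n terms double the rate. *)
Lemma leibniz_gevrey (M1 M2 q : R) f g : 0 <= M1 -> 0 <= M2 -> 0 <= q ->
  gevrey M1 q f -> gevrey M2 q g -> gevrey (M1 * M2) (2 * q) (leibniz f g).
Proof.
move=> M10 M20 q0 gf gg n t.
apply: (le_trans (ler_norm_sum _ _ _)).
apply: (@le_trans _ _ (\sum_(i < n.+1) M1 * M2 * q ^+ n * n`!%:R ^+ 2)); last first.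
  rewrite sumr_const card_ord -[leLHS]mulr_natl [(2 * q) ^+ n]exprMn.
  have -> : M1 * M2 * (2 ^+ n * q ^+ n) * n`!%:R ^+ 2 = 2 ^+ n * (M1 * M2 * q ^+ n * n`!%:R ^+ 2) by ring.
  apply: ler_wpM2r; first by rewrite !mulr_ge0 ?exprn_ge0.
  by rewrite -natrX ler_nat ltn_expl.
apply: ler_sum => i _; have iN : (i <= n)%N by rewrite -ltnS.
rewrite normrM normr_nat normrM.
have -> : M1 * M2 * q ^+ n * n`!%:R ^+ 2 = M1 * M2 * q ^+ n * n`!%:R * n`!%:R by ring.
apply: (@le_trans _ _ ('C(n, i)%:R * ((M1 * q ^+ i * i`!%:R ^+ 2) * (M2 * q ^+ (n - i) * (n - i)`!%:R ^+ 2)))).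
  by apply: ler_wpM2l => //; apply: ler_pM.
have -> : 'C(n, i)%:R * ((M1 * q ^+ i * i`!%:R ^+ 2) * (M2 * q ^+ (n - i) * (n - i)`!%:R ^+ 2)) =
  M1 * M2 * (q ^+ i * q ^+ (n - i)) * ('C(n, i)%:R * (i`!%:R * (n - i)`!%:R)) * (i`!%:R * (n - i)`!%:R) by ring.
rewrite -exprD subnKC// -!natrM bin_fact// ; apply: ler_wpM2l.
  by rewrite !mulr_ge0 ?exprn_ge0.
by rewrite ler_nat -(bin_fact iN) leq_pmull// bin_gt0.
Qed.

(** The step is the normalised primitive of the bump exp (- c / (t + a)) exp (c / t), which lives on
    ]-a, 0[. Value 1 and vanishing derivatives at 0 reduce the power series to its first term at the
    final time. *)
Lemma gevrey_step (a q : R) : 0 < a -> 0 < q -> exists (phi : nat -> R -> R) (M : R),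
  [/\ jet phi, 0 <= M, gevrey M q phi,
      (forall n t, t <= - a -> phi n t = 0) &
      phi 0 0 = 1 /\ forall n, phi n.+1 0 = 0].
Proof.
move=> a0 q0.
(* Each factor of the bump then has rate 12 / c = q / 2, and their product has rate q. *)
pose c := 24 / q; have c0 : 0 < c by rewrite divr_gt0.
pose f n t := flat_jet c n (t + a).
pose g n t := (-1) ^+ n * flat_jet c n (- t).
have jf : jet f.
  move=> n t; have D := is_derive_add (is_derive_id t (1 : R)) (is_derive_cst a t 1).
  by apply: (is_derive_cast (is_derive_comp D (flat_jetP c0 n (t + a)))); rewrite addr0 mulr1.
have jg : jet g.
  move=> n t; have D := is_derive_scale (-1) (is_derive_id t (1 : R)).
  have := flat_jetP c0 n (-1 * t) => D2.
  have -> : g n = fun t => (-1) ^+ n * flat_jet c n (-1 * t).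
    by apply/funext => s; rewrite /g mulN1r.
  apply: (is_derive_cast (is_derive_scale _ (is_derive_comp D D2))).
  by rewrite /g exprS mulN1r; ring.
have q12 : 12 / c = q / 2 by rewrite /c; field; rewrite gt_eqF.
have gf : gevrey 2 (q / 2) f by move=> n t; rewrite -q12; exact: flat_jet_gevrey.
have gg : gevrey 2 (q / 2) g.
  by move=> n t; rewrite -q12 normrM normrX normrN1 expr1n mul1r; exact: flat_jet_gevrey.
pose rho := leibniz f g.
have jrho : jet rho by exact: leibniz_jet.
have grho : gevrey 4 q rho.
  have -> : 4 = 2 * 2 :> R by ring.
  have -> : q = 2 * (q / 2) by field.
  by apply: leibniz_gevrey => //; rewrite divr_ge0// ltW.
have f0 n t : t <= - a -> f n t = 0.
  by move=> ta; rewrite /f /flat_jet ltNge -lerBrDr sub0r ta.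
have g0 n t : 0 <= t -> g n t = 0.
  by move=> ta; rewrite /g /flat_jet oppr_gt0 ltNge ta mulr0.
have rhol n t : t <= - a -> rho n t = 0.
  by move=> ta; rewrite /rho /leibniz big1// => i _; rewrite f0// mul0r mulr0.
have rhor n t : 0 <= t -> rho n t = 0.
  by move=> ta; rewrite /rho /leibniz big1// => i _; rewrite g0// !mulr0.
have rho_gt0 t : - a < t -> t < 0 -> 0 < rho 0 t.
  move=> ta t0; rewrite /rho /leibniz big_ord1 bin0 mul1r /f /g /flat_jet subnn expr0 mul1r.
  by rewrite -ltrBlDr sub0r ta oppr_gt0 t0 /= !hornerC !mul1r mulr_gt0// expR_gt0.
have crho : continuous (rho 0) by move=> t; exact: is_derive_continuous (jrho 0%N t).
have irho : (leb R).-integrable setT (EFin \o rho 0).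
  have : (leb R).-integrable `]- a, 0[ (EFin \o rho 0).
    apply: (@bounded_integrable_oo _ _ _ 4) => [|t _].
      by apply: within_oo_measurable => t _; exact: crho.
    by have := grho 0%N t; rewrite expr0 fact0 expr1n !mulr1.
  move=> H; have mI := @measurable_itv R `]- a, 0[.
  have := (@integrable_mkcond _ _ R (leb R) _ _ mI).1 H; apply: eq_integrable => // t _.
  rewrite patchE; case: ifPn => //= tN; congr EFin.
  have [ta|ta] := leP t (- a); first by rewrite rhol.
  have [t0|t0] := leP 0 t; first by rewrite rhor.
  by move/negP : tN; case; rewrite inE/= in_itv/= ta t0.
pose F (x : R) := \int[leb R]_(t in [set` `]-oo, x]]) rho 0 t.
have dF (x : R) : is_derive x 1 F (rho 0 x).
  have [] := @continuous_FTC1 R (rho 0) -oo%O x (x + 1) _ _ _ (crho x).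
  - by rewrite ltrDl.
  - by apply: integrableS irho.
  - by rewrite ltNyr.
  - by move=> d1 d2; rewrite -d2; exact: derivable_is_derive1.
have FN t : t <= - a -> F t = 0.
  move=> ta; rewrite /F; under eq_Rintegral => s do
    [rewrite inE/= in_itv/= => st; rewrite rhol ?(le_trans st)//].
  by rewrite Rintegral_cst// mul0r.
(* By the mean value theorem F 0 is a times a value of the bump inside ]-a, 0[, where it is
   positive. *)
have F0 : 0 < F 0.
  have na : - a < 0 by rewrite oppr_lt0.
  have [|x xI] := @MVT R F (rho 0) (- a) 0 na (fun x _ => dF x).
    by apply: continuous_in_subspaceT => x _; exact: is_derive_continuous (dF x).
  rewrite (FN (- a) (lexx _)) subr0 opprK add0r => ->.
  by rewrite mulr_gt0// rho_gt0//; move: xI; rewrite in_itv/= => /andP[].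
pose C := \int[leb R]_t `|rho 0 t|.
have FC t : `|F t| <= C.
  have i1 : (leb R).-integrable [set` `]-oo, t]] (EFin \o rho 0) by apply: integrableS irho.
  apply: (le_trans (le_normr_Rintegral _ i1)) => //.
  have i2 := integrable_norm irho; have i3 := integrable_norm i1.
  rewrite /C /Rintegral fine_le//.
  + by apply: integrable_fin_num.
  + by apply: integrable_fin_num.
  + by apply: ge0_subset_integral => //; case/integrableP: i2.
have C0 : 0 <= C by exact: le_trans (FC 0).
(* [C / F 0] bounds the step itself. Its derivatives are those of the bump shifted by one index,
   which costs the factor 1 / q in the second term. *)
exists (fun n t => if n is m.+1 then rho m t / F 0 else F t / F 0), (C / F 0 + 4 / (F 0 * q)).
have iF : 0 <= (F 0)^-1 by rewrite invr_ge0 ltW.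
have m1 : 0 <= C / F 0 by rewrite mulr_ge0.
have m2 : 0 <= 4 / (F 0 * q) by rewrite divr_ge0// mulr_ge0// ltW.
split.
- move=> [|n] t.
    have -> : (fun t => F t / F 0) = fun t => (F 0)^-1 * F t by apply/funext => s; rewrite mulrC.
    by rewrite mulrC; exact: is_derive_scale.
  have -> : (fun t => rho n t / F 0) = fun t => (F 0)^-1 * rho n t by apply/funext => s; rewrite mulrC.
  by rewrite mulrC; exact: is_derive_scale.
- exact: addr_ge0.
- move=> [|n] t; rewrite normrM normfV (gtr0_norm F0).
    rewrite expr0 fact0 expr1n !mulr1; apply: (@le_trans _ _ (C / F 0)).
      exact: ler_wpM2r.
    by rewrite lerDl.
  apply: (@le_trans _ _ (4 * q ^+ n * n`!%:R ^+ 2 / F 0)); first by apply: ler_wpM2r.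
  apply: (@le_trans _ _ (4 / (F 0 * q) * q ^+ n.+1 * (n.+1)`!%:R ^+ 2)); last first.
    by apply: ler_wpM2r; [exact: exprn_ge0|apply: ler_wpM2r; [rewrite exprn_ge0// ltW|rewrite lerDr]].
  have -> : 4 / (F 0 * q) * q ^+ n.+1 * (n.+1)`!%:R ^+ 2 = 4 * q ^+ n * (n.+1)`!%:R ^+ 2 / F 0.
    by rewrite exprS; field; rewrite !gt_eqF.
  apply: ler_wpM2r => //; apply: ler_wpM2l; first by rewrite mulr_ge0// exprn_ge0// ltW.
  by rewrite lerXn2r ?nnegrE// ler_nat factS leq_pmull.
- by move=> [|n] t ta; rewrite ?(FN _ ta) ?(rhol _ _ ta) mul0r.
- by split=> [|n]; [rewrite mulfV// gt_eqF|rewrite (rhor n 0 (lexx _)) mul0r].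
Qed.

End gevrey.

Lemma geometric_series_tail (R : realType) (u : nat -> R) (K : R) :
  (forall i, `|u i| <= K * 2^-1 ^+ i) ->
  exists l, (\sum_(i < n) u i) @[n --> \oo] --> l /\
    forall n, `|l - \sum_(i < n) u i| <= 2 * K * 2^-1 ^+ n.
Proof.
move=> uK.
have K0 : 0 <= K by have := uK 0%N; rewrite expr0 mulr1; apply: le_trans.
pose S n := \sum_(i < n) u i.
have SE m n : `|S (n + m)%N - S n| <= 2 * K * 2^-1 ^+ n.
  have H : `|S (n + m)%N - S n| <= 2 * K * 2^-1 ^+ n - 2 * K * 2^-1 ^+ (n + m).
    elim: m => [|m IH]; first by rewrite addn0 !subrr normr0.
    rewrite addnS /S big_ord_recr /= -/(S (n + m)%N).
    have -> : S (n + m)%N + u (n + m)%N - S n = (S (n + m)%N - S n) + u (n + m)%N by ring.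
    apply: (le_trans (ler_normD _ _)).
    apply: (@le_trans _ _ (2 * K * 2^-1 ^+ n - 2 * K * 2^-1 ^+ (n + m) + K * 2^-1 ^+ (n + m))).
      exact: lerD.
    by rewrite exprS; lra.
  apply: (le_trans H); rewrite lerBlDr lerDl.
  by rewrite !mulr_ge0// exprn_ge0.
have cS : cvgn S.
  have -> : S = series u by apply/funext => n; rewrite /S seriesEord.
  apply: normed_cvg; apply: (@series_le_cvg _ _ (geometric K 2^-1)) => [n|n|n|].
  - exact: normr_ge0.
  - by rewrite /geometric/= mulr_ge0// exprn_ge0.
  - exact: uK.
  - by apply: is_cvg_geometric_series; rewrite ger0_norm ?invf_lt1// ltr1n.
exists (limn S); split; first exact: cS.
move=> n; apply/ler_addgt0Pr => e e0.
have /cvgrPdist_le/(_ e e0)[N _ HN] : S @ \oo --> limn S by exact: cS.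
have := HN (n + N)%N (leq_addl _ _); rewrite /= => h1.
have -> : limn S - S n = (limn S - S (n + N)%N) + (S (n + N)%N - S n) by ring.
by rewrite addrC; apply: norm_leD.
Qed.

(** * The power series in x with Gevrey coefficients *)

Section flat_series.
Context {R : realType}.
Variables (a q M Y : R) (phi : nat -> R -> R) (p : nat).
Hypotheses (p1 : (p <= 1)%N) (q_gt0 : 0 < q) (M_ge0 : 0 <= M) (Y_ge1 : 1 <= Y).
Hypothesis qY : 4 * (q * Y ^+ 2) <= 2^-1.
Hypotheses (jphi : jet phi) (gphi : gevrey M q phi).

Definition mono k (x : R) : R := x ^+ k / k`!%:R.
Definition dmono k (x : R) : R := if k is k'.+1 then mono k' x else 0.
Definition ddmono k (x : R) : R := if k is k'.+1 then dmono k' x else 0.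

Lemma is_derive_mono k (x : R) : is_derive x 1 (mono k) (dmono k x).
Proof.
have D := is_derive_scale (k`!%:R)^-1 (is_derive_pow k (is_derive_id x (1 : R))).
have -> : mono k = fun x => (k`!%:R)^-1 * x ^+ k by apply/funext => y; rewrite /mono mulrC.
apply: (is_derive_cast D); case: k {D} => [|k] /=; first by rewrite !mul0r mulr0.
rewrite /mono factS natrM invfM mulr1.
have k0 : k.+1%:R != 0 :> R by rewrite pnatr_eq0.
by rewrite mulrACA mulVf// mul1r mulrC.
Qed.

Lemma is_derive_dmono k (x : R) : is_derive x 1 (dmono k) (ddmono k x).
Proof. by case: k => [|k]; [exact: is_derive_cst|exact: is_derive_mono]. Qed.

Definition fser n (sg x : R) : R := \sum_(i < n) phi i sg * mono (i.*2 + p) x.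
Definition fser_t n (sg x : R) : R := \sum_(i < n) phi i.+1 sg * mono (i.*2 + p) x.
Definition fser_x n (sg x : R) : R := \sum_(i < n) phi i sg * dmono (i.*2 + p) x.
Definition fser_xx n (sg x : R) : R := \sum_(i < n) phi i sg * ddmono (i.*2 + p) x.

Lemma is_derive_bigsum n (f : 'I_n -> R -> R) (df : 'I_n -> R) (x : R) :
  (forall i, is_derive x 1 (f i) (df i)) ->
  is_derive x 1 (fun y => \sum_(i < n) f i y) (\sum_(i < n) df i).
Proof.
move=> D; have := is_derive_sum D; rewrite (_ : \sum_(i < n) f i = fun y => \sum_(i < n) f i y)//.
by apply/funext => y; rewrite fct_sumE.
Qed.

Lemma fser_is_derive_x n (sg x : R) : is_derive x 1 (fser n sg) (fser_x n sg x).
Proof.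
apply: (is_derive_bigsum (f := fun i x => phi i sg * mono (i.*2 + p) x)) => i.
exact: is_derive_scale (is_derive_mono _ _).
Qed.

Lemma fser_x_is_derive_x n (sg x : R) : is_derive x 1 (fser_x n sg) (fser_xx n sg x).
Proof.
apply: (is_derive_bigsum (f := fun i x => phi i sg * dmono (i.*2 + p) x)) => i.
exact: is_derive_scale (is_derive_dmono _ _).
Qed.

(** Two x-derivatives lower the exponent 2 i + p by one step of i, and the first term disappears
    because p <= 1. The residual of a truncated series in the heat equation is thus its last term
    alone. *)
Lemma fser_xxE n (sg x : R) : fser_xx n.+1 sg x = fser_t n sg x.
Proof.
rewrite /fser_xx big_ord_recl /= (_ : ddmono p x = 0) ?mulr0 ?add0r.
  by [].
by case: p p1 => [|[|]].
Qed.

Lemma fser_xx_continuous n (sg x : R) : {for x, continuous (fser_xx n.+1 sg)}.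
Proof.
have -> : fser_xx n.+1 sg = fser_t n sg by apply/funext => y; rewrite fser_xxE.
apply: is_derive_continuous.
apply: (is_derive_bigsum (f := fun i x => phi i.+1 sg * mono (i.*2 + p) x)) => i.
exact: is_derive_scale (is_derive_mono _ _).
Qed.

Lemma fact_sq i : (i`! * i`! <= (i.*2)`!)%N.
Proof.
rewrite -(bin_fact (n := i.*2) (m := i)); last by rewrite -addnn leq_addr.
by rewrite -addnn addnK leq_pmull// bin_gt0 leq_addr.
Qed.

Lemma fact_mono m n : (m <= n)%N -> (m`! <= n`!)%N.
Proof.
elim: n => [|n IH]; first by rewrite leqn0 => /eqP ->.
rewrite leq_eqVlt => /predU1P[->//|]; rewrite ltnS => /IH mn.
by apply: (leq_trans mn); rewrite factS leq_pmull.
Qed.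

(** This and the next two inequalities compare the squared factorial of the Gevrey bound with the
    factorial in the monomial, for the series and its t- and x-derivatives. The loss 4^i is the
    factor 4 in [qY]. *)
Let fact1 i : (i`! * i`! <= 4 ^ i * (i.*2 + p)`!)%N.
Proof.
apply: (leq_trans (fact_sq i)); apply: (leq_trans (fact_mono (leq_addr p i.*2))).
by rewrite leq_pmull// expn_gt0.
Qed.

Let fact2 i : (i.+1`! * i.+1`! <= 4 ^ i * (i.*2 + p)`!)%N.
Proof.
rewrite factS mulnACA; apply: leq_mul.
  by elim: i => // i IH; rewrite expnS; nia.
by apply: (leq_trans (fact_sq i)); exact: fact_mono (leq_addr _ _).
Qed.

Let fact3 i k : (i.*2 + p)%N = k.+1 -> (i`! * i`! <= 4 ^ i * k`!)%N.
Proof.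
move=> ik; case: i ik => [|i] ik; first by rewrite fact0 expn0 !mul1n fact_gt0.
apply: (leq_trans (fact_sq _)); rewrite doubleS factS.
apply: leq_mul; first by elim: i {ik} => // i IH; rewrite expnS; lia.
by apply: fact_mono; lia.
Qed.

(** The factor [Y] is what remains of Y^(2 i + 1) besides (Y^2)^i; 1 + q covers q^0 and the q^1
    created by a t-derivative. *)
Definition flat_bound : R := M * Y * (1 + q).

Let Y_ge0 : 0 <= Y. Proof. exact: (le_trans ler01 Y_ge1). Qed.

Lemma flat_bound_ge0 : 0 <= flat_bound.
Proof. by rewrite /flat_bound !mulr_ge0// addr_ge0// ltW. Qed.

(** Once the factorials cancel, the powers combine into (4 q Y^2)^i, which [qY] makes at most
    2^-i. *)
Let term i j k (sg x : R) : `|x| <= Y -> (j <= 1)%N -> (k <= i.*2 + 1)%N ->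
  ((i + j)`! * (i + j)`! <= 4 ^ i * k`!)%N ->
  `|phi (i + j)%N sg * mono k x| <= flat_bound * 2^-1 ^+ i.
Proof.
move=> xY j1 ki fa.
have kf : 0 < k`!%:R :> R by rewrite ltr0n fact_gt0.
apply: (@le_trans _ _ ((M * q ^+ (i + j) * ((i + j)`!%:R) ^+ 2) * (Y ^+ k / k`!%:R))).
  rewrite normrM /mono normrM normfV normr_nat; apply: ler_pM => //.
  by apply: ler_wpM2r; [rewrite invr_ge0|rewrite normrX lerXn2r// nnegrE].
apply: (@le_trans _ _ (M * q ^+ (i + j) * (4 ^+ i * Y ^+ (i.*2 + 1)))).
  rewrite -!mulrA; apply: ler_wpM2l => //; apply: ler_wpM2l; first by rewrite exprn_ge0// ltW.
  rewrite !mulrA ler_pdivrMr//.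
  apply: (@le_trans _ _ (4 ^+ i * k`!%:R * Y ^+ k)).
    by apply: ler_wpM2r; [exact: exprn_ge0|rewrite -natrX -!natrM ler_nat].
  rewrite -mulrA -mulrA; apply: ler_wpM2l; first exact: exprn_ge0.
  by rewrite mulrC; apply: ler_wpM2r; [rewrite ltW|exact: ler_weXn2l].
have -> : M * q ^+ (i + j) * (4 ^+ i * Y ^+ (i.*2 + 1)) =
    M * Y * q ^+ j * (4 * (q * Y ^+ 2)) ^+ i.
  rewrite -mul2n (exprMn i 4) (exprMn i q) -exprM (exprD Y) (exprD q) expr1.
    by move: (4 ^+ i) (q ^+ i) (Y ^+ (2 * i)) (q ^+ j) => *; ring.
apply: ler_pM.
- by apply: mulr_ge0; [exact: mulr_ge0|rewrite exprn_ge0// ltW].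
- by rewrite exprn_ge0// !mulr_ge0 ?exprn_ge0// ltW.
- rewrite /flat_bound; apply: ler_wpM2l; first exact: mulr_ge0.
  by case: j j1 fa => [|[|//]] _ _; rewrite ?expr0 ?expr1 ?lerDl ?lerDr// ltW.
- by apply: lerXn2r => //; rewrite nnegrE// !mulr_ge0 ?exprn_ge0// ltW.
Qed.

Lemma fser_term i (sg x : R) : `|x| <= Y ->
  `|phi i sg * mono (i.*2 + p) x| <= flat_bound * 2^-1 ^+ i.
Proof.
move=> xY; have := @term i 0%N (i.*2 + p) sg x xY isT.
by rewrite addn0 leq_add2l p1 fact1; exact.
Qed.

Lemma fser_t_term i (sg x : R) : `|x| <= Y ->
  `|phi i.+1 sg * mono (i.*2 + p) x| <= flat_bound * 2^-1 ^+ i.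
Proof.
move=> xY; have := @term i 1%N (i.*2 + p) sg x xY isT.
by rewrite leq_add2l p1 (addn1 i) fact2; exact.
Qed.

Lemma fser_x_term i (sg x : R) : `|x| <= Y ->
  `|phi i sg * dmono (i.*2 + p) x| <= flat_bound * 2^-1 ^+ i.
Proof.
move=> xY; case E : (i.*2 + p)%N => [|k] /=.
  by rewrite mulr0 normr0 mulr_ge0 ?flat_bound_ge0// exprn_ge0.
have ki : (k <= i.*2 + 1)%N by move: p1 E; lia.
by have := @term i 0%N k sg x xY isT ki; rewrite addn0 (fact3 E); exact.
Qed.

Let geo n : \sum_(i < n) flat_bound * 2^-1 ^+ i <= 2 * flat_bound.
Proof.
have H : \sum_(i < n) flat_bound * 2^-1 ^+ i = 2 * flat_bound - 2 * flat_bound * 2^-1 ^+ n.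
  elim: n => [|n IH]; first by rewrite big_ord0 expr0; ring.
  by rewrite big_ord_recr /= IH exprS; field.
rewrite H lerBlDr lerDl; apply: mulr_ge0; last exact: exprn_ge0.
by apply: mulr_ge0; [|exact: flat_bound_ge0].
Qed.

Let sum_bound n (f : nat -> R) : (forall i, `|f i| <= flat_bound * 2^-1 ^+ i) ->
  `|\sum_(i < n) f i| <= 2 * flat_bound.
Proof.
move=> H; apply: (le_trans (ler_norm_sum _ _ _)); apply: le_trans (geo n).
by apply: ler_sum => i _.
Qed.

Lemma fser_bound n (sg x : R) : `|x| <= Y ->
  [/\ `|fser n sg x| <= 2 * flat_bound, `|fser_t n sg x| <= 2 * flat_bound &
      `|fser_x n sg x| <= 2 * flat_bound].
Proof.
move=> xY; split.
- by apply: (@sum_bound n (fun i => phi i sg * mono (i.*2 + p) x)) => i; exact: fser_term.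
- by apply: (@sum_bound n (fun i => phi i.+1 sg * mono (i.*2 + p) x)) => i; exact: fser_t_term.
- by apply: (@sum_bound n (fun i => phi i sg * dmono (i.*2 + p) x)) => i; exact: fser_x_term.
Qed.

Lemma fser_residual n (sg x : R) : `|x| <= Y ->
  `|fser_t n.+1 sg x - fser_xx n.+1 sg x| <= flat_bound * 2^-1 ^+ n.
Proof.
move=> xY; rewrite fser_xxE /fser_t big_ord_recr /= addrAC subrr add0r.
exact: fser_t_term.
Qed.

(* The series is only controlled for |x| <= Y; clipping its argument makes its
   sum measurable on the whole plane. *)
Definition clip (x : R) : R := Num.max (- Y) (Num.min x Y).

Lemma clip_le x : `|clip x| <= Y.
Proof.
rewrite /clip ler_norml le_max lexx /= ge_max ge_min lexx orbT andbT.
by rewrite (le_trans _ Y_ge0)// oppr_le0.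
Qed.

Lemma clip_id x : `|x| <= Y -> clip x = x.
Proof.
by rewrite ler_norml => /andP[a1 a2]; rewrite /clip (min_idPl a2) (max_idPr a1).
Qed.

Definition fser_lim (sg x : R) : R := limn (fun n => fser n sg (clip x)).

Lemma fser_lim_tail n (sg x : R) : `|x| <= Y ->
  `|fser_lim sg x - fser n sg x| <= 2 * flat_bound * 2^-1 ^+ n.
Proof.
move=> xY.
have [l [cl tl]] := @geometric_series_tail R (fun i => phi i sg * mono (i.*2 + p) x) flat_bound (fun i => fser_term i sg xY).
rewrite /fser_lim clip_id// (_ : limn _ = l); first exact: tl.
by apply/cvg_lim => //; exact: cl.
Qed.

Lemma measurable_fser_lim : measurable_fun setT (fun u : R * R => fser_lim u.1 u.2).
Proof.
have mclip : measurable_fun setT clip.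
  by apply: measurable_maxr; [exact: measurable_cst|exact: measurable_minr].
have mphi i : measurable_fun setT (phi i).
  by apply: continuous_measurable_fun => t; exact: is_derive_continuous (jphi i t).
apply: (@measurable_fun_cvg _ _ _ _ (fun n (u : R * R) => fser n u.1 (clip u.2))) => [n|u _].
  apply: measurable_sum => i; apply: measurable_funM.
    exact: (measurableT_comp (mphi i) measurable_fst).
  apply: measurable_funM; last exact: measurable_cst.
  apply: measurable_funX; exact: (measurableT_comp mclip measurable_snd).
have [l [cl tl]] := @geometric_series_tail R (fun i => phi i u.1 * mono (i.*2 + p) (clip u.2)) flat_bound (fun i => fser_term i u.1 (clip_le u.2)).
by apply: cvgP; exact: cl.
Qed.

End flat_series.

Section series.
Context {R : realType}.
Variables (c c' m m' : nat -> R -> R).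
Hypotheses (dc : forall i (s : R), is_derive s 1 (c i) (c' i s)).
Hypotheses (dm : forall i (x : R), is_derive x 1 (m i) (m' i x)).

Lemma is_derive_series n (f g : R -> R) (t a b : R) :
  is_derive t 1 f a -> is_derive t 1 g b ->
  is_derive t 1 (fun t => \sum_(i < n) c i (f t) * m i (g t))
    (\sum_(i < n) (c' i (f t) * a * m i (g t) + c i (f t) * (m' i (g t) * b))).
Proof.
move=> df dg; apply: (is_derive_bigsum (f := fun i t => c i (f t) * m i (g t))) => i.
exact: is_derive_mul (is_derive_comp df (dc _ _)) (is_derive_comp dg (dm _ _)).
Qed.

Lemma measurable_series n :
  measurable_fun setT (fun u : R * R => \sum_(i < n) c i u.1 * m i u.2).
Proof.
apply: measurable_sum => i; apply: measurable_funM.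
  apply: (measurableT_comp (f := c i)) measurable_fst.
  by apply: continuous_measurable_fun => t; exact: is_derive_continuous (dc i t).
apply: (measurableT_comp (f := m i)) measurable_snd.
by apply: continuous_measurable_fun => t; exact: is_derive_continuous (dm i t).
Qed.

End series.

(** * Atoms for s > T: Appell transforms of flat series *)

Section flat.
Context {R : realType}.
Variables (L T d X q M : R) (phi : nat -> R -> R) (p : nat).
Hypotheses (L_gt0 : 0 < L) (T_gt0 : 0 < T) (d_gt0 : 0 < d) (X_ge0 : 0 <= X).
Hypotheses (p1 : (p <= 1)%N) (q_gt0 : 0 < q) (M_ge0 : 0 <= M).
(** Where r >= s / 2, the transformed position s (x - l) / r is at most 2 X in modulus; the added 1
    ensures [1 <= Y]. *)
Let Y := 2 * X + 1.
Hypothesis qY : 4 * (q * Y ^+ 2) <= 2^-1.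
Hypotheses (jphi : jet phi) (gphi : gevrey M q phi).
Hypothesis phi_flat : forall n t, t <= - (T / 2) -> phi n t = 0.

Let Y1 : 1 <= Y. Proof. by rewrite /Y lerDr mulr_ge0. Qed.

(* Appell transform: if [v] solves the heat equation, so does the product of the
   heat kernel at (r, x - l) and v (s (t - T) / r, s (x - l) / r), r = t - T + s. *)
Definition flat_atom (s l t x : R) : R :=
  wt s * hk 0 (t - T + s) (x - l) *
  fser_lim Y phi p (s * (t - T) / (t - T + s)) (s * (x - l) / (t - T + s)).

(** When r >= s / 2, both s / r <= 2 and 1 / r <= 2 / T are at most [a], hence s^k r^-j <= a^2 for k
    <= j <= 2. [B] includes the factor 2 of [H0_le]. *)
Let a : R := 2 * (1 + T^-1).
Let B : R := 2 * a ^+ 2.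
Let F : R := 2 * flat_bound q M Y.

Let F_ge0 : 0 <= F. Proof. by rewrite mulr_ge0// flat_bound_ge0. Qed.

Let Ti_ge0 : 0 <= T^-1. Proof. by rewrite invr_ge0 ltW. Qed.

Let a_ge2 : 2 <= a. Proof. by rewrite /a mulrDr mulr1 lerDl mulr_ge0. Qed.

Let B_ge0 : 0 <= B. Proof. by rewrite mulr_ge0// sqr_ge0. Qed.

Definition flat_const : R := B * F * (2 + X + X ^+ 2).

Variables (s l : R).
Hypothesis sT : T < s.
Hypothesis lX : forall x : R, x \in `[- L, L] -> d <= `|x - l| <= X.

Let s_gt0 : 0 < s. Proof. exact: lt_trans sT. Qed.
Let c : R := s^-1 ^+ 2.
Let c_ge0 : 0 <= c. Proof. exact: sqr_ge0. Qed.

Let r t := t - T + s.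
Let sg t := s * (t - T) / r t.
Let eta t x := s * (x - l) / r t.
Let H j t x := wt s * hk j (r t) (x - l).

Let r_gt0 t : t \in `[0, T] -> 0 < r t.
Proof. by rewrite in_itv/= /r => /andP[t0 tT]; move: sT; lra. Qed.

(** The age r starts from s - T, which may be arbitrarily small, and the factors 1 / r are then
    uncontrolled. For t <= T / 2, however, the transformed time lies where [phi] vanishes, and
    afterwards r >= s / 2. *)
Let flat_or_far t : t \in `[0, T] -> sg t <= - (T / 2) \/ s / 2 <= r t.
Proof.
move=> tI; have r0 := r_gt0 tI; move: (tI); rewrite in_itv/= => /andP[t0 tT].
have [h|h] := leP t (T / 2); last by right; move: sT; rewrite /r; lra.
left; rewrite /sg -lerN2 opprK -mulNr ler_pdivlMr//.
have h1 : T / 2 <= T - t by lra.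
have -> : - (s * (t - T)) = (T - t) * s by ring.
apply: ler_pM => //; first by rewrite divr_ge0// ltW.
  exact: ltW.
by rewrite /r; lra.
Qed.

Let far_pow (k j : nat) (rho : R) : (k <= j)%N -> (j <= 2)%N -> s / 2 <= rho -> s ^+ k * rho^-1 ^+ j <= a ^+ 2.
Proof.
move=> kj j2 srho; have rho0 : 0 < rho by apply: lt_le_trans srho; rewrite divr_gt0.
have h1 : 0 <= s * rho^-1 <= a.
  apply/andP; split; first by rewrite divr_ge0 ?ltW.
  by apply: le_trans a_ge2; rewrite ler_pdivrMr//; move: srho; lra.
have h2 : 0 <= rho^-1 <= a.
  apply/andP; split; first by rewrite invr_ge0 ltW.
  apply: (@le_trans _ _ (2 * T^-1)); last by rewrite /a; lra.
  rewrite -[2]invrK -invfM lef_pV2 ?posrE ?mulr_gt0 ?invr_gt0//.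
  by move: sT srho; lra.
have a0 : 0 <= a by apply: le_trans a_ge2.
have -> : s ^+ k * rho^-1 ^+ j = (s * rho^-1) ^+ k * rho^-1 ^+ (j - k).
  by rewrite exprMn -mulrA -exprD subnKC.
have [/andP[p1' p2] /andP[p3 p4]] := (h1, h2).
apply: (@le_trans _ _ (a ^+ k * a ^+ (j - k))).
  by apply: ler_pM; rewrite ?exprn_ge0// lerXn2r ?nnegrE.
rewrite -exprD subnKC//; apply: ler_weXn2l => //.
by apply: le_trans a_ge2; rewrite ler1n.
Qed.

Let H0_le t x : s / 2 <= r t -> H 0 t x <= 2 * c.
Proof.
move=> sr; have r0 : 0 < r t by apply: lt_le_trans sr; rewrite divr_gt0.
have e1 : expR (- ((x - l) ^+ 2 / (4 * r t))) <= 1.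
  by rewrite -expR0 ler_expR oppr_le0 divr_ge0 ?sqr_ge0// mulr_ge0// ltW.
have e2 : (Num.sqrt (r t))^-1 <= 2 * (Num.sqrt s)^-1.
  rewrite -[2]invrK -invfM lef_pV2 ?posrE ?mulr_gt0 ?invr_gt0 ?sqrtr_gt0//.
  rewrite -(@ler_pXn2r _ 2) ?nnegrE ?mulr_ge0 ?invr_ge0 ?sqrtr_ge0//.
  by rewrite exprMn !sqr_sqrtr ?ltW//; move: sr s_gt0; lra.
rewrite /H /hk expr0 mul1r /wt.
apply: (@le_trans _ _ (s^-1 * (Num.sqrt s)^-1 * (2 * (Num.sqrt s)^-1))).
  apply: ler_wpM2l; first exact: wt_ge0.
  by rewrite -[leRHS]mulr1; apply: ler_pM; rewrite ?expR_ge0 ?invr_ge0 ?sqrtr_ge0.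
have -> : s^-1 * (Num.sqrt s)^-1 * (2 * (Num.sqrt s)^-1) = 2 * (s^-1 * (Num.sqrt s ^+ 2)^-1).
  by rewrite -exprVn; ring.
rewrite sqr_sqrtr; last exact: ltW.
by rewrite /c expr2 lexx.
Qed.

Let H_ge0 j t x : 0 <= H j t x.
Proof. by apply: mulr_ge0; [exact: wt_ge0|exact: hk_ge0]. Qed.

(** The common estimate behind all bounds of this section: [w] stands for the series or one of its
    derivatives, which vanishes at flat times and is bounded by [G] at admissible positions. The
    factor [c] = s^-2 is the decay needed for the superposition. *)
Let est (k j : nat) (t x w G : R) : (k <= j)%N -> (j <= 2)%N -> in_rect L T t x -> 0 <= G ->
  (sg t <= - (T / 2) -> w = 0) -> (`|eta t x| <= Y -> `|w| <= G) ->
  `|s ^+ k * H j t x * w| <= B * c * G.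
Proof.
move=> kj j2 /andP[tI xI] G0 w0 wG.
have BcG : 0 <= B * c * G by exact: (mulr_ge0 (mulr_ge0 B_ge0 c_ge0) G0).
have [/w0 ->|sr] := flat_or_far tI; first by rewrite mulr0 normr0.
have r0 := r_gt0 tI; have /andP[_ xX] := lX xI.
have eY : `|eta t x| <= Y.
  rewrite /eta normrM normrM normfV (gtr0_norm r0) (gtr0_norm s_gt0) ler_pdivrMr//.
  apply: (@le_trans _ _ (s * X)); first by apply: ler_wpM2l => //; exact: ltW.
  apply: (@le_trans _ _ (2 * X * r t)).
    by rewrite mulrAC; apply: ler_wpM2r => //; move: sr; lra.
  by apply: ler_wpM2r; [exact: ltW|rewrite /Y lerDl].
apply: norm_leM (wG eY).
rewrite ger0_norm; last first.
  exact: (mulr_ge0 (exprn_ge0 _ (ltW s_gt0)) (H_ge0 _ _ _)).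
have -> : s ^+ k * H j t x = s ^+ k * (r t)^-1 ^+ j * H 0 t x.
  by rewrite /H /hk expr0; ring.
have -> : B * c = a ^+ 2 * (2 * c) by rewrite /B; ring.
apply: ler_pM; [|exact: H_ge0|exact: far_pow|exact: H0_le].
have ri : 0 <= (r t)^-1 by rewrite invr_ge0 ltW.
exact: (mulr_ge0 (exprn_ge0 _ (ltW s_gt0)) (exprn_ge0 _ ri)).
Qed.

Let xi0 x : x \in `[- L, L] -> x - l != 0.
Proof. by move=> /lX /andP[h _]; rewrite -normr_gt0 (lt_le_trans d_gt0). Qed.

Let dr (t : R) : is_derive t 1 r 1.
Proof.
apply: (is_derive_cast (is_derive_add (is_derive_sub (is_derive_id t (1 : R)) (is_derive_cst T t 1)) (is_derive_cst s t 1))).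
by rewrite subr0 addr0.
Qed.

Let dtT (t : R) : is_derive t 1 (fun t => s * (t - T)) s.
Proof.
apply: (is_derive_cast (is_derive_scale s (is_derive_sub (is_derive_id t (1 : R)) (is_derive_cst T t 1)))).
by rewrite subr0 mulr1.
Qed.

Let dx_shift (x : R) : is_derive x 1 (fun x => x - l) 1.
Proof.
by apply: (is_derive_cast (is_derive_sub (is_derive_id x (1 : R)) (is_derive_cst l x 1))); rewrite subr0.
Qed.

Let dHt j (t x : R) : x - l != 0 -> is_derive t 1 (fun t => H j t x)
  (- (j%:R + 2^-1) * H j.+1 t x + (x - l) ^+ 2 / 4 * H j.+2 t x).
Proof.
move=> x0; apply: (is_derive_cast (is_derive_scale (wt s) (is_derive_comp (dr t) (is_derive_hk_t j (r t) x0)))).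
by rewrite /H; ring.
Qed.

Let dHx j (t x : R) : is_derive x 1 (fun x => H j t x) (- ((x - l) / 2) * H j.+1 t x).
Proof.
apply: (is_derive_cast (is_derive_scale (wt s) (is_derive_comp (dx_shift x) (is_derive_hk_x j (r t) (x - l))))).
by rewrite /H; ring.
Qed.

Let dsg (t : R) : r t != 0 -> is_derive t 1 sg (s ^+ 2 * (r t)^-1 ^+ 2).
Proof.
move=> r0; apply: (is_derive_cast (is_derive_mul (dtT t) (is_derive_inv r0 (dr t)))).
by move: r0; rewrite /r => r0; field.
Qed.

Let deta_t (t x : R) : r t != 0 -> is_derive t 1 (eta ^~ x) (- (s * (x - l) * (r t)^-1 ^+ 2)).
Proof.
move=> r0; apply: (is_derive_cast (is_derive_scale (s * (x - l)) (is_derive_inv r0 (dr t)))).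
by rewrite exprVn; ring.
Qed.

Let deta_x (t x : R) : is_derive x 1 (eta t) (s * (r t)^-1).
Proof.
have -> : eta t = fun x => s * (r t)^-1 * (x - l) by apply/funext => y; rewrite /eta; ring.
by apply: (is_derive_cast (is_derive_scale (s * (r t)^-1) (dx_shift x))); rewrite mulr1.
Qed.

Let J n t x := fser phi p n (sg t) (eta t x).
Let Jt n t x := fser_t phi p n (sg t) (eta t x).
Let Jx n t x := fser_x phi p n (sg t) (eta t x).
Let Jxx n t x := fser_xx phi p n (sg t) (eta t x).

Let dJt n (t x : R) : r t != 0 -> is_derive t 1 (J n ^~ x)
  (s ^+ 2 * (r t)^-1 ^+ 2 * Jt n t x - s * (x - l) * (r t)^-1 ^+ 2 * Jx n t x).
Proof.
move=> r0; have D : is_derive t 1 (J n ^~ x) _ :=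
  is_derive_series (m := fun i => mono (i.*2 + p))
    jphi (fun i => is_derive_mono (i.*2 + p)) n (dsg r0) (deta_t x r0).
apply: (is_derive_cast D).
by rewrite /Jt /Jx /fser_t /fser_x !mulr_sumr -sumrB; apply: eq_bigr => i _; ring.
Qed.

Let dJx n (t x : R) : is_derive x 1 (J n t) (s * (r t)^-1 * Jx n t x).
Proof.
by rewrite mulrC; exact: is_derive_comp (deta_x t x) (fser_is_derive_x _ _ _ _ _).
Qed.

Let dJxx n (t x : R) : is_derive x 1 (Jx n t) (s * (r t)^-1 * Jxx n t x).
Proof.
by rewrite mulrC; exact: is_derive_comp (deta_x t x) (fser_x_is_derive_x _ _ _ _ _).
Qed.

Let cJ n (t x : R) : r t != 0 -> {for t, continuous (J n ^~ x)}.
Proof. by move=> r0; exact: is_derive_continuous (dJt n x r0). Qed.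

Let cJt n (t x : R) : r t != 0 -> {for t, continuous (Jt n ^~ x)}.
Proof.
move=> r0; apply: is_derive_continuous.
exact: (is_derive_series (c := fun i => phi i.+1) (m := fun i => mono (i.*2 + p))
  (fun i => jphi i.+1) (fun i => is_derive_mono (i.*2 + p)) n (dsg r0) (deta_t x r0)).
Qed.

Let cJx n (t x : R) : r t != 0 -> {for t, continuous (Jx n ^~ x)}.
Proof.
move=> r0; apply: is_derive_continuous.
exact: (is_derive_series (m := fun i => dmono (i.*2 + p))
  jphi (fun i => is_derive_dmono (i.*2 + p)) n (dsg r0) (deta_t x r0)).
Qed.

Let A n t x := H 0 t x * J n t x.
Let At n t x := (- 2^-1 * H 1 t x + (x - l) ^+ 2 / 4 * H 2 t x) * J n t x +
  (s ^+ 2 * H 2 t x * Jt n t x - (x - l) * (s * H 2 t x * Jx n t x)).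
Let Ax n t x := - ((x - l) / 2) * (H 1 t x * J n t x) + s * H 1 t x * Jx n t x.
(** The cross term 2 Hx Jx produced by two x-derivatives equals the drift term that [At] inherits
    from the time dependence of [eta]. This is the cancellation behind the Appell transform:
    [At - Axx] is s^2 H_2 times the residual of the truncated series. *)
Let Axx n t x := (- 2^-1 * H 1 t x + (x - l) ^+ 2 / 4 * H 2 t x) * J n t x +
  (s ^+ 2 * H 2 t x * Jxx n t x - (x - l) * (s * H 2 t x * Jx n t x)).

Let HV j k t x : (r t)^-1 ^+ k * H j t x = H (k + j) t x.
Proof. by rewrite /H -hkS; ring. Qed.

Let eps n := B * c * (flat_bound q M Y * 2^-1 ^+ n) * (2 * L) * T.

Let mr : measurable_fun setT (fun u : R * R => r u.1).
Proof. by apply: measurable_funD => //; exact: measurable_funB. Qed.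

Let mH j : measurable_fun setT (fun u : R * R => H j u.1 u.2).
Proof. by apply: measurable_funM => //; apply: measurable_hk => //; exact: measurable_funB. Qed.

Let mri : measurable_fun setT (fun u : R * R => (r u.1)^-1).
Proof. exact: (measurableT_comp (@measurable_inv R) mr). Qed.

Let msg : measurable_fun setT (fun u : R * R => sg u.1).
Proof.
by apply: measurable_funM => //; apply: measurable_funM => //; exact: measurable_funB.
Qed.

Let meta : measurable_fun setT (fun u : R * R => eta u.1 u.2).
Proof.
by apply: measurable_funM => //; apply: measurable_funM => //; exact: measurable_funB.
Qed.

Let mJ n : measurable_fun setT (fun u : R * R => J n u.1 u.2).
Proof.
apply: (measurable_plane_comp (f := fser phi p n)) => //.
exact: (measurable_series (m := fun i => mono (i.*2 + p)) jphi (fun i => is_derive_mono (i.*2 + p)) n).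
Qed.

Let mJt n : measurable_fun setT (fun u : R * R => Jt n u.1 u.2).
Proof.
apply: (measurable_plane_comp (f := fser_t phi p n)) => //.
exact: (measurable_series (c := fun i => phi i.+1) (m := fun i => mono (i.*2 + p))
  (fun i => jphi i.+1) (fun i => is_derive_mono (i.*2 + p)) n).
Qed.

Let mJx n : measurable_fun setT (fun u : R * R => Jx n u.1 u.2).
Proof.
apply: (measurable_plane_comp (f := fser_x phi p n)) => //.
exact: (measurable_series (m := fun i => dmono (i.*2 + p)) jphi (fun i => is_derive_dmono (i.*2 + p)) n).
Qed.

Let fser0 n (sg0 x : R) : sg0 <= - (T / 2) -> [/\ fser phi p n sg0 x = 0, fser_t phi p n sg0 x = 0,
  fser_x phi p n sg0 x = 0 & fser_xx phi p n sg0 x = 0].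
Proof. by move=> h; split; apply: big1 => i _; rewrite phi_flat// mul0r. Qed.

Let estJ (k j : nat) n (t x : R) : (k <= j)%N -> (j <= 2)%N -> in_rect L T t x ->
  [/\ `|s ^+ k * H j t x * J n t x| <= B * c * F,
      `|s ^+ k * H j t x * Jt n t x| <= B * c * F &
      `|s ^+ k * H j t x * Jx n t x| <= B * c * F].
Proof.
move=> kj j2 tx.
have b x' := fser_bound p1 q_gt0 M_ge0 Y1 qY gphi n (sg t) (x := x').
by split; apply: est => // h; [case: (fser0 n (eta t x) h)|case: (b _ h)|
  case: (fser0 n (eta t x) h)|case: (b _ h)|case: (fser0 n (eta t x) h)|case: (b _ h)].
Qed.

Let partial n : trajectory L T (flat_const * c) (eps n) (A n.+1).
Proof.
rewrite /eps; apply: (@classical_trajectory _ _ _ _ _ (A n.+1) (At n.+1) (Ax n.+1) (Axx n.+1)).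
- exact: L_gt0.
- exact: ltW.
- exact: measurable_funM.
- have mx : measurable_fun setT (fun p : R * R => p.2 - l) by exact: measurable_funB.
  have mx2 : measurable_fun setT (fun p : R * R => (p.2 - l) ^+ 2) by exact: measurable_funX.
  have mc (k : R) : measurable_fun setT (fun _ : R * R => k) by exact: measurable_cst.
  exact: (measurable_funD
    (measurable_funM
      (measurable_funD (measurable_funM (mc _) (mH 1)) (measurable_funM (measurable_funM mx2 (mc _)) (mH 2)))
      (mJ _))
    (measurable_funB (measurable_funM (measurable_funM (mc _) (mH 2)) (mJt _))
      (measurable_funM mx (measurable_funM (measurable_funM (mc _) (mH 2)) (mJx _))))).
- move=> t x /andP[tI xI]; have r0 := lt0r_neq0 (r_gt0 tI).
  have x0 := xi0 xI.
  split.
  + apply: (is_derive_cast (is_derive_mul (dHt 0 t x0) (dJt n.+1 x r0))).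
    by rewrite /At -(HV 0 2); ring.
  + apply: (is_derive_cast (is_derive_mul (dHx 0 t x) (dJx n.+1 t x))).
    by rewrite /Ax -(HV 0 1); ring.
  + have D := is_derive_mul (is_derive_mul (is_derive_scale (- 2^-1) (dx_shift x)) (dHx 1 t x)) (dJx n.+1 t x).
    have D2 := is_derive_scale s (is_derive_mul (dHx 1 t x) (dJxx n.+1 t x)).
    have -> : Ax n.+1 t = fun x => - 2^-1 * (x - l) * H 1 t x * J n.+1 t x + s * (H 1 t x * Jx n.+1 t x).
      by apply/funext => y; rewrite /Ax; ring.
    apply: (is_derive_cast (is_derive_add D D2)).
    by rewrite /Axx -(HV 1 1); field.
- move=> t x /andP[tI xI]; have r0 := lt0r_neq0 (r_gt0 tI).
  have x0 := xi0 xI.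
  have ch j : {for t, continuous (H j ^~ x)} by exact: is_derive_continuous (dHt j t x0).
  have cc (k : R) : {for t, continuous (fun _ : R => k)} by exact: cvg_cst.
  apply: continuous_add.
    apply: continuous_mul; last exact: cJ.
    by apply: continuous_add; apply: continuous_mul.
  apply: continuous_sub.
    by apply: continuous_mul; [exact: continuous_mul|exact: cJt].
  by apply: continuous_mul => //; apply: continuous_mul; [exact: continuous_mul|exact: cJx].
- move=> t x _.
  have ch j : {for x, continuous (H j t)} by exact: is_derive_continuous (dHx j t x).
  have cc (k : R) : {for x, continuous (fun _ : R => k)} by exact: cvg_cst.
  have cx : {for x, continuous (fun x => x - l)} by exact: is_derive_continuous (dx_shift x).
  have cj : {for x, continuous (J n.+1 t)} by exact: is_derive_continuous (dJx n.+1 t x).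
  have cjx : {for x, continuous (Jx n.+1 t)} by exact: is_derive_continuous (dJxx n.+1 t x).
  have cjxx : {for x, continuous (Jxx n.+1 t)}.
    apply: (@continuous_comp _ _ _ (eta t) (fser_xx phi p n.+1 (sg t))).
      exact: is_derive_continuous (deta_x t x).
    exact: fser_xx_continuous.
  apply: continuous_add.
    apply: continuous_mul => //.
    apply: continuous_add; apply: continuous_mul => //.
    by apply: continuous_mul => //; apply: continuous_mul.
  by apply: continuous_sub; apply: continuous_mul => //; apply: continuous_mul => //; apply: continuous_mul.
- move=> t x tx; have /andP[tI xI] := tx; have /andP[_ xX] := lX xI.
  have xX2 : `|(x - l) ^+ 2 / 4| <= X ^+ 2 / 4.
    by apply: norm_leM; [exact: norm_leX|rewrite ger0_norm].
  have X20 : 0 <= X ^+ 2 by exact: sqr_ge0.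
  have BF : 0 <= B * c * F by exact: (mulr_ge0 (mulr_ge0 B_ge0 c_ge0) F_ge0).
  have BX := mulr_ge0 X_ge0 BF; have BX2 := mulr_ge0 X20 BF.
  have kc : flat_const * c = (2 + X + X ^+ 2) * (B * c * F) by rewrite /flat_const; ring.
  split.
  + have [h _ _] := @estJ 0 0 n.+1 t x isT isT tx; rewrite expr0 mul1r in h.
    by apply: (le_trans h); rewrite kc; lra.
  + have [h1 _ _] := @estJ 0 1 n.+1 t x isT isT tx; rewrite expr0 mul1r in h1.
    have [h2 _ _] := @estJ 0 2 n.+1 t x isT isT tx; rewrite expr0 mul1r in h2.
    have [_ h3 _] := @estJ 2 2 n.+1 t x isT isT tx.
    have [_ _ h4] := @estJ 1 2 n.+1 t x isT isT tx; rewrite expr1 in h4.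
    have -> : At n.+1 t x = - 2^-1 * (H 1 t x * J n.+1 t x) + (x - l) ^+ 2 / 4 * (H 2 t x * J n.+1 t x) +
      (s ^+ 2 * H 2 t x * Jt n.+1 t x - (x - l) * (s * H 2 t x * Jx n.+1 t x)) by rewrite /At; ring.
    have n2 : `|- 2^-1 : R| <= 2^-1 by rewrite normrN ger0_norm.
    apply: (le_trans (norm_leD (norm_leD (norm_leM n2 h1) (norm_leM xX2 h2)) (norm_leB h3 (norm_leM xX h4)))).
    by rewrite kc; lra.
  + have [h1 _ _] := @estJ 0 1 n.+1 t x isT isT tx; rewrite expr0 mul1r in h1.
    have [_ _ h4] := @estJ 1 1 n.+1 t x isT isT tx; rewrite expr1 in h4.
    have n2 : `|- ((x - l) / 2)| <= X / 2 by rewrite normrN; apply: (norm_leM xX); rewrite ger0_norm.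
    apply: (le_trans (norm_leD (norm_leM n2 h1) h4)).
    by rewrite kc; lra.
- move=> t x tx.
  have -> : At n.+1 t x - Axx n.+1 t x = s ^+ 2 * H 2 t x * (Jt n.+1 t x - Jxx n.+1 t x).
    by rewrite /At /Axx; ring.
  apply: est => //; first exact: (mulr_ge0 (flat_bound_ge0 q_gt0 M_ge0 Y1) (exprn_ge0 _ _)).
  + by move=> h; rewrite /Jt /Jxx; have [_ -> _ ->] := fser0 n.+1 (eta t x) h; rewrite subrr.
  + by move=> h; exact: fser_residual.
- move=> x xI; rewrite /A /J.
  have TI : 0 \in `[0, T] by rewrite in_itv/= lexx ltW.
  (* At time 0 the transformed time is - s T / (s - T) <= - T, inside the region where [phi]
     vanishes. *)
  have sg0 : sg 0 <= - (T / 2).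
    have r0 := r_gt0 TI; rewrite /sg sub0r mulrN mulNr lerN2 ler_pdivlMr//.
    by rewrite /r; move: T_gt0 sT; nra.
  by have [-> _ _ _] := fser0 n.+1 (eta 0 x) sg0; rewrite mulr0.
Qed.

Lemma flat_trajectory : trajectory L T (flat_const * s^-1 ^+ 2) 0 (flat_atom s l).
Proof.
(* In the last factor, 2 L T comes from the defect of the truncation and 1 from its uniform distance
   to the full series. *)
apply: (@trajectory_limit _ _ _ _ _ (fun n => B * c * (flat_bound q M Y * 2^-1 ^+ n) * (2 * L * T + 1)) (fun n => A n.+1)).
- exact: L_gt0.
- rewrite [X in _ --> X](_ : 0 = B * c * (flat_bound q M Y * 0) * (2 * L * T + 1)); last by ring.
  apply: cvgMl; apply: cvgMr; apply: cvgMr.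
  by apply: cvg_expr; rewrite ger0_norm// invf_lt1// ltr1n.
- move=> n; have [h1 h2] := partial n; split => // tau z Z tauI bz.
  have [t0 tT] : 0 <= tau /\ tau <= T by apply/andP; move: tauI; rewrite in_itv.
  have Z_ge0 : 0 <= Z.
    have rI : in_rect L tau 0 L by rewrite /in_rect !in_itv/= lexx t0 lexx andbT ltW ?gtrN.
    by have [_ bZ] := bz; have [+ _] := bZ _ _ rI; exact: le_trans.
  apply: (le_trans (h2 tau z Z tauI bz)); apply: ler_wpM2r => //.
  have fn : 0 <= flat_bound q M Y * 2^-1 ^+ n.
    exact: (mulr_ge0 (flat_bound_ge0 q_gt0 M_ge0 Y1) (exprn_ge0 _ _)).
  have BF := mulr_ge0 (mulr_ge0 B_ge0 c_ge0) fn.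
  have -> : eps n = B * c * (flat_bound q M Y * 2^-1 ^+ n) * (2 * L * T) by rewrite /eps; ring.
  by apply: (ler_wpM2l BF); rewrite lerDl.
- move=> n t x tx.
  have -> : flat_atom s l t x - A n.+1 t x =
    s ^+ 0 * H 0 t x * (fser_lim Y phi p (sg t) (eta t x) - J n.+1 t x).
    by rewrite expr0 /flat_atom /A /H; ring.
  have fb := flat_bound_ge0 q_gt0 M_ge0 Y1.
  have fn : 0 <= flat_bound q M Y * 2^-1 ^+ n by rewrite mulr_ge0 ?exprn_ge0.
  apply: (@le_trans _ _ (B * c * (flat_bound q M Y * 2^-1 ^+ n))).
    apply: est => //.
      move=> h; have [j0 _ _ _] := fser0 n.+1 (eta t x) h; rewrite /J j0 subr0.
      rewrite /fser_lim (_ : (fun n => _) = cst 0) ?lim_cst//.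
      by apply/funext => m /=; have [] := fser0 m (clip Y (eta t x)) h.
    move=> h; apply: (le_trans (fser_lim_tail p1 q_gt0 M_ge0 Y1 qY gphi n.+1 (sg t) h)).
    by rewrite exprS; lra.
  have BF : 0 <= B * c * (flat_bound q M Y * 2^-1 ^+ n).
    exact: (mulr_ge0 (mulr_ge0 B_ge0 c_ge0) fn).
  rewrite -[leLHS]mulr1; apply: ler_wpM2l => //.
  by rewrite lerDr !mulr_ge0// ltW.
Qed.

End flat.

Lemma fser_lim_at0 (R : realType) (Y : R) (phi : nat -> R -> R) (p : nat) (x : R) :
  (p <= 1)%N -> phi 0 0 = 1 -> (forall n, phi n.+1 0 = 0) -> `|x| <= Y ->
  fser_lim Y phi p 0 x = x ^+ p.
Proof.
move=> p1 h0 hS xY; rewrite /fser_lim (clip_id xY).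
have E n : fser phi p n.+1 0 x = x ^+ p.
  rewrite /fser big_ord_recl /= big1 ?addr0; last by move=> i _; rewrite hS mul0r.
  by rewrite h0 mul1r /mono; case: p p1 => [|[|]]// _; rewrite add0n divr1.
apply/cvg_lim => //; rewrite -cvg_shiftS /= (_ : (fun n => _) = cst (x ^+ p)); last exact/funext.
exact: cvg_cst.
Qed.

Lemma measurable_wt (R : realType) d (V : measurableType d) (s : V -> R) :
  measurable_fun setT s -> measurable_fun setT (fun v => wt (s v)).
Proof.
move=> ms; have -> : (fun v => wt (s v)) = fun v => hk 1 (s v) 0.
  by apply/funext => v; rewrite /wt /hk expr1 expr0n/= mul0r oppr0 expR0 mulr1.
exact: measurable_hk.
Qed.

(** * Gaussians as final states, with constants integrable in s *)

Section atoms.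
Context {R : realType}.
Variables (L L' L0 T : R).
Hypotheses (L_gt0 : 0 < L) (LL' : L < L') (L'L0 : L' <= L0) (T_gt0 : 0 < T).

Lemma heat_atoms : exists (A : nat -> R -> R -> R -> R -> R) (K : R),
  [/\ 0 <= K,
      forall p s l, (p <= 1)%N -> 0 < s -> L' <= `|l| <= L0 ->
        trajectory L T (K / (1 + s ^+ 2)) 0 (A p s l),
      forall p s l x, (p <= 1)%N -> 0 < s -> L' <= `|l| <= L0 -> x \in `[- L, L] ->
        A p s l T x = wt s * hk 0 s (x - l) * (x - l) ^+ p &
      forall p, (p <= 1)%N ->
        measurable_fun setT (fun w : (R * R) * (R * R) => A p w.1.1 w.1.2 w.2.1 w.2.2)].
Proof.
pose d := L' - L; pose X := L0 + L; pose Y := 2 * X + 1.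
have d0 : 0 < d by rewrite subr_gt0.
have X0 : 0 <= X by rewrite /X; move: L_gt0 LL' L'L0; lra.
have Y1 : 1 <= Y by rewrite /Y lerDr mulr_ge0.
have Y0 : 0 < Y by apply: lt_le_trans Y1.
(* The rate for which 4 q Y^2 equals 1/2. *)
pose q := (8 * Y ^+ 2)^-1.
have q0 : 0 < q by rewrite invr_gt0 mulr_gt0 ?exprn_gt0.
have qY : 4 * (q * Y ^+ 2) <= 2^-1.
  rewrite (_ : 4 * (q * Y ^+ 2) = 2^-1)// /q; field; rewrite gt_eqF//.
have T20 : 0 < T / 2 by rewrite divr_gt0.
have [phi [M [jphi M0 gphi flat [phi0 phiS]]]] := gevrey_step T20 q0.
have dX (l : R) : L' <= `|l| <= L0 -> forall x : R, x \in `[- L, L] -> d <= `|x - l| <= X.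
  move=> /andP[l1 l2] x; rewrite in_itv/= -ler_norml => xL.
  apply/andP; split.
    rewrite distrC /d; apply: le_trans (lerB_dist _ _); exact: lerB.
  by apply: (le_trans (ler_normB _ _)); rewrite addrC /X; exact: lerD.
pose A p s l t x := if s <= T then
    (if p == 0%N then wt s * hk 0 (t - T + s) (x - l)
     else s * (x - l) * (wt s * hk 1 (t - T + s) (x - l)))
  else flat_atom T X phi p s l t x.
pose K1 := causal_const T d X; pose K2 := flat_const T X q M.
(* For s <= T the constant bound is multiplied by (1 + T^2) / (1 + s^2) >= 1; for s > T one has s^-2
   (1 + s^2) <= 1 + T^-2. *)
pose K := `|K1| * (1 + T ^+ 2) + `|K2| * (1 + T^-1 ^+ 2).
have K0 : 0 <= K by rewrite addr_ge0 ?mulr_ge0 ?addr_ge0 ?sqr_ge0.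
exists A, K; split => //.
- move=> p s l p1 s0 /dX lX; rewrite /A.
  have s21 : 0 < 1 + s ^+ 2 by rewrite ltr_wpDr ?sqr_ge0.
  have [sT|sT] := leP s T.
    apply: (@trajectory_weaken _ _ _ K1); last first.
      by case: eqP => _; [exact: causal0_trajectory|exact: causal1_trajectory].
    rewrite ler_pdivlMr//; apply: (@le_trans _ _ (`|K1| * (1 + T ^+ 2))).
      apply: (@le_trans _ _ (`|K1| * (1 + s ^+ 2))); first by apply: ler_wpM2r; [exact: ltW|exact: ler_norm].
      apply: ler_wpM2l; first exact: normr_ge0.
      by rewrite lerD2l; apply: lerXn2r => //; rewrite nnegrE ltW.
    by rewrite lerDl mulr_ge0 ?addr_ge0 ?sqr_ge0.
  apply: (@trajectory_weaken _ _ _ (K2 * s^-1 ^+ 2)); last first.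
    exact: (flat_trajectory L_gt0 T_gt0 d0 X0 p1 q0 M0 qY).
  rewrite ler_pdivlMr//; apply: (@le_trans _ _ (`|K2| * (1 + T^-1 ^+ 2))).
    rewrite -mulrA; apply: (@le_trans _ _ (`|K2| * (s^-1 ^+ 2 * (1 + s ^+ 2)))).
      by apply: ler_wpM2r; [rewrite mulr_ge0 ?sqr_ge0// ltW|exact: ler_norm].
    apply: ler_wpM2l => //; rewrite mulrDr mulr1 addrC -exprMn mulVf ?gt_eqF// expr1n lerD2l.
    by rewrite lerXn2r ?nnegrE ?invr_ge0 ?ltW// ltf_pV2 ?posrE.
  by rewrite lerDr mulr_ge0 ?addr_ge0 ?sqr_ge0.
- move=> p s l x p1 s0 /dX lX xL; rewrite /A.
  have sn : s != 0 by rewrite gt_eqF.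
  have [sT|sT] := leP s T.
    rewrite subrr add0r; case: p p1 => [|[|]]//= _; first by rewrite expr0 mulr1.
    by rewrite -(hkS 0 1) expr1; field.
  (* At time T the transformed time is 0 and the transformed position is x - l, where the series
     reduces to (x - l)^p. *)
  rewrite /flat_atom subrr add0r mulr0 mul0r [s * _]mulrC mulfK//.
  rewrite fser_lim_at0//; have /andP[_ h] := lX x xL.
  by apply: (le_trans h); rewrite /Y; lra.
- move=> p p1; rewrite /A.
  pose V := ((R * R) * (R * R))%type.
  have ms : measurable_fun setT (fun w : V => w.1.1) by exact: measurableT_comp.
  have ml : measurable_fun setT (fun w : V => w.1.2) by exact: measurableT_comp.
  have mt : measurable_fun setT (fun w : V => w.2.1) by exact: measurableT_comp.
  have mx : measurable_fun setT (fun w : V => w.2.2) by exact: measurableT_comp.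
  have mc : measurable_fun setT (fun w : V => T) by exact: measurable_cst.
  have mtT : measurable_fun setT (fun w : V => w.2.1 - T) by exact: measurable_funB.
  have mr : measurable_fun setT (fun w : V => w.2.1 - T + w.1.1) by exact: measurable_funD.
  have mxi : measurable_fun setT (fun w : V => w.2.2 - w.1.2) by exact: measurable_funB.
  have mri : measurable_fun setT (fun w : V => (w.2.1 - T + w.1.1)^-1).
    exact: (measurableT_comp (@measurable_inv R) mr).
  have mH j : measurable_fun setT (fun w : V => wt w.1.1 * hk j (w.2.1 - T + w.1.1) (w.2.2 - w.1.2)).
    by apply: measurable_funM; [exact: measurable_wt|exact: measurable_hk].
  apply: measurable_fun_ifT.
  + exact: measurable_fun_ler.
  + case: (p == 0%N); first exact: mH.
    by apply: measurable_funM; [exact: measurable_funM|exact: mH].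
  + apply: measurable_funM; first exact: mH.
    apply: (measurable_plane_comp (measurable_fser_lim p1 q0 M0 Y1 qY jphi gphi)).
    * by apply: measurable_funM => //; exact: measurable_funM.
    * by apply: measurable_funM => //; exact: measurable_funM.
Qed.

End atoms.

(** * Superpositions of heat kernels *)

Section laplace.
Context {R : realType}.
Variable a : R.
Hypothesis a_gt0 : 0 < a.

(** The function exp (- a / 4s) for s > 0, extended by 0. Writing it through [hk] gives its
    derivative, and its measurability jointly in a and s, from the results on [hk]. *)
Definition heat_exp (s : R) : R := Num.sqrt s * hk 0 s (Num.sqrt a).

Let ee := heat_exp.

Let ee_le0 (s : R) : s <= 0 -> ee s = 0.
Proof. by move=> s0; rewrite /ee /heat_exp hk_le0// mulr0. Qed.

Lemma heat_expE (s : R) : 0 < s -> heat_exp s = expR (- (a / 4 * s^-1)).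
Proof.
move=> s0; rewrite /heat_exp /hk expr0 mul1r mulrA mulfV ?gt_eqF ?sqrtr_gt0// mul1r.
rewrite sqr_sqrtr; last exact: ltW.
by rewrite invfM mulrA.
Qed.

Let ee_bound n (s : R) : 0 < s -> ee s <= n`!%:R * (4 / a) ^+ n * s ^+ n.
Proof.
move=> s0; rewrite /ee heat_expE//.
have an : a / 4 * s^-1 != 0 by rewrite gt_eqF// !divr_gt0.
have x0 : 0 <= a / 4 * s^-1 by rewrite !divr_ge0// ltW.
have := expRN_pow_le n x0.
rewrite mulrC -ler_pdivlMr ?exprn_gt0 ?lt_def ?an//.
have -> : n`!%:R / (a / 4 * s^-1) ^+ n = n`!%:R * (4 / a) ^+ n * s ^+ n; last by [].
  rewrite -exprVn -[RHS]mulrA -[(4 / a) ^+ n * _]exprMn; congr (_ * _ ^+ n).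
by field; rewrite !gt_eqF.
Qed.

Let dee (s : R) : 0 < s -> is_derive s 1 ee (a / 4 * (s^-1 ^+ 2 * ee s)).
Proof.
move=> s0; have sa : Num.sqrt a != 0 by rewrite gt_eqF// sqrtr_gt0.
apply: (is_derive_cast (is_derive_mul (is_derive1_sqrt s0) (is_derive_hk_t 0 s sa))).
rewrite /ee /heat_exp -(hkS 0 1) -(hkS 0 2) sqr_sqrtr; last exact: ltW.
have w0 : Num.sqrt s != 0 by rewrite gt_eqF// sqrtr_gt0.
have si : s^-1 = (Num.sqrt s)^-1 ^+ 2 by rewrite exprVn sqr_sqrtr// ltW.
by rewrite si; move: (hk 0 s _) (Num.sqrt s) w0 => h w w0; field.
Qed.

Variable b : R.

(* The real part of s^-k (u + i v) exp (- (a + i b) / 4 s). *)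
Definition heat_osc k (u v s : R) : R :=
  s^-1 ^+ k * (ee s * (u * cos (b / 4 * s^-1) + v * sin (b / 4 * s^-1))).

Let G := heat_osc.

Let trig_bound (u v x y : R) : `|u * cos x + v * sin y| <= `|u| + `|v|.
Proof.
by rewrite -[`|u|]mulr1 -[`|v|]mulr1; apply: norm_leD; apply: norm_leM; rewrite ?cos_max ?sin_max.
Qed.

(** The derivative of exp (- zeta / 4s) is zeta / (4 s^2) times itself: two more powers of 1 / s,
    and u + i v multiplied by (a + i b) / 4. For k = 0 this exhibits the primitive of the integrand
    with k = 2. *)
Lemma is_derive_heat_osc k (u v s : R) : is_derive s 1 (heat_osc k u v)
  (heat_osc k.+2 ((a * u - b * v) / 4) ((a * v + b * u) / 4) s - k%:R * heat_osc k.+1 u v s).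
Proof.
pose f' s := G k.+2 ((a * u - b * v) / 4) ((a * v + b * u) / 4) s - k%:R * G k.+1 u v s.
pose C := (k.+2)`!%:R * (4 / a) ^+ k.+2 * (`|u| + `|v|).
apply: (@is_derive_flat _ (G k u v) f' C) => {}s s0.
- by rewrite /f' /G /heat_osc !ee_le0// !mul0r !mulr0 subrr.
- have sn : s != 0 by rewrite gt_eqF.
  have Di := is_derive_inv sn (is_derive_id s (1 : R)).
  have Db := is_derive_scale (b / 4) Di.
  have Dc := is_derive_scale u (is_derive_comp Db (is_derive_cos _)).
  have Ds := is_derive_scale v (is_derive_comp Db (is_derive_sin _)).
  have D := is_derive_mul (is_derive_pow k Di) (is_derive_mul (dee s0) (is_derive_add Dc Ds)).
  apply: (is_derive_cast D); rewrite /f' /G /heat_osc.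
  have kE : k%:R * s^-1 ^+ k.-1 * (- 1 / s ^+ 2) = - (k%:R * s^-1 ^+ k.+1).
    by case: (k) => [|m]; [rewrite !mul0r oppr0|rewrite /= !exprS; field].
  rewrite kE [s^-1 ^+ k.+2]exprS [s^-1 ^+ k.+1]exprS.
  have -> : - 1 / s ^+ 2 = - s^-1 ^+ 2 by rewrite exprVn mulN1r.
  move: (ee s) (cos (b / 4 * s^-1)) (sin (b / 4 * s^-1)) (s^-1 ^+ k) => E c1 s1 P.
  by move: (s^-1) (k%:R : R) => i k'; field.
- rewrite /G /heat_osc normrM normrM.
  have si : 0 <= s^-1 by rewrite invr_ge0 ltW.
  rewrite (ger0_norm (exprn_ge0 k si)).
  have e0 : 0 <= ee s by rewrite /ee heat_expE ?expR_ge0.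
  rewrite (ger0_norm e0).
  apply: (@le_trans _ _ (s^-1 ^+ k * ((k.+2)`!%:R * (4 / a) ^+ k.+2 * s ^+ k.+2 * (`|u| + `|v|)))).
    apply: ler_wpM2l; first exact: exprn_ge0.
    by apply: ler_pM => //; exact: ee_bound.
  have -> : s^-1 ^+ k * ((k.+2)`!%:R * (4 / a) ^+ k.+2 * s ^+ k.+2 * (`|u| + `|v|)) =
      (k.+2)`!%:R * (4 / a) ^+ k.+2 * (`|u| + `|v|) * ((s^-1 * s) ^+ k * s ^+ 2).
    have -> : s ^+ k.+2 = s ^+ k * s ^+ 2 by rewrite -exprD addn2.
    rewrite [(s^-1 * s) ^+ k]exprMn.
    by move: (s^-1 ^+ k) (s ^+ k) ((4 / a) ^+ k.+2) => *; ring.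
  by rewrite mulVf ?gt_eqF// expr1n mul1r /C.
Qed.

Lemma heat_osc_ge k (u v s : R) : 0 < s -> - (s^-1 ^+ k * ee s * (`|u| + `|v|)) <= heat_osc k u v s.
Proof.
move=> s0; have /ler_normlP[h _] := trig_bound u v (b / 4 * s^-1) (b / 4 * s^-1).
rewrite /heat_osc [leRHS]mulrA -mulrN; apply: ler_wpM2l; last by rewrite lerNl.
rewrite mulr_ge0 ?exprn_ge0 ?invr_ge0 ?ltW//; rewrite /ee heat_expE ?expR_ge0//.
by rewrite expR_gt0.
Qed.

Lemma heat_osc_cvg (u v : R) : heat_osc 0 u v s @[s --> +oo] --> u.
Proof.
have iv : (s : R)^-1 @[s --> +oo] --> (0 : R).
  by apply/gtr0_cvgV0; [exact: nbhs_pinfty_gt|exact: cvg_id].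
pose H (x : R) := expR (- (a / 4) * x) * (u * cos (b / 4 * x) + v * sin (b / 4 * x)).
have cH : {for 0, continuous H}.
  have Di (c : R) := is_derive_scale c (is_derive_id (0 : R) (1 : R)).
  exact: is_derive_continuous (is_derive_mul (is_derive_exp (Di (- (a / 4))))
    (is_derive_add (is_derive_scale u (is_derive_comp (Di (b / 4)) (is_derive_cos _)))
      (is_derive_scale v (is_derive_comp (Di (b / 4)) (is_derive_sin _))))).
have H0 : H 0 = u by rewrite /H !mulr0 expR0 cos0 sin0; ring.
rewrite -{2}H0; apply: cvg_trans (cvg_comp _ _ iv cH).
apply: near_eq_cvg; near=> s; have s0 : 0 < s by near: s; exact: nbhs_pinfty_gt.
by rewrite /heat_osc /ee (heat_expE s0) expr0 mul1r /H /= mulNr.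
Unshelve. all: by end_near. Qed.

Lemma measurable_heat_osc k (u v : R) : measurable_fun setT (heat_osc k u v).
Proof.
by apply: continuous_measurable_fun => s; exact: is_derive_continuous (is_derive_heat_osc k u v s).
Qed.

End laplace.

Lemma heat_osc_sum_ge0 (R : realType) (a b u v w s : R) : 0 < a -> `|u| + `|v| <= w -> 0 < s ->
  0 <= heat_osc a 0 2 w 0 s + heat_osc a b 2 u v s.
Proof.
move=> a0 uvw s0; have h := heat_osc_ge a0 b 2 u v s0.
have P : 0 <= s^-1 ^+ 2 * heat_exp a s.
  by rewrite (heat_expE a0 s0); exact: (mulr_ge0 (sqr_ge0 _) (expR_ge0 _)).
have := ler_wpM2l P uvw.
have -> : heat_osc a 0 2 w 0 s = s^-1 ^+ 2 * heat_exp a s * w.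
  by rewrite /heat_osc !mul0r cos0; ring.
by move: h; lra.
Qed.

(** The fundamental theorem on the half-line is used for nonnegative integrands, so the oscillating
    one is shifted by a non-oscillating one of weight [w >= |u| + |v|]. The primitive has
    coefficients A + i B = 4 (u + i v) / (a + i b); it vanishes at 0 and tends to its real
    coefficients at infinity. *)
Lemma heat_osc_ge0_integral (R : realType) (a b u v w : R) : 0 < a -> `|u| + `|v| <= w ->
  (\int[leb R]_(s in `]0%R, +oo[) (heat_osc a 0 2 w 0 s + heat_osc a b 2 u v s)%:E =
   (4 * w / a + 4 * (u * a + v * b) / (a ^+ 2 + b ^+ 2))%:E)%E.
Proof.
move=> a0 uvw.
have w0 : 0 <= w by apply: le_trans uvw; rewrite addr_ge0.
have N0 : a ^+ 2 + b ^+ 2 != 0 by rewrite gt_eqF// ltr_wpDr ?sqr_ge0// exprn_gt0.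
have an : a != 0 by rewrite gt_eqF.
pose A := 4 * (u * a + v * b) / (a ^+ 2 + b ^+ 2).
pose B := 4 * (v * a - u * b) / (a ^+ 2 + b ^+ 2).
pose A0 := 4 * w / a.
pose f (s : R) := heat_osc a 0 2 w 0 s + heat_osc a b 2 u v s.
pose F (s : R) := heat_osc a 0 0 A0 0 s + heat_osc a b 0 A B s.
have dF (s : R) : is_derive s 1 F (f s).
  apply: (is_derive_cast (is_derive_add (is_derive_heat_osc a0 0 0 A0 0 s) (is_derive_heat_osc a0 b 0 A B s))).
  rewrite !mul0r !subr0 /f; congr (heat_osc _ _ _ _ _ _ + heat_osc _ _ _ _ _ _); rewrite /A0 /A /B; by field.
have cf : continuous f.
  move=> s; apply: continuous_add; exact: is_derive_continuous (is_derive_heat_osc a0 _ _ _ _ s).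
have F0 : F 0 = 0.
  by rewrite /F /heat_osc /heat_exp sqrtr0 !mul0r !mulr0 addr0.
rewrite integral_itv_obnd_cbnd; last first.
  by apply/measurable_EFinP; apply: measurable_funTS; apply: measurable_funD; exact: measurable_heat_osc.
rewrite (@ge0_continuous_FTC2y _ f F 0 (A0 + A)).
- by rewrite F0 -EFinB subr0.
- move=> s; rewrite le_eqVlt => /predU1P[<-|s0].
    by rewrite /f /heat_osc /heat_exp sqrtr0 !mul0r !mulr0 addr0.
  exact: heat_osc_sum_ge0.
- exact: continuous_subspaceT.
- by apply: cvgD; exact: heat_osc_cvg.
- by move=> s _; have [] := dF s.
- by apply: cvg_at_right_filter; exact: is_derive_continuous (dF 0).
- by move=> s _; rewrite derive1E; have [_ ->] := dF s.
Qed.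

(** The real part of 4 (u + i v) / (a + i b), obtained as the difference of two shifted integrals
    with the same shift. *)
Lemma heat_osc_integral (R : realType) (a b u v : R) : 0 < a ->
  (leb R).-integrable `]0, +oo[ (EFin \o heat_osc a b 2 u v) /\
  \int[leb R]_(s in `]0, +oo[) heat_osc a b 2 u v s = 4 * (u * a + v * b) / (a ^+ 2 + b ^+ 2).
Proof.
move=> a0; pose w := `|u| + `|v|.
have w0 : `|0 : R| + `|0 : R| <= w by rewrite normr0 addr0 addr_ge0.
have an : a != 0 by rewrite gt_eqF.
have ig (b' u' v' : R) : `|u'| + `|v'| <= w ->
    (leb R).-integrable `]0, +oo[ (EFin \o (fun s => heat_osc a 0 2 w 0 s + heat_osc a b' 2 u' v' s)) /\
    \int[leb R]_(s in `]0, +oo[) (heat_osc a 0 2 w 0 s + heat_osc a b' 2 u' v' s) =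
      4 * w / a + 4 * (u' * a + v' * b') / (a ^+ 2 + b' ^+ 2).
  move=> h; have I := heat_osc_ge0_integral b' a0 h.
  split; last by rewrite /Rintegral I.
  apply/integrableP; split.
    by apply/measurable_EFinP; apply: measurable_funTS; apply: measurable_funD; exact: measurable_heat_osc.
  apply: le_lt_trans (ltry (4 * w / a + 4 * (u' * a + v' * b') / (a ^+ 2 + b' ^+ 2))).
  rewrite -I le_eqVlt; apply/orP; left; apply/eqP; apply: eq_integral => s.
  rewrite inE/= in_itv/= andbT => s0.
  by rewrite ger0_norm//; exact: heat_osc_sum_ge0.
have [i1 e1] := ig b u v (lexx _).
have [i2 e2] := ig 0 0 0 w0.
have E : heat_osc a b 2 u v = fun s => (heat_osc a 0 2 w 0 s + heat_osc a b 2 u v s) -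
    (heat_osc a 0 2 w 0 s + heat_osc a 0 2 0 0 s).
  by apply/funext => s; rewrite [heat_osc a 0 2 0 0 s]/heat_osc; ring.
rewrite E; split.
  have := @integrableB _ _ _ (leb R) _ (measurable_itv _) _ _ i1 i2.
  exact.
rewrite (RintegralB _ i1 i2); last exact: measurable_itv.
by rewrite e1 e2; field; rewrite an /= gt_eqF// ltr_wpDr ?sqr_ge0// exprn_gt0.
Qed.

Lemma Rintegral_prod d1 d2 (X : measurableType d1) (Y : measurableType d2) (R : realType)
    (m1 : {sigma_finite_measure set X -> \bar R}) (m2 : {sigma_finite_measure set Y -> \bar R})
    (D1 : set X) (D2 : set Y) (f : X * Y -> R) :
  measurable D1 -> measurable D2 ->
  (m1 \x m2)%E.-integrable (D1 `*` D2) (EFin \o f) ->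
  (forall x, D1 x -> m2.-integrable D2 (fun y => (f (x, y))%:E)) ->
  \int[(m1 \x m2)%E]_(w in D1 `*` D2) f w = \int[m1]_(x in D1) (\int[m2]_(y in D2) f (x, y)).
Proof.
move=> mD1 mD2 fi fs; have mD := measurableX mD1 mD2.
rewrite [LHS]Rintegral_mkcond [RHS]Rintegral_mkcond.
have Fi : (m1 \x m2)%E.-integrable setT (EFin \o (f \_ (D1 `*` D2))).
  by rewrite -restrict_EFin; apply/(integrable_mkcond _ mD).
rewrite {1}/Rintegral -(integral12_prod_meas1 Fi) {1}/Rintegral; congr fine.
apply: eq_integral => x _; rewrite /fubini_F /= patchE.
have E y : (f \_ (D1 `*` D2)) (x, y) =
    if x \in D1 then ((fun y => f (x, y)) \_ D2) y else 0.
  rewrite !patchE.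
  have -> : ((x, y) \in D1 `*` D2) = (x \in D1) && (y \in D2).
    by apply/idP/andP; rewrite !inE.
  by case: (x \in D1); case: (y \in D2).
under eq_integral do rewrite E.
case: ifPn => [/set_mem xD|xD]; last by rewrite integral0_eq.
rewrite /Rintegral fineK; last exact: (integrable_fin_num mD2 (fs x xD)).
by rewrite [RHS]integral_mkcond restrict_EFin.
Qed.

Section sigma_finite_product.
Local Open Scope ereal_scope.
Context d1 d2 (X : measurableType d1) (Y : measurableType d2) (R : realType).
Variables (m1 : {sigma_finite_measure set X -> \bar R})
          (m2 : {sigma_finite_measure set Y -> \bar R}).

(* The library's canonical sigma-finite structure on [m1 \x m2] is the one of a
   pair of subprobabilities; this copy carries the general one. *)
Definition sigma_product : set (X * Y) -> \bar R := m1 \x m2.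

HB.instance Definition _ := Measure.copy sigma_product (m1 \x m2).

Let sigma_product_sigma_finite : sigma_finite setT sigma_product.
Proof.
have /sigma_finiteP[F [TF ndF Foo]] := sigma_finiteT m1.
have /sigma_finiteP[G [TG ndG Goo]] := sigma_finiteT m2.
exists (fun n => F n `*` G n).
  rewrite -setXTT TF TG; apply/seteqP; split=> [[x y] [/= [n _ Fnx] [k _ Gky]]|[x y] [n _ []]].
    by exists (maxn n k) => //; split; [move: x Fnx; exact/subsetPset/ndF/leq_maxl|
      move: y Gky; exact/subsetPset/ndG/leq_maxr].
  by split; exists n.
move=> k; have [F1 F2] := Foo k; have [G1 G2] := Goo k; split; first exact: measurableX.
by rewrite /sigma_product product_measure1E// lte_mul_pinfty// ge0_fin_numE.
Qed.

HB.instance Definition _ :=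
  Measure_isSigmaFinite.Build _ _ _ sigma_product sigma_product_sigma_finite.

End sigma_finite_product.

Lemma trajectory_product_integral (R : realType) (L T : R) : 0 < L ->
  forall d1 d2 (X : measurableType d1) (Y : measurableType d2)
    (m1 : {sigma_finite_measure set X -> \bar R}) (m2 : {sigma_finite_measure set Y -> \bar R})
    (D1 : set X) (D2 : set Y) (g : X * Y -> R) (A : X * Y -> R -> R -> R),
  measurable D1 -> measurable D2 ->
  (m1 \x m2)%E.-integrable (D1 `*` D2) (EFin \o g) ->
  measurable_fun setT (fun p : (X * Y) * (R * R) => A p.1 p.2.1 p.2.2) ->
  (forall w, (D1 `*` D2) w -> trajectory L T (g w) 0 (A w)) ->
  trajectory L T (\int[(m1 \x m2)%E]_(w in D1 `*` D2) g w) 0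
    (fun t x => \int[(m1 \x m2)%E]_(w in D1 `*` D2) A w t x).
Proof.
move=> L0 d1 d2 X Y m1 m2 D1 D2 g A mD1 mD2 ig mA TA.
exact: (@trajectory_parameter_integral R L T L0 _ _ (sigma_product m1 m2) _ g A (measurableX mD1 mD2) ig mA TA).
Qed.

Lemma wt_hk0 (R : realType) (s xi : R) : 0 < s ->
  wt s * hk 0 s xi = s^-1 ^+ 2 * expR (- (xi ^+ 2 / (4 * s))).
Proof.
move=> s0; have -> : wt s * hk 0 s xi =
    s^-1 * ((Num.sqrt s)^-1 ^+ 2) * expR (- (xi ^+ 2 / (4 * s))) by rewrite /wt /hk; ring.
by rewrite exprVn sqr_sqrtr ?expr2// ltW.
Qed.

(** * Quotients as final states of superposed atoms *)

Section pole.
Context {R : realType}.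
Variables (L L' L0 T : R).
Hypotheses (L_gt0 : 0 < L) (LL' : L < L') (L'L0 : L' <= L0) (T_gt0 : 0 < T).
Variables (u0 v0 u1 v1 a b l G : R -> R).
Hypotheses (mu0 : measurable_fun setT u0) (mv0 : measurable_fun setT v0)
  (mu1 : measurable_fun setT u1) (mv1 : measurable_fun setT v1)
  (ma : measurable_fun setT a) (mb : measurable_fun setT b) (ml : measurable_fun setT l).
Hypothesis iG : (leb R).-integrable `]- L0, L0[ (EFin \o G).
Hypothesis G_ge : forall y, y \in `]- L0, L0[ -> `|u0 y| + `|v0 y| + (`|u1 y| + `|v1 y|) <= G y.
Hypothesis a_ge0 : forall y, y \in `]- L0, L0[ -> 0 <= a y.
Hypothesis l_bd : forall y, y \in `]- L0, L0[ -> L' <= `|l y| <= L0.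

(* The real part of 4 (H0 + H1 xi) / (xi^2 + zeta) for H0 = u0 + i v0,
   H1 = u1 + i v1 and zeta = a + i b. *)
Definition real_pole (u0 v0 u1 v1 a b xi : R) : R :=
  4 * ((u0 + u1 * xi) * (xi ^+ 2 + a) + (v0 + v1 * xi) * b) / ((xi ^+ 2 + a) ^+ 2 + b ^+ 2).

(** The real part of (u + i v) exp (- (a + i b) / 4s) at w = (y, s): the weight of an atom, bounded
    by |u| + |v| because a >= 0. *)
Let osc (u v : R -> R) (w : R * R) : R :=
  expR (- (a w.1 / 4 * w.2^-1)) *
    (u w.1 * cos (b w.1 / 4 * w.2^-1) + v w.1 * sin (b w.1 / 4 * w.2^-1)).

Let osc_bound u v w : w.1 \in `]- L0, L0[ -> 0 < w.2 -> `|osc u v w| <= `|u w.1| + `|v w.1|.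
Proof.
move=> yI s0; rewrite /osc -[leRHS]mul1r; apply: norm_leM.
  rewrite ger0_norm ?expR_ge0// -expR0 ler_expR oppr_le0.
  by rewrite !mulr_ge0 ?invr_ge0 ?a_ge0// ltW.
by rewrite -[`|u w.1|]mulr1 -[`|v w.1|]mulr1; apply: norm_leD; apply: norm_leM; rewrite ?cos_max ?sin_max.
Qed.

Let mosc (u v : R -> R) : measurable_fun setT u -> measurable_fun setT v -> measurable_fun setT (osc u v).
Proof.
move=> mu mv.
have m1 (f : R -> R) : measurable_fun setT f -> measurable_fun setT (fun w : R * R => f w.1).
  by move=> mf; exact: (measurableT_comp mf measurable_fst).
have mi : measurable_fun setT (fun w : R * R => w.2^-1).
  exact: (measurableT_comp (@measurable_inv R) measurable_snd).
have m4 (f : R -> R) : measurable_fun setT f -> measurable_fun setT (fun w : R * R => f w.1 / 4 * w.2^-1).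
  by move=> mf; apply: measurable_funM mi; apply: measurable_funM; [exact: m1|exact: measurable_cst].
apply: measurable_funM.
  by apply: (measurableT_comp (@measurable_expR R)); apply: measurable_funN; exact: m4.
have mc : measurable_fun setT (@cos R) by apply: continuous_measurable_fun; exact: continuous_cos.
have msn : measurable_fun setT (@sin R) by apply: continuous_measurable_fun; exact: continuous_sin.
exact: (measurable_funD (measurable_funM (m1 _ mu) (measurableT_comp mc (m4 _ mb)))
  (measurable_funM (m1 _ mv) (measurableT_comp msn (m4 _ mb)))).
Qed.

Let oneDsqr_integrable (K : R) : 0 <= K ->
  (leb R).-integrable `]0, +oo[ (EFin \o (fun s => K / (1 + s ^+ 2))).
Proof.
move=> K0.
have m1 : measurable_fun setT (fun s : R => (1 + s ^+ 2)^-1).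
  by apply: (measurableT_comp (@measurable_inv R)); apply: measurable_funD => //; exact: measurable_funX.
have i1 : (leb R).-integrable `[0, +oo[ (EFin \o (fun s : R => (1 + s ^+ 2)^-1)).
  apply/integrableP; split.
    by apply/measurable_EFinP; exact: measurable_funTS.
  apply: le_lt_trans (ltry (pi / 2)).
  rewrite -integral0y_oneDsqr le_eqVlt; apply/orP; left; apply/eqP; apply: eq_integral => s _ /=.
  by rewrite ger0_norm// invr_ge0 addr_ge0// sqr_ge0.
have i2 := @integrableZl _ _ R (leb R) _ (measurable_itv _) K _ i1.
apply: (@integrableS _ _ _ (leb R) `[0, +oo[) => //.
by apply: subset_itvr; rewrite bnd_simp.
Qed.

(** Atoms centred at [l y] are superposed over (y, s) with weights [osc], under the majorant G(y) K
    / (1 + s^2). At time T the s-integral is a Laplace integral with real part (x - l)^2 + a of the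
    exponent, positive because l lies outside [-L, L]. *)
Lemma pole_trajectory : exists (M : R) (U : R -> R -> R),
  trajectory L T M 0 U /\
  forall x, x \in `[- L, L] ->
    (leb R).-integrable `]- L0, L0[
      (EFin \o (fun y => real_pole (u0 y) (v0 y) (u1 y) (v1 y) (a y) (b y) (x - l y))) /\
    U T x = \int[leb R]_(y in `]- L0, L0[)
      real_pole (u0 y) (v0 y) (u1 y) (v1 y) (a y) (b y) (x - l y).
Proof.
have [A [K [K0 TA AT mA]]] := heat_atoms L_gt0 LL' L'L0 T_gt0.
pose D1 : set R := `]- L0, L0[%classic; pose D2 : set R := `]0, +oo[%classic.
have mD1 : measurable D1 by exact: measurable_itv.
have mD2 : measurable D2 by exact: measurable_itv.
pose g (w : R * R) := G w.1 * (K / (1 + w.2 ^+ 2)).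
pose A' (w : R * R) t x := osc u0 v0 w * A 0 w.2 (l w.1) t x + osc u1 v1 w * A 1 w.2 (l w.1) t x.
have DP w : (D1 `*` D2) w -> (w.1 \in `]- L0, L0[) /\ (0 < w.2).
  by case: w => y s [/= h1 h2]; split => //; move: h2; rewrite /D2 /= in_itv/= andbT.
have G0 y : y \in `]- L0, L0[ -> 0 <= G y.
  by move=> /G_ge; apply: le_trans; rewrite !addr_ge0.
have Ks (s : R) : 0 <= K / (1 + s ^+ 2) by rewrite divr_ge0// addr_ge0// sqr_ge0.
have iK := oneDsqr_integrable K0.
pose nu := ((leb R) \x (leb R))%E.
have TA' w : (D1 `*` D2) w -> trajectory L T (g w) 0 (A' w).
  move=> /DP[yI s0].
  have t0 := trajectoryZ L_gt0 (osc u0 v0 w) (TA 0%N w.2 (l w.1) isT s0 (l_bd yI)).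
  have t1 := trajectoryZ L_gt0 (osc u1 v1 w) (TA 1%N w.2 (l w.1) isT s0 (l_bd yI)).
  apply: trajectory_weaken (trajectoryD L_gt0 t0 t1).
  rewrite -mulrDl; apply: ler_wpM2r => //; apply: le_trans (G_ge yI).
  by apply: lerD; exact: osc_bound.
have mA' : measurable_fun setT (fun p : (R * R) * (R * R) => A' p.1 p.2.1 p.2.2).
  have mo u v : measurable_fun setT u -> measurable_fun setT v ->
      measurable_fun setT (fun p : (R * R) * (R * R) => osc u v p.1).
    by move=> mu mv; exact: (measurableT_comp (mosc mu mv) measurable_fst).
  have mAp p : (p <= 1)%N -> measurable_fun setT
      (fun w : (R * R) * (R * R) => A p w.1.2 (l w.1.1) w.2.1 w.2.2).
    move=> /mA h; apply: (measurableT_comp h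
      (g := fun w : (R * R) * (R * R) => ((w.1.2, l w.1.1), w.2))).
    apply: measurable_fun_pair; last exact: measurable_snd.
    apply: measurable_fun_pair; first exact: (measurableT_comp measurable_snd measurable_fst).
    exact: (measurableT_comp ml (measurableT_comp measurable_fst measurable_fst)).
  exact: (measurable_funD (measurable_funM (mo _ _ mu0 mv0) (mAp 0%N isT))
    (measurable_funM (mo _ _ mu1 mv1) (mAp 1%N isT))).
have mg : measurable_fun (D1 `*` D2) g.
  have /integrableP[/measurable_EFinP mG _] := iG.
  apply: measurable_funM.
    rewrite (_ : (fun w : R * R => G w.1) = G \o fst)//.
    apply: measurable_comp mG _ => //; first by move=> _ [w [wD _] <-].
    exact: measurable_funTS measurable_fst.
  apply: measurable_funTS; apply: measurable_funM => //.
  apply: (measurableT_comp (@measurable_inv R)); apply: measurable_funD => //.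
  exact: (measurable_funX 2 measurable_snd).
have ig : nu.-integrable (D1 `*` D2) (EFin \o g).
  have [//|//] := @fubini_dominated _ _ _ _ R (leb R) (leb R) D1 D2 g G
    (fun s => K / (1 + s ^+ 2)) mD1 mD2 mg iG iK.
  by move=> y s yI _; rewrite /g /= ger0_norm// mulr_ge0// G0.
exists (\int[nu]_(w in D1 `*` D2) g w), (fun t x => \int[nu]_(w in D1 `*` D2) A' w t x).
split; first exact: (@trajectory_product_integral R L T L_gt0 _ _ _ _ (leb R) (leb R) D1 D2 g A' mD1 mD2 ig mA' TA').
move=> x xL.
pose f (w : R * R) := A' w T x.
have mf : measurable_fun (D1 `*` D2) f.
  apply: measurable_funTS; apply: (measurableT_comp mA' (g := fun w => (w, (T, x)))).
  exact: measurable_pair2.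
have TI : T \in `[0, T] by rewrite in_itv/= lexx andbT ltW.
have fb y s : D1 y -> D2 s -> `|f (y, s)| <= G y * (K / (1 + s ^+ 2)).
  move=> yD sD; have [[bd _ _] _] := TA' (y, s) (conj yD sD).
  by apply: bd; rewrite /in_rect TI.
have [if1 if2 if3 _] := @fubini_dominated _ _ _ _ R (leb R) (leb R) D1 D2 f G
  (fun s => K / (1 + s ^+ 2)) mD1 mD2 mf iG iK fb.
have inner y : D1 y -> \int[leb R]_(s in D2) f (y, s) =
    real_pole (u0 y) (v0 y) (u1 y) (v1 y) (a y) (b y) (x - l y).
  move=> yD; have /andP[l1 l2] := l_bd yD.
  have xi0 : x - l y != 0.
    apply/eqP => /subr0_eq xl; move: xL l1; rewrite in_itv/= -ler_norml xl; move: LL'.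
    by move=> h1 h2 h3; have := le_lt_trans (le_trans h3 h2) h1; rewrite ltxx.
  have a0 : 0 < (x - l y) ^+ 2 + a y.
    by rewrite ltr_pwDl ?a_ge0// exprn_even_gt0.
  have [_ h] := heat_osc_integral (b y) (u0 y + u1 y * (x - l y)) (v0 y + v1 y * (x - l y)) a0.
  rewrite /real_pole -h; apply: eq_Rintegral => s /set_mem sD.
  have [_ /= s0] := DP (y, s) (conj yD sD).
  have lb : L' <= `|l y| <= L0 by exact: l_bd.
  have A0 := AT 0%N s (l y) x isT s0 lb xL.
  have A1 := AT 1%N s (l y) x isT s0 lb xL.
  rewrite /f /A' /osc /= A0 A1 /heat_osc (heat_expE a0 s0) wt_hk0// expr0 expr1.
  (* The Gaussian of the atom and the damping of its weight combine into one exponential. *)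
  have -> : expR (- (((x - l y) ^+ 2 + a y) / 4 * s^-1)) =
      expR (- ((x - l y) ^+ 2 / (4 * s))) * expR (- (a y / 4 * s^-1)).
    by rewrite -expRD; congr expR; field; rewrite gt_eqF.
  by ring.
have EI : \int[nu]_(w in D1 `*` D2) f w = \int[leb R]_(y in D1)
    real_pole (u0 y) (v0 y) (u1 y) (v1 y) (a y) (b y) (x - l y).
  rewrite (@Rintegral_prod _ _ _ _ R (leb R) (leb R) _ _ _ mD1 mD2 if1 if2).
  by apply: eq_Rintegral => y /set_mem yD; exact: inner.
split; last exact: EI.
apply: eq_integrable if3 => //.
by move=> y /set_mem yD /=; rewrite inner.
Qed.

End pole.

(** * Decomposition of the kernel into poles *)

Lemma Rintegrable_add (R : realType) (D : set R) (f g : R -> R) : measurable D ->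
  (leb R).-integrable D (EFin \o f) -> (leb R).-integrable D (EFin \o g) ->
  (leb R).-integrable D (EFin \o (fun y => f y + g y)) /\
  \int[leb R]_(y in D) f y + \int[leb R]_(y in D) g y = \int[leb R]_(y in D) (f y + g y).
Proof.
move=> mD i1 i2; split; last by rewrite (RintegralD _ i1 i2).
by have := @integrableD _ _ _ (leb R) _ mD _ _ i1 i2.
Qed.

(** The real form of k (xi + c) / (xi^2 - c^2) = k / (xi - c) for k = k1 + i k2 and c = c1 + i c2,
    with the factor 4 of [real_pole]. *)
Lemma real_pole_split (R : realType) (k1 k2 c1 c2 xi : R) : c2 != 0 ->
  real_pole (k1 * c1 - k2 * c2) (k1 * c2 + k2 * c1) k1 k2 (c2 ^+ 2 - c1 ^+ 2) (- 2 * c1 * c2) xi =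
  4 * (k1 * (xi - c1) - k2 * c2) / ((xi - c1) ^+ 2 + c2 ^+ 2).
Proof.
move=> c20; rewrite /real_pole.
have n1 : (xi - c1) ^+ 2 + c2 ^+ 2 != 0.
  by rewrite gt_eqF// ltr_wpDl ?sqr_ge0// exprn_even_gt0.
have n2 : (xi + c1) ^+ 2 + c2 ^+ 2 != 0.
  by rewrite gt_eqF// ltr_wpDl ?sqr_ge0// exprn_even_gt0.
have -> : (xi ^+ 2 + (c2 ^+ 2 - c1 ^+ 2)) ^+ 2 + (- 2 * c1 * c2) ^+ 2 =
  ((xi - c1) ^+ 2 + c2 ^+ 2) * ((xi + c1) ^+ 2 + c2 ^+ 2) by ring.
by field; rewrite n1 n2.
Qed.

(** Partial fractions of (u + i v) / (X^2 + sigma^2) with sigma = p + i q: the poles are + i sigma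
    and - i sigma, with opposite residues, and k1 + i k2 = (u + i v) / (2 i sigma). *)
Lemma two_poles (R : realType) (X p q u v : R) : 0 < p ->
  let n := p ^+ 2 + q ^+ 2 in
  let k1 := (v * p - u * q) / (2 * n) in
  let k2 := - (u * p + v * q) / (2 * n) in
  (k1 * (X + q) - k2 * p) / ((X + q) ^+ 2 + p ^+ 2) -
  (k1 * (X - q) + k2 * p) / ((X - q) ^+ 2 + p ^+ 2) =
  (u * (X ^+ 2 + (p ^+ 2 - q ^+ 2)) + v * (2 * p * q)) /
    ((X ^+ 2 + (p ^+ 2 - q ^+ 2)) ^+ 2 + (2 * p * q) ^+ 2).
Proof.
move=> p0 n k1 k2.
have pn y : y ^+ 2 + p ^+ 2 != 0.
  by rewrite gt_eqF// ltr_wpDl ?sqr_ge0// exprn_gt0.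
have n0 : p ^+ 2 + q ^+ 2 != 0 by rewrite addrC.
have -> : (X ^+ 2 + (p ^+ 2 - q ^+ 2)) ^+ 2 + (2 * p * q) ^+ 2 =
  ((X + q) ^+ 2 + p ^+ 2) * ((X - q) ^+ 2 + p ^+ 2) by ring.
by rewrite /k1 /k2 /n; field; rewrite n0 !pn.
Qed.

(** Here p + i q is the principal square root of S + i c, from p^2 = (|S + i c| + S) / 2. The bound
    p >= sqrt S keeps the poles off the real axis. *)
Lemma two_poles_sqrt (R : realType) (S c : R) : 0 < S ->
  let p := Num.sqrt ((Num.sqrt (S ^+ 2 + c ^+ 2) + S) / 2) in
  let q := c / (2 * p) in
  [/\ Num.sqrt S <= p, p <= Num.sqrt (S + `|c|), `|q| <= Num.sqrt (S + `|c|),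
      p ^+ 2 - q ^+ 2 = S & 2 * p * q = c].
Proof.
move=> S0 p q.
have N0 : 0 <= S ^+ 2 + c ^+ 2 by rewrite addr_ge0 ?sqr_ge0.
pose m := Num.sqrt (S ^+ 2 + c ^+ 2).
have m2 : m ^+ 2 = S ^+ 2 + c ^+ 2 by rewrite sqr_sqrtr.
have sqr_le (x y : R) : 0 <= y -> x ^+ 2 <= y ^+ 2 -> x <= y.
  by move=> y0; apply: contraTT; rewrite -!ltNge => yx; rewrite ltrXn2r ?(le_lt_trans y0 yx).
have m0 : 0 <= m by exact: sqrtr_ge0.
have Sm : S <= m.
  by apply: sqr_le => //; rewrite m2 lerDl sqr_ge0.
have mc : m <= S + `|c|.
  have c0 := normr_ge0 c.
  apply: sqr_le; first by rewrite addr_ge0// ltW.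
  rewrite m2 -[c ^+ 2]real_normK ?num_real//.
  have := mulr_ge0 (ltW S0) c0; move: (`|c|) => c'; lra.
have p2 : p ^+ 2 = (m + S) / 2 by rewrite sqr_sqrtr// divr_ge0// addr_ge0// ltW.
have pS : Num.sqrt S <= p by apply: ler_wsqrtr; rewrite ler_pdivlMr//; move: Sm; rewrite -/m; lra.
have p0 : 0 < p by apply: lt_le_trans pS; rewrite sqrtr_gt0.
have q2 : q ^+ 2 = (m - S) / 2.
  have -> : q ^+ 2 = c ^+ 2 / (4 * p ^+ 2) by rewrite /q; field; rewrite gt_eqF.
  have -> : c ^+ 2 = (m - S) * (m + S) by rewrite -[c ^+ 2](addKr (S ^+ 2)) -m2; ring.
  by rewrite p2; field; rewrite gt_eqF// ltr_wpDl.
split => //.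
- by apply: ler_wsqrtr; rewrite ler_pdivrMr// -/m; move: (normr_ge0 c) mc S0; lra.
- rewrite -sqrtr_sqr; apply: ler_wsqrtr; rewrite q2 ler_pdivrMr//.
  by move: (normr_ge0 c) mc S0; lra.
- by rewrite p2 q2; lra.
- by rewrite /q; field; rewrite gt_eqF.
Qed.

(* The real part of (u y + i v y) / ((x - y)^2 + L0^2 - y^2 + i al y); replacing
   (u, v) by (v, - u) gives the imaginary part. *)
Definition real_kernel (R : realType) (L0 : R) (u v al : R -> R) (x y : R) : R :=
  (u y * ((x - y) ^+ 2 + (L0 ^+ 2 - y ^+ 2)) + v y * al y) /
  (((x - y) ^+ 2 + (L0 ^+ 2 - y ^+ 2)) ^+ 2 + al y ^+ 2).

Section kernel.
Context {R : realType}.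
Variables (L L' L0 T B : R).
Hypotheses (L_gt0 : 0 < L) (LL' : L < L') (L'L0 : L' < L0) (T_gt0 : 0 < T).
Variables (u v al : R -> R).
Hypotheses (mu : measurable_fun setT u) (mv : measurable_fun setT v)
  (mal : measurable_fun setT al).
Hypothesis al_le : forall y, `|al y| <= B.
Hypothesis iuv : (leb R).-integrable `]- L0, L0[ (EFin \o (fun y => `|u y| + `|v y|)).

Let S (y : R) := L0 ^+ 2 - y ^+ 2.
Let p (y : R) := Num.sqrt ((Num.sqrt (S y ^+ 2 + al y ^+ 2) + S y) / 2).
Let q (y : R) := al y / (2 * p y).
Let n (y : R) := p y ^+ 2 + q y ^+ 2.
Let k1 (y : R) := (v y * p y - u y * q y) / (2 * n y).
Let k2 (y : R) := - (u y * p y + v y * q y) / (2 * n y).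
Let cut (f : R -> R) (y : R) := if `|y| < L' then f y else 0.
(** For |y| < L', [p0] is a lower bound of [p], and [B1] an upper bound of [p] and |q|. *)
Let p0 := Num.sqrt (L0 ^+ 2 - L' ^+ 2).
Let B1 := Num.sqrt (L0 ^+ 2 + B).

Let L'_gt0 : 0 < L'. Proof. exact: lt_trans LL'. Qed.
Let L0_gt0 : 0 < L0. Proof. exact: lt_trans L'L0. Qed.

Let S_ge y : `|y| < L' -> L0 ^+ 2 - L' ^+ 2 <= S y.
Proof.
move=> yL; rewrite /S lerB// -[y ^+ 2]real_normK ?num_real//.
by apply: lerXn2r; rewrite ?nnegrE// ltW.
Qed.

Let S0 : 0 < L0 ^+ 2 - L' ^+ 2.
Proof. by rewrite subr_gt0; apply: ltrXn2r; rewrite ?(ltW L'_gt0). Qed.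

Let p0_gt0 : 0 < p0. Proof. by rewrite sqrtr_gt0. Qed.

Let pq y : `|y| < L' ->
  [/\ p0 <= p y, p y <= B1, `|q y| <= B1, p y ^+ 2 - q y ^+ 2 = S y & 2 * p y * q y = al y].
Proof.
move=> yL; have Sy := S_ge yL.
have [h1 h2 h3 h4 h5] := two_poles_sqrt (al y) (lt_le_trans S0 Sy).
have b : Num.sqrt (S y + `|al y|) <= B1.
  apply: ler_wsqrtr; apply: lerD; last exact: al_le.
  by rewrite /S gerBl sqr_ge0.
split => //; [|exact: le_trans h2 b|exact: le_trans h3 b].
by apply: le_trans h1; exact: ler_wsqrtr.
Qed.

(** Both p / (2 n) and |q| / (2 n) are at most 1 / p, since p |q| <= p^2 + q^2. The cut at L' < L0
    keeps 1 / p below 1 / p0. *)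
Let k_le y : `|y| < L' -> `|k1 y| <= (`|u y| + `|v y|) / p0 /\ `|k2 y| <= (`|u y| + `|v y|) / p0.
Proof.
move=> /pq[h1 h2 h3 _ _]; have pp : 0 < p y by exact: lt_le_trans h1.
have n0 : 0 < 2 * n y by rewrite mulr_gt0// ltr_wpDr ?sqr_ge0// exprn_gt0.
have e1 : p y / (2 * n y) <= p0^-1.
  apply: (@le_trans _ _ (p y)^-1); last by rewrite lef_pV2 ?posrE.
  rewrite ler_pdivrMr// mulrC ler_pdivlMr// /n.
  by have := sqr_ge0 (p y); have := sqr_ge0 (q y); rewrite expr2; lra.
have e2 : `|q y| / (2 * n y) <= p0^-1.
  apply: (@le_trans _ _ (p y)^-1); last by rewrite lef_pV2 ?posrE.
  rewrite ler_pdivrMr// mulrC ler_pdivlMr// /n -[q y ^+ 2]real_normK ?num_real//.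
  by have := sqr_ge0 (p y - `|q y|); have := sqr_ge0 (p y + `|q y|); lra.
have ni : `|(2 * n y)^-1| = (2 * n y)^-1 by rewrite ger0_norm// invr_ge0 ltW.
have e1' : `|p y / (2 * n y)| <= p0^-1 by rewrite normrM ni ger0_norm// ltW.
have e2' : `|q y / (2 * n y)| <= p0^-1 by rewrite normrM ni.
split.
  have -> : k1 y = v y * (p y / (2 * n y)) - u y * (q y / (2 * n y)) by rewrite /k1; ring.
  by rewrite [`|u y| + _]addrC [leRHS]mulrDl; apply: norm_leB; exact: norm_leM.
have -> : k2 y = - (u y * (p y / (2 * n y)) + v y * (q y / (2 * n y))) by rewrite /k2; ring.
by rewrite normrN [leRHS]mulrDl; apply: norm_leD; exact: norm_leM.
Qed.

Let msqrt (f : R -> R) : measurable_fun setT f -> measurable_fun setT (fun y => Num.sqrt (f y)).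
Proof.
by move=> mf; apply: (measurableT_comp _ mf); apply: continuous_measurable_fun; exact: sqrt_continuous.
Qed.

Let minv (f : R -> R) : measurable_fun setT f -> measurable_fun setT (fun y => (f y)^-1).
Proof. by move=> mf; exact: (measurableT_comp (@measurable_inv R) mf). Qed.

Let mc (c : R) : measurable_fun setT (fun _ : R => c). Proof. exact: measurable_cst. Qed.
Let mid : measurable_fun setT (fun y : R => y). Proof. exact: measurable_id. Qed.
Let mS : measurable_fun setT S.
Proof. exact: (measurable_funB (mc _) (measurable_funX 2 mid)). Qed.
Let mp : measurable_fun setT p.
Proof.
exact: (msqrt (measurable_funM (measurable_funD (msqrt (measurable_funD
  (measurable_funX 2 mS) (measurable_funX 2 mal))) mS) (mc _))).
Qed.
Let mq : measurable_fun setT q.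
Proof. exact: (measurable_funM mal (minv (measurable_funM (mc _) mp))). Qed.
Let m2n : measurable_fun setT (fun y => (2 * n y)^-1).
Proof.
exact: (minv (measurable_funM (mc _) (measurable_funD (measurable_funX 2 mp) (measurable_funX 2 mq)))).
Qed.
Let mk1 : measurable_fun setT k1.
Proof. exact: (measurable_funM (measurable_funB (measurable_funM mv mp) (measurable_funM mu mq)) m2n). Qed.
Let mk2 : measurable_fun setT k2.
Proof.
exact: (measurable_funM (measurable_funN (measurable_funD (measurable_funM mu mp) (measurable_funM mv mq))) m2n).
Qed.
Let mcut f : measurable_fun setT f -> measurable_fun setT (cut f).
Proof.
move=> mf; apply: measurable_fun_ifT => //.
by apply: measurable_fun_ltr => //; exact: measurableT_comp.
Qed.

(** The sign [e] selects one of the two poles z = y - e q + i e p, together with the sign of its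
    residue. *)
Let inner_pole (e : R) : e ^+ 2 = 1 -> exists (M : R) (U : R -> R -> R),
  trajectory L T M 0 U /\
  forall x, x \in `[- L, L] ->
    let r y := cut (fun y => e * (k1 y * (x - y + e * q y) - k2 y * (e * p y)) /
                    ((x - y + e * q y) ^+ 2 + p y ^+ 2)) y in
    (leb R).-integrable `]- L0, L0[ (EFin \o r) /\ U T x = \int[leb R]_(y in `]- L0, L0[) r y.
Proof.
move=> e2.
have e1 : `|e| <= 1.
  by rewrite -(@ler_pXn2r _ 2) ?nnegrE// real_normK ?num_real// e2 expr1n.
(* The centre is the end of [-L0, L0] on the side of Re z = [zr]; c1 + i c2 is z - l. *)
pose zr y := y - e * q y; pose l y := if 0 <= zr y then L0 else - L0.
pose c1 y := zr y - l y; pose c2 y := e * p y.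
(* The division by 4 compensates the factor 4 of [real_pole]. *)
pose j1 y := e * k1 y / 4; pose j2 y := e * k2 y / 4.
pose U0 := cut (fun y => j1 y * c1 y - j2 y * c2 y).
pose V0 := cut (fun y => j1 y * c2 y + j2 y * c1 y).
pose a := cut (fun y => c2 y ^+ 2 - c1 y ^+ 2); pose b := cut (fun y => - 2 * c1 y * c2 y).
have mzr : measurable_fun setT zr by exact: (measurable_funB mid (measurable_funM (mc _) mq)).
have ml : measurable_fun setT l by apply: measurable_fun_ifT => //; exact: measurable_fun_ler.
have mc1 : measurable_fun setT c1 by exact: measurable_funB.
have mc2 : measurable_fun setT c2 by exact: (measurable_funM (mc _) mp).
have mj1 : measurable_fun setT j1 by exact: (measurable_funM (measurable_funM (mc _) mk1) (mc _)).
have mj2 : measurable_fun setT j2 by exact: (measurable_funM (measurable_funM (mc _) mk2) (mc _)).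
have mU0 : measurable_fun setT U0.
  by apply: mcut; exact: (measurable_funB (measurable_funM mj1 mc1) (measurable_funM mj2 mc2)).
have mV0 : measurable_fun setT V0.
  by apply: mcut; exact: (measurable_funD (measurable_funM mj1 mc2) (measurable_funM mj2 mc1)).
have ma : measurable_fun setT a.
  by apply: mcut; exact: (measurable_funB (measurable_funX 2 mc2) (measurable_funX 2 mc1)).
have mb : measurable_fun setT b.
  by apply: mcut; exact: (measurable_funM (measurable_funM (mc _) mc1) mc2).
have lL0 y : `|l y| = L0 by rewrite /l; case: ifP; rewrite ?normrN gtr0_norm.
(* [C1] bounds |c1| <= |y| + |q| + |l|. The two numerators of degree 0 each contribute C1 + B1 to
   the last factor of [G], those of degree 1 contribute 1 each. *)
pose C1 := L0 + B1 + L0; pose G y := (`|u y| + `|v y|) * (p0^-1 * (2 * (C1 + B1) + 2)).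
have B10 : 0 <= B1 by exact: sqrtr_ge0.
have iG : (leb R).-integrable `]- L0, L0[ (EFin \o G).
  have := @integrableZr _ _ R (leb R) _ (measurable_itv _) (p0^-1 * (2 * (C1 + B1) + 2)) _ iuv.
  exact.
have Gle y : y \in `]- L0, L0[ ->
    `|U0 y| + `|V0 y| + (`|cut j1 y| + `|cut j2 y|) <= G y.
  rewrite in_itv/= -ltr_norml => yL0.
  have uv0 : 0 <= (`|u y| + `|v y|) / p0 by rewrite divr_ge0 ?addr_ge0// ltW.
  have GE : G y = (`|u y| + `|v y|) / p0 * (2 * (C1 + B1) + 2) by rewrite /G mulrA.
  rewrite GE /U0 /V0 /cut; case: ifPn => yL'; last first.
    by rewrite normr0 !addr0; apply: mulr_ge0 => //; rewrite /C1; move: B10 L0_gt0; lra.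
  have [h1 h2 h3 _ _] := pq yL'; have [K1 K2] := k_le yL'.
  have q4 : `|4^-1 : R| <= 1 by rewrite ger0_norm// invf_le1// ler1n.
  have b1 : `|j1 y| <= (`|u y| + `|v y|) / p0.
    by rewrite -[leRHS]mulr1; apply: norm_leM => //; rewrite -[leRHS]mul1r; exact: norm_leM.
  have b2 : `|j2 y| <= (`|u y| + `|v y|) / p0.
    by rewrite -[leRHS]mulr1; apply: norm_leM => //; rewrite -[leRHS]mul1r; exact: norm_leM.
  have b4 : `|c2 y| <= B1.
    by rewrite -[leRHS]mul1r; apply: norm_leM => //; rewrite ger0_norm ?sqrtr_ge0.
  have b3 : `|c1 y| <= C1.
    apply: norm_leB; last by rewrite lL0.
    apply: norm_leB; first exact: ltW.
    by rewrite -[leRHS]mul1r; exact: norm_leM.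
  move: b1 b2 uv0; move: (_ / p0) => E b1 b2 E0.
  apply: (le_trans (lerD (lerD (norm_leB (norm_leM b1 b3) (norm_leM b2 b4))
    (norm_leD (norm_leM b1 b4) (norm_leM b2 b3))) (lerD b1 b2))).
  by rewrite le_eqVlt; apply/orP; left; apply/eqP; ring.
have a_ge0 y : y \in `]- L0, L0[ -> 0 <= a y.
  rewrite in_itv/= -ltr_norml => yL0; rewrite /a /cut; case: ifPn => // yL'.
  have [h1 h2 h3 h4 _] := pq yL'.
  (* The choice |l| = L0 matters: in p^2 - (zr - l)^2 the relation p^2 - q^2 = L0^2 - y^2 cancels
     all squares and leaves a product with [zr], whose sign agrees with that of l - y. *)
  have E : c2 y ^+ 2 - c1 y ^+ 2 = 2 * (l y * zr y - y * zr y).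
    have l2 : l y ^+ 2 = L0 ^+ 2 by rewrite -[LHS]real_normK ?num_real// lL0.
    have p2 : p y ^+ 2 = q y ^+ 2 + L0 ^+ 2 - y ^+ 2 by rewrite -addrA -[_ - y ^+ 2]h4; ring.
    by rewrite /c2 /c1 exprMn sqrrB l2 p2 /zr e2; ring: e2.
  rewrite E mulr_ge0// subr_ge0; move: yL0; rewrite ltr_norml /l => /andP[y1 y2].
  case: ifPn => z0; first by apply: ler_wpM2r => //; exact: ltW.
  by apply: ler_wnM2r; [apply: ltW; rewrite ltNge|exact: ltW].
have l_bd y : y \in `]- L0, L0[ -> L' <= `|l y| <= L0 by rewrite lL0 lexx andbT => _; exact: ltW.
have [M [U [TU HU]]] := pole_trajectory L_gt0 LL' (ltW L'L0) T_gt0 mU0 mV0 (mcut mj1) (mcut mj2)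
  ma mb ml iG Gle a_ge0 l_bd.
exists M, U; split => // x xL /=.
have E : (fun y => real_pole (U0 y) (V0 y) (cut j1 y) (cut j2 y) (a y) (b y) (x - l y)) =
  cut (fun y => e * (k1 y * (x - y + e * q y) - k2 y * (e * p y)) / ((x - y + e * q y) ^+ 2 + p y ^+ 2)).
  apply/funext => y; rewrite /U0 /V0 /a /b /cut; case: ifPn => yL'; last first.
    by rewrite /real_pole !(mul0r, mulr0, addr0).
  have [h1 _ _ _ _] := pq yL'; have pp : 0 < p y by exact: lt_le_trans h1.
  have e0 : e != 0 by apply/eqP => e0; move: e2; rewrite e0 expr0n/= => /eqP; rewrite eq_sym oner_eq0.
  rewrite real_pole_split; last by rewrite mulf_neq0// gt_eqF.
  have -> : x - l y - c1 y = x - y + e * q y by rewrite /c1 /zr; ring.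
  have -> : c2 y ^+ 2 = p y ^+ 2 by rewrite /c2 exprMn e2 mul1r.
  by rewrite /c2 /j1 /j2; congr (_ / _); field.
by have := HU x xL; rewrite E.
Qed.

Lemma kernel_trajectory : exists (M : R) (U : R -> R -> R),
  trajectory L T M 0 U /\
  forall x, x \in `[- L, L] ->
    (leb R).-integrable `]- L0, L0[ (EFin \o real_kernel L0 u v al x) /\
    U T x = \int[leb R]_(y in `]- L0, L0[) real_kernel L0 u v al x y.
Proof.
pose out (f : R -> R) y := if `|y| < L' then 0 else f y.
have mout f : measurable_fun setT f -> measurable_fun setT (out f).
  move=> mf; apply: measurable_fun_ifT => //.
  by apply: measurable_fun_ltr => //; exact: measurableT_comp.
(* For |y| < L' the outer weights are zero, and [L0] is just an admissible centre. *)
pose l := fun y : R => if `|y| < L' then L0 else y.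
have ml : measurable_fun setT l.
  apply: measurable_fun_ifT => //.
  by apply: measurable_fun_ltr => //; exact: measurableT_comp.
have m0 := mc 0.
have q4 : `|4^-1 : R| <= 1 by rewrite ger0_norm// invf_le1// ler1n.
have le4 (w : R) : `|w / 4| <= `|w| by rewrite -[leRHS]mulr1; exact: norm_leM.
have Gle y : y \in `]- L0, L0[ ->
    `|out (fun y => u y / 4) y| + `|out (fun y => v y / 4) y| + (`|0 : R| + `|0 : R|) <= `|u y| + `|v y|.
  move=> _; rewrite !normr0 !addr0 /out; case: ifP => _; first by rewrite normr0 addr0 addr_ge0.
  by apply: lerD.
have a_ge0 y : y \in `]- L0, L0[ -> 0 <= S y.
  rewrite in_itv/= -ltr_norml => yL0; rewrite /S subr_ge0 -[y ^+ 2]real_normK ?num_real//.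
  by apply: lerXn2r; rewrite ?nnegrE// ltW.
have l_bd y : y \in `]- L0, L0[ -> L' <= `|l y| <= L0.
  rewrite in_itv/= -ltr_norml => yL0; rewrite /l; case: ifPn => yL'.
    by rewrite gtr0_norm// lexx andbT ltW.
  by rewrite leNgt yL' /= ltW.
have [M1 [U1 [TU1 HU1]]] := pole_trajectory L_gt0 LL' (ltW L'L0) T_gt0
  (mout _ (measurable_funM mu (mc 4^-1))) (mout _ (measurable_funM mv (mc 4^-1))) m0 m0
  mS mal ml iuv Gle a_ge0 l_bd.
have [M2 [U2 [TU2 HU2]]] := inner_pole (expr1n R 2).
have N12 : (- 1) ^+ 2 = 1 :> R by rewrite sqrrN expr1n.
have [M3 [U3 [TU3 HU3]]] := inner_pole N12.
exists (M1 + (M2 + M3)), (fun t x => U1 t x + (U2 t x + U3 t x)).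
split; first exact: (trajectoryD L_gt0 TU1 (trajectoryD L_gt0 TU2 TU3)).
move=> x xL.
pose f1 y := real_pole (out (fun y => u y / 4) y) (out (fun y => v y / 4) y) 0 0 (S y) (al y) (x - l y).
pose f e := cut (fun y => e * (k1 y * (x - y + e * q y) - k2 y * (e * p y)) /
                    ((x - y + e * q y) ^+ 2 + p y ^+ 2)).
have [i1 ->] : (leb R).-integrable `]- L0, L0[ (EFin \o f1) /\
    U1 T x = \int[leb R]_(y in `]- L0, L0[) f1 y := HU1 x xL.
have [i2 ->] : (leb R).-integrable `]- L0, L0[ (EFin \o f 1) /\
    U2 T x = \int[leb R]_(y in `]- L0, L0[) f 1 y := HU2 x xL.
have [i3 ->] : (leb R).-integrable `]- L0, L0[ (EFin \o f (- 1)) /\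
    U3 T x = \int[leb R]_(y in `]- L0, L0[) f (- 1) y := HU3 x xL.
have [i23 ->] := Rintegrable_add (measurable_itv _) i2 i3.
have [i123 ->] := Rintegrable_add (measurable_itv _) i1 i23.
suff <- : (fun y => f1 y + (f 1 y + f (- 1) y)) = real_kernel L0 u v al x by [].
apply/funext => y; rewrite /f1 /f /out /l /cut /=; case: ifPn => yL'; last first.
  by rewrite !addr0 /real_pole /real_kernel -/(S y); congr (_ / _); field.
have [h1 _ _ h4 h5] := pq yL'; have pp : 0 < p y by exact: lt_le_trans h1.
have -> : real_pole 0 0 0 0 (S y) (al y) (x - L0) = 0.
  by rewrite /real_pole !(mul0r, mulr0, addr0).
rewrite add0r /real_kernel -/(S y) -h4 -h5 -(two_poles (x - y) (q y) (u y) (v y) pp) -/(n y) -/(k1 y) -/(k2 y).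
by rewrite !mul1r !mulN1r mulNr !mulrN opprK.
Qed.

End kernel.

(** * From real solutions to reachable states *)

Lemma Rintegrable_scale (R : realType) (D : set R) (c : R) (f : R -> R) : measurable D ->
  (leb R).-integrable D (EFin \o f) ->
  (leb R).-integrable D (EFin \o (fun y => c * f y)) /\
  \int[leb R]_(y in D) (c * f y) = c * \int[leb R]_(y in D) f y.
Proof.
move=> mD i; split; last by rewrite (RintegralZl _ _ i).
by have := @integrableZl _ _ R (leb R) _ mD c _ i.
Qed.

(** The quadratic polynomial k^2 N - 2 k v + l is nonnegative, so its discriminant is not positive.
    This is how Cauchy-Schwarz is obtained below; for N = 0 the value k = (l + 1) / v excludes v
    different from 0. *)
Lemma discriminant_le (R : realType) (v N l : R) : 0 <= N -> 0 <= l ->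
  (forall k, 2 * k * v <= k ^+ 2 * N + l) -> v ^+ 2 <= l * N.
Proof.
move=> N0 l0 H; have [->|v0] := eqVneq v 0; first by rewrite expr0n/= mulr_ge0.
move: N0; rewrite le_eqVlt => /predU1P[E|N0].
  have := H ((l + 1) / v); rewrite -E mulr0 add0r.
  have -> : 2 * ((l + 1) / v) * v = 2 * (l + 1) by field.
  by move: l0; lra.
have := H (v / N).
have -> : 2 * (v / N) * v = 2 * (v ^+ 2 / N) by ring.
have -> : (v / N) ^+ 2 * N = v ^+ 2 / N by field; rewrite gt_eqF.
by rewrite -ler_pdivrMr//; lra.
Qed.

Section L2_primitive.
Context {R : realType}.
Variables (L : R) (f S : R -> R).
Hypothesis L_gt0 : 0 < L.
Hypothesis mf : measurable_fun `]- L, L[ f.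
Hypothesis iS : (leb R).-integrable `]- L, L[ (EFin \o S).
Hypothesis fS : forall x, x \in `]- L, L[ -> f x ^+ 2 <= S x.

Let D : set R := `]- L, L[%classic.
Let mD : measurable D. Proof. exact: measurable_itv. Qed.

Let i1S (k c : R) : (leb R).-integrable D (EFin \o (fun x => k * S x + c)) /\
  \int[leb R]_(x in D) (k * S x + c) = k * (\int[leb R]_(x in D) S x) + c * (2 * L).
Proof.
have ic : (leb R).-integrable D (EFin \o (fun _ : R => c)).
  by apply: (@bounded_integrable_oo _ _ _ `|c|).
have [ik <-] := Rintegrable_scale k mD iS.
have [ikc <-] := Rintegrable_add mD ik ic; split => //; congr (_ + _).
by rewrite Rintegral_cst//= lebesgue_measure_itv/= lte_fin gtrN// opprK -mulr2n mulr_natl.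
Qed.

Lemma L2_integrable : (leb R).-integrable `]- L, L[ (EFin \o f).
Proof.
have [+ _] := i1S 1 1; apply: le_integrable => //; first exact/measurable_EFinP.
move=> x xD /=; rewrite lee_fin mul1r; have := fS xD.
have h := sqr_ge0 (`|f x| - 1); have h2 : f x ^+ 2 = `|f x| ^+ 2 by rewrite real_normK ?num_real.
rewrite h2 => h3; apply: le_trans (ler_norm _).
by move: h h3; move: (`|f x|) => a; nra.
Qed.

Let g (x s : R) : R := if s < x then f s else 0.

Let g_le x s : D s -> `|g x s| <= `|f s|.
Proof. by move=> _; rewrite /g; case: ifP; rewrite ?normr0. Qed.

Let mg : measurable_fun (D `*` D) (fun u : R * R => g u.1 u.2).
Proof.
apply: measurable_fun_if => //.
- exact: measurableX.
- by apply: measurable_fun_ltr; apply: measurable_funTS; [exact: measurable_snd|exact: measurable_fst].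
- rewrite (_ : (fun u : R * R => f u.2) = f \o snd)//.
  apply: (measurable_comp mD) mf _ => //; first by move=> _ [u [[_ u2] _] <-].
  exact: measurable_funTS measurable_snd.
Qed.

Let primitiveE x : x \in `[- L, L] -> \int[leb R]_(s in `]- L, x[) f s = \int[leb R]_(s in D) g x s.
Proof.
rewrite in_itv/= => /andP[_ xL].
rewrite [LHS]Rintegral_mkcond [RHS]Rintegral_mkcond; apply: eq_Rintegral => s _.
rewrite !patchE /g; have -> : (s \in `]- L, x[%classic) = (s \in D) && (s < x).
  rewrite !mem_setE /D !in_itv/=; case: (- L < s) => //=.
  by apply/idP/andP => [sx|[]//]; split => //; exact: lt_le_trans sx xL.
by case: (s \in D).
Qed.

Let fub := @fubini_dominated _ _ _ _ R (leb R) (leb R) D D (fun u => g u.1 u.2) (cst 1) (fun s => `|f s|).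

(** The primitive is the integral over a fixed domain of the truncated integrand [g], so that its
    measurability is part of Fubini's theorem. *)
Lemma L2_primitive_measurable : measurable_fun `]- L, L[ (fun x => \int[leb R]_(s in `]- L, x[) f s).
Proof.
have [|||_ _ i _] := fub mD mD mg.
- by apply: (@bounded_integrable_oo _ _ _ `|1|).
- by have := @integrable_norm _ _ _ (leb R) _ _ L2_integrable.
- by move=> x s xD sD; rewrite mul1r; exact: g_le.
have /integrableP[/measurable_EFinP m _] := i.
apply: eq_measurable_fun m => x /set_mem xD.
by rewrite primitiveE//; exact: mem_itv_oo_cc.
Qed.

(** Integrating 2 k g <= k^2 S + 1 for every k gives the hypothesis of [discriminant_le]; 2 L is the
    length of the interval. *)
Lemma L2_primitive_bound x : x \in `[- L, L] ->
  (\int[leb R]_(s in `]- L, x[) f s) ^+ 2 <= 2 * L * \int[leb R]_(s in `]- L, L[) S s.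
Proof.
move=> xL; rewrite primitiveE//.
have mgx : measurable_fun D (g x).
  by apply: measurable_fun_if => //; [exact: measurable_fun_ltr|apply: measurable_funS mf => // s []].
have ig : (leb R).-integrable D (EFin \o g x).
  apply: le_integrable L2_integrable => //; first exact/measurable_EFinP.
  by move=> s sD /=; rewrite lee_fin; exact: g_le.
apply: discriminant_le.
- by apply: Rintegral_ge0 => s sD; apply: le_trans (fS sD); exact: sqr_ge0.
- by rewrite mulr_ge0// ltW.
move=> k; have [i1 <-] := Rintegrable_scale (2 * k) mD ig.
have [i2 e2] := i1S (k ^+ 2) 1; rewrite mul1r in e2; rewrite -e2.
apply: le_Rintegral => // s sD.
have := fS sD; rewrite /g; case: ifP => _ h.
  by have := sqr_ge0 (k * f s - 1); have := ler_wpM2l (sqr_ge0 k) h; nra.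
by rewrite mulr0 addr_ge0// mulr_ge0 ?sqr_ge0//; apply: le_trans h; exact: sqr_ge0.
Qed.

End L2_primitive.

Local Open Scope complex_scope.

Lemma cReM (R : realType) (x y : R[i]) :
  complex.Re (x * y) = complex.Re x * complex.Re y - complex.Im x * complex.Im y.
Proof. by case: x => a b; case: y. Qed.

Lemma cImM (R : realType) (x y : R[i]) :
  complex.Im (x * y) = complex.Re x * complex.Im y + complex.Im x * complex.Re y.
Proof. by case: x => a b; case: y. Qed.

Lemma cReD (R : realType) (x y : R[i]) : complex.Re (x + y) = complex.Re x + complex.Re y.
Proof. by case: x => a b; case: y. Qed.

Lemma cImD (R : realType) (x y : R[i]) : complex.Im (x + y) = complex.Im x + complex.Im y.
Proof. by case: x => a b; case: y. Qed.

Lemma complex_ext (R : realType) (x y : R[i]) :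
  complex.Re x = complex.Re y -> complex.Im x = complex.Im y -> x = y.
Proof. by case: x => a b; case: y => c d /= -> ->. Qed.

Lemma cintegral_linear (R : realType) (D : set R) (a : R[i]) (f g : R -> R[i]) : measurable D ->
  cintegrable (leb R) D f -> cintegrable (leb R) D g ->
  cintegrable (leb R) D (fun x => a * f x + g x) /\
  cintegral (leb R) D (fun x => a * f x + g x) = a * cintegral (leb R) D f + cintegral (leb R) D g.
Proof.
move=> mD [f1 f2] [g1 g2].
have [r1 e1] := Rintegrable_scale (complex.Re a) mD f1.
have [r2 e2] := Rintegrable_scale (- complex.Im a) mD f2.
have [r3 e3] := Rintegrable_scale (complex.Re a) mD f2.
have [r4 e4] := Rintegrable_scale (complex.Im a) mD f1.
have [s1 d1] := Rintegrable_add mD r1 r2; have [s2 d2] := Rintegrable_add mD r3 r4.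
have [t1 c1] := Rintegrable_add mD s1 g1; have [t2 c2] := Rintegrable_add mD s2 g2.
have E1 x : complex.Re (a * f x + g x) = complex.Re a * complex.Re (f x) + - complex.Im a * complex.Im (f x) + complex.Re (g x).
  by rewrite cReD cReM mulNr.
have E2 x : complex.Im (a * f x + g x) = complex.Re a * complex.Im (f x) + complex.Im a * complex.Re (f x) + complex.Im (g x).
  by rewrite cImD cImM.
split.
  by split; [under [X in integrable _ _ X]eq_fun do rewrite E1|under [X in integrable _ _ X]eq_fun do rewrite E2].
apply: complex_ext.
  rewrite [RHS]cReD cReM /cintegral /=; under [LHS]eq_Rintegral do rewrite E1.
  by rewrite -c1 -d1 e1 e2 mulNr.
rewrite [RHS]cImD cImM /cintegral /=; under [LHS]eq_Rintegral do rewrite E2.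
by rewrite -c2 -d2 e3 e4.
Qed.

Lemma sqrt_sqmod_le (R : realType) (z : R[i]) :
  Num.sqrt (sqmod z) <= `|complex.Re z| + `|complex.Im z|.
Proof.
have s0 : 0 <= `|complex.Re z| + `|complex.Im z| by rewrite addr_ge0.
rewrite -[leRHS]ger0_norm// -sqrtr_sqr; apply: ler_wsqrtr.
have h := mulr_ge0 (normr_ge0 (complex.Re z)) (normr_ge0 (complex.Im z)).
rewrite /sqmod -[complex.Re z ^+ 2]real_normK ?num_real// -[complex.Im z ^+ 2]real_normK ?num_real//.
by move: h; move: (`|complex.Re z|) (`|complex.Im z|) => a b; nra.
Qed.

(** * Bounded functions as elements of H^-1 *)

Section duality.
Context {R : realType}.
Variables (L : R).
Hypothesis L_gt0 : 0 < L.

Let D : set R := `]- L, L[%classic.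
Let mD : measurable D. Proof. exact: measurable_itv. Qed.

(** The one-dimensional embedding of H^1_0 into bounded functions, from the Cauchy-Schwarz bound for
    primitives. *)
Lemma H10_bounded (phi psi : R -> R[i]) : H10_deriv L phi psi ->
  [/\ measurable_fun D (fun x => complex.Re (phi x)), measurable_fun D (fun x => complex.Im (phi x)) &
      forall x, x \in `[- L, L] ->
        `|complex.Re (phi x)| <= Num.sqrt (2 * L) * cL2norm D psi /\
        `|complex.Im (phi x)| <= Num.sqrt (2 * L) * cL2norm D psi].
Proof.
move=> [[m1 m2 iS] phiE _].
have l1 x : x \in `]- L, L[ -> complex.Re (psi x) ^+ 2 <= sqmod (psi x).
  by move=> _; rewrite /sqmod lerDl sqr_ge0.
have l2 x : x \in `]- L, L[ -> complex.Im (psi x) ^+ 2 <= sqmod (psi x).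
  by move=> _; rewrite /sqmod lerDr sqr_ge0.
split.
- apply: eq_measurable_fun (L2_primitive_measurable L_gt0 m1 iS l1) => x /set_mem xD.
  by rewrite phiE//; exact: mem_itv_oo_cc.
- apply: eq_measurable_fun (L2_primitive_measurable L_gt0 m2 iS l2) => x /set_mem xD.
  by rewrite phiE//; exact: mem_itv_oo_cc.
- have L2 : 0 <= 2 * L by rewrite mulr_ge0// ltW.
  move=> x xL; rewrite phiE//= /cL2norm -sqrtrM// -!sqrtr_sqr; split; apply: ler_wsqrtr.
    exact: (L2_primitive_bound L_gt0 m1 iS l1).
  exact: (L2_primitive_bound L_gt0 m2 iS l2).
Qed.

Variables (W : R -> R[i]) (m : R).
Hypotheses (mW1 : measurable_fun D (fun x => complex.Re (W x)))
  (mW2 : measurable_fun D (fun x => complex.Im (W x))).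
Hypothesis Wm : forall x, x \in `]- L, L[ -> `|complex.Re (W x)| <= m /\ `|complex.Im (W x)| <= m.

Let pairing_facts (phi psi : R -> R[i]) : H10_deriv L phi psi ->
  let B := m * (Num.sqrt (2 * L) * cL2norm D psi) in
  [/\ measurable_fun D (fun x => complex.Re (W x * phi x)),
      measurable_fun D (fun x => complex.Im (W x * phi x)) &
      forall x, x \in `]- L, L[ ->
        `|complex.Re (W x * phi x)| <= B + B /\ `|complex.Im (W x * phi x)| <= B + B].
Proof.
move=> /H10_bounded[p1 p2 b] B; split.
- rewrite (_ : (fun x => _) = fun x => complex.Re (W x) * complex.Re (phi x) - complex.Im (W x) * complex.Im (phi x)).
    by apply: measurable_funB; exact: measurable_funM.
  by apply/funext => x; rewrite cReM.
- rewrite (_ : (fun x => _) = fun x => complex.Re (W x) * complex.Im (phi x) + complex.Im (W x) * complex.Re (phi x)).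
    by apply: measurable_funD; exact: measurable_funM.
  by apply/funext => x; rewrite cImM.
- move=> x xD; have [w1 w2] := Wm xD; have [b1 b2] := b x (mem_itv_oo_cc xD).
  by rewrite cReM cImM; split; [apply: norm_leB|apply: norm_leD]; exact: norm_leM.
Qed.

Lemma pairing_cintegrable (phi : R -> R[i]) : H10 L phi ->
  cintegrable (leb R) D (fun x => W x * phi x).
Proof.
move=> [psi /pairing_facts[f1 f2 b]].
set B := m * (Num.sqrt (2 * L) * cL2norm D psi) in b.
by split; apply: (@bounded_integrable_oo _ _ _ (B + B)) => // x /b[].
Qed.

Lemma pairing_Hm1_norm_le :
  Hm1_norm_le L (fun phi => cintegral (leb R) D (fun x => W x * phi x))
    (8 * L * Num.sqrt (2 * L) * m).
Proof.
move=> phi psi hpsi; have [f1 f2 b] := pairing_facts hpsi.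
apply: (le_trans (sqrt_sqmod_le _)).
set B := m * (Num.sqrt (2 * L) * cL2norm D psi) in b.
(* The real and imaginary parts of the product each consist of two terms bounded by [B], integrated
   over an interval of length 2 L. *)
have -> : 8 * L * Num.sqrt (2 * L) * m * cL2norm D psi =
  (B + B) * (L - - L) + (B + B) * (L - - L) by rewrite /B; ring.
have LL : - L <= L by rewrite ltW// gtrN.
by apply: lerD; apply: Rintegral_bound_oo => // x /b[].
Qed.

End duality.

(** The adjoint equation has real coefficients, so it holds for both parts separately. The common
    bound [Z] comes from compactness of the rectangle. *)
Lemma adjoint_state_real (R : realType) (L tau : R) (z : R -> R -> R[i]) :
  0 < L -> adjoint_state L tau z -> exists Z,
  bounded_adjoint L tau Z (fun t x => complex.Re (z t x)) /\
  bounded_adjoint L tau Z (fun t x => complex.Im (z t x)).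
Proof.
move=> L0 [C1 C2 eq bd].
have bound (y : R -> R -> R) : C12 y -> exists Z, forall t x, in_rect L tau t x ->
    `|y t x| <= Z /\ `|derive1 (y t) x| <= Z.
  move=> [_ c1 _ c2 _].
  have [Z1 b1] := continuous_rect_bounded 0 tau (- L) L c1.
  have [Z2 b2] := continuous_rect_bounded 0 tau (- L) L c2.
  exists (Num.max Z1 Z2) => t x /andP[tI xI]; rewrite !le_max.
  by rewrite (b1 t x tI xI) (b2 t x tI xI) orbT.
have [Z1 b1] := bound _ C1; have [Z2 b2] := bound _ C2.
have weaken (y : R -> R -> R) (Z Z' : R) : Z <= Z' -> (forall t x, in_rect L tau t x ->
    `|y t x| <= Z /\ `|derive1 (y t) x| <= Z) -> forall t x, in_rect L tau t x ->
    `|y t x| <= Z' /\ `|derive1 (y t) x| <= Z'.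
  by move=> ZZ b t x /b[h1 h2]; split; [exact: le_trans h1 ZZ|exact: le_trans h2 ZZ].
exists (Num.max Z1 Z2); split; split.
- split=> // [t x tI xI|t tI]; last by have [-> ->] := bd t tI.
  have /(congr1 (@complex.Re R)) := eq t x tI xI.
  by move=> /= /eqP; rewrite subr_eq0 => /eqP <-; rewrite opprK.
- by apply: weaken b1; rewrite le_max lexx.
- split=> // [t x tI xI|t tI]; last by have [-> ->] := bd t tI.
  have /(congr1 (@complex.Im R)) := eq t x tI xI.
  by move=> /= /eqP; rewrite subr_eq0 => /eqP <-; rewrite opprK.
- by apply: weaken b2; rewrite le_max lexx orbT.
Qed.

Section reachability.
Context {R : realType}.
Variables (L T M : R) (U1 U2 : R -> R -> R).
Hypotheses (L_gt0 : 0 < L) (T_gt0 : 0 < T).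
Hypotheses (T1 : trajectory L T M 0 U1) (T2 : trajectory L T M 0 U2).

Let D : set R := `]- L, L[%classic.
Let mD : measurable D. Proof. exact: measurable_itv. Qed.
Let B1 := T1.1.
Let B2 := T2.1.
Let U (t x : R) : R[i] := U1 t x +i* U2 t x.
Let u (t : R) (phi : R -> R[i]) : R[i] := cintegral (leb R) D (fun x => U t x * phi x).

Let M_ge0 : 0 <= M. Proof. exact: (bounded_lipschitz_ge0 L_gt0 (ltW T_gt0) B1). Qed.

Let LI : L \in `[- L, L]. Proof. by rewrite in_itv/= lexx andbT ltW ?gtrN. Qed.
Let NLI : - L \in `[- L, L]. Proof. by rewrite in_itv/= lexx /= ltW ?gtrN. Qed.

Let U_bound t x : t \in `[0, T] -> x \in `]- L, L[ -> `|complex.Re (U t x)| <= M /\ `|complex.Im (U t x)| <= M.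
Proof.
move=> tI xI; have [b1 _ _] := B1; have [b2 _ _] := B2.
have rI : in_rect L T t x by rewrite /in_rect tI (mem_itv_oo_cc xI).
by split; [exact: b1|exact: b2].
Qed.

Let U_meas t : t \in `[0, T] ->
  measurable_fun D (fun x => complex.Re (U t x)) /\ measurable_fun D (fun x => complex.Im (U t x)).
Proof.
by move=> tI; split; [exact: (bounded_lipschitz_measurable_x B1 tI)|exact: (bounded_lipschitz_measurable_x B2 tI)].
Qed.

Let u_integrable t phi : t \in `[0, T] -> H10 L phi -> cintegrable (leb R) D (fun x => U t x * phi x).
Proof.
move=> tI; have [m1 m2] := U_meas tI.
exact: (pairing_cintegrable L_gt0 m1 m2 (fun x => @U_bound t x tI)).
Qed.

Let u_Hm1 t : t \in `[0, T] -> Hm1 L (u t).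
Proof.
move=> tI; split; last first.
  have [m1 m2] := U_meas tI; eexists.
  exact: (pairing_Hm1_norm_le L_gt0 m1 m2 (fun x => @U_bound t x tI)).
move=> a phi1 phi2 /(u_integrable tI) i1 /(u_integrable tI) i2.
have [_ <-] := cintegral_linear a mD i1 i2; rewrite /u; congr cintegral.
by apply/funext => x; ring.
Qed.

Let u_continuous t : t \in `[0, T] -> forall eps : R, 0 < eps ->
    exists2 delta : R, 0 < delta &
      forall s, s \in `[0, T] -> `|s - t| < delta ->
        Hm1_norm_le L (fun phi => u s phi - u t phi) eps.
Proof.
(* The added 1 keeps [C] positive even when M = 0. *)
move=> tI eps e0; pose C := 8 * L * Num.sqrt (2 * L) * M + 1.
have C0 : 0 < C by rewrite /C ltr_wpDl// !mulr_ge0 ?sqrtr_ge0// ltW.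
exists (eps / C); first by rewrite divr_gt0.
move=> s sI st phi psi hpsi.
have phiH : H10 L phi by exists psi.
pose W x := U s x - U t x.
have W1 x : complex.Re (W x) = U1 s x - U1 t x by [].
have W2 x : complex.Im (W x) = U2 s x - U2 t x by [].
have [m1 m2] := U_meas tI; have [n1 n2] := U_meas sI.
have mW1 : measurable_fun D (fun x => complex.Re (W x)) by exact: measurable_funB.
have mW2 : measurable_fun D (fun x => complex.Im (W x)) by exact: measurable_funB.
have Wm x : x \in `]- L, L[ -> `|complex.Re (W x)| <= M * `|s - t| /\ `|complex.Im (W x)| <= M * `|s - t|.
  move=> /mem_itv_oo_cc xI; have [_ b1 _] := B1; have [_ b2 _] := B2.
  by split; [apply: b1|apply: b2]; rewrite /in_rect ?sI ?tI xI.
have := pairing_Hm1_norm_le L_gt0 mW1 mW2 Wm hpsi.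
have -> : cintegral (leb R) D (fun x => W x * phi x) = u s phi - u t phi.
  have [_ ] := cintegral_linear (-1) mD (u_integrable tI phiH) (u_integrable sI phiH).
  rewrite mulN1r addrC => <-; congr cintegral.
  by apply/funext => x; rewrite /W; ring.
move=> h; apply: (le_trans h); apply: ler_wpM2r; first exact: sqrtr_ge0.
apply: (@le_trans _ _ (C * `|s - t|)).
  by rewrite mulrA; apply: ler_wpM2r => //; rewrite /C lerDl.
by rewrite mulrC -ler_pdivlMr// ltW.
Qed.

Let vm t := U t (- L).
Let vp t := U t L.

Let trace_L2 x : x \in `[- L, L] -> cL2 `]0, T[ (fun t => U t x).
Proof.
move=> xI.
have m1 := bounded_lipschitz_measurable_t B1 xI; have m2 := bounded_lipschitz_measurable_t B2 xI.
split => //; apply: (@bounded_integrable_oo _ _ _ (M ^+ 2 + M ^+ 2)).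
  by apply: measurable_funD; exact: measurable_funX.
move=> t tI; have [b1 _ _] := B1; have [b2 _ _] := B2.
have rI : in_rect L T t x by rewrite /in_rect (mem_itv_oo_cc tI).
by rewrite /sqmod /=; apply: norm_leD; apply: norm_leX; [exact: b1|exact: b2].
Qed.

(** The pairing is complex bilinear: its two parts combine the four real identities of [U1] and [U2]
    against the real and imaginary parts of z. *)
Let u_green tau z : tau \in `[0, T] -> adjoint_state L tau z ->
    u tau (z tau) =
    cintegral (leb R) `]0, tau[
      (fun t => vm t * cderive1 (z t) (- L) - vp t * cderive1 (z t) L).
Proof.
move=> tauI /(adjoint_state_real L_gt0)[Z [z1 z2]].
have sub (y1 y2 : R -> R) (E : set R) : measurable E -> (leb R).-integrable E (EFin \o y1) ->
    (leb R).-integrable E (EFin \o y2) ->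
    \int[leb R]_(x in E) (y1 x - y2 x) = \int[leb R]_(x in E) y1 x - \int[leb R]_(x in E) y2 x.
  by move=> mE i1 i2; rewrite (RintegralB _ i1 i2).
have mtau : measurable `]0, tau[%classic by exact: measurable_itv.
rewrite /u; apply: complex_ext; rewrite /cintegral /=.
- under eq_Rintegral do rewrite cReM.
  rewrite (sub _ _ _ mD (pairing_integrable B1 tauI z1) (pairing_integrable B2 tauI z2)).
  rewrite (trajectory_green T1 tauI z1) (trajectory_green T2 tauI z2).
  rewrite -(sub _ _ _ mtau (flux_integrable L_gt0 B1 tauI z1) (flux_integrable L_gt0 B2 tauI z2)).
  by apply: eq_Rintegral => t _; rewrite /flux /=; ring.
- under eq_Rintegral do rewrite cImM.
  have [_ <-] := Rintegrable_add mD (pairing_integrable B1 tauI z2) (pairing_integrable B2 tauI z1).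
  rewrite (trajectory_green T1 tauI z2) (trajectory_green T2 tauI z1).
  have [_ ->] := Rintegrable_add mtau (flux_integrable L_gt0 B1 tauI z2) (flux_integrable L_gt0 B2 tauI z1).
  by apply: eq_Rintegral => t _; rewrite /flux /=; ring.
Qed.

Lemma trajectory_reachable (w : R -> R[i]) :
  (forall x, x \in `]- L, L[ -> w x = U1 T x +i* U2 T x) -> reachable_in L T w.
Proof.
move=> wE; exists vm, vp, u.
have TI : T \in `[0, T] by rewrite in_itv/= lexx andbT ltW.
split; [exact: trace_L2|exact: trace_L2| |].
  by split; [split|move=> tau tauI z; exact: u_green].
move=> phi hphi; have [i1 i2] := u_integrable TI hphi.
have E x : x \in D -> U T x * phi x = w x * phi x by move=> /set_mem xD; rewrite wE.
split; first split.
- by apply: eq_integrable i1 => // x xD; rewrite E.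
- by apply: eq_integrable i2 => // x xD; rewrite E.
- by rewrite /u /cintegral; congr (_ +i* _); apply: eq_Rintegral => x xD; rewrite E.
Qed.

End reachability.

(** * The final state *)

(** The terms in y^2 cancel, leaving L0^2 - 2 x y + x^2 with x y <= |x| L0. The lower bound does not
    depend on y and is positive for |x| < L0. *)
Lemma gap_le (R : realType) (L0 x y : R) : y \in `[- L0, L0] ->
  (L0 - `|x|) ^+ 2 <= (x - y) ^+ 2 + (L0 ^+ 2 - y ^+ 2).
Proof.
rewrite in_itv/= -ler_norml => yL.
have xy : x * y <= `|x| * L0.
  by apply: le_trans (ler_norm _) _; rewrite normrM ler_wpM2l.
have -> : (x - y) ^+ 2 + (L0 ^+ 2 - y ^+ 2) = L0 ^+ 2 - 2 * (x * y) + x ^+ 2 by ring.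
have -> : (L0 - `|x|) ^+ 2 = L0 ^+ 2 - 2 * (`|x| * L0) + `|x| ^+ 2 by ring.
by rewrite real_normK ?num_real//; lra.
Qed.

Definition heat_integrand (R : realType) (L0 : R) (u v al : R -> R) (x t y : R) : R :=
  heat_osc ((x - y) ^+ 2 + (L0 ^+ 2 - y ^+ 2)) (al y) 2 (u y) (v y) t.

Section heat_fubini.
Context {R : realType}.
Variables (L0 x : R) (u v al : R -> R).
Hypothesis xL0 : `|x| < L0.
Hypotheses (mu : measurable_fun setT u) (mv : measurable_fun setT v)
  (mal : measurable_fun setT al).
Hypothesis iuv : (leb R).-integrable `]- L0, L0[ (EFin \o (fun y => `|u y| + `|v y|)).

Let d (y : R) := (x - y) ^+ 2 + (L0 ^+ 2 - y ^+ 2).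
Let d0 := (L0 - `|x|) ^+ 2.

Let d0_gt0 : 0 < d0. Proof. by rewrite exprn_gt0// subr_gt0. Qed.

Let D1 : set R := `]0, +oo[%classic.
Let D2 : set R := `]- L0, L0[%classic.
Let mD1 : measurable D1. Proof. exact: measurable_itv. Qed.
Let mD2 : measurable D2. Proof. exact: measurable_itv. Qed.

Let f (p : R * R) := heat_integrand L0 u v al x p.1 p.2.
Let g (t : R) := heat_osc d0 0 2 1 0 t.
Let k (y : R) := `|u y| + `|v y|.

Let D1P t : D1 t -> 0 < t. Proof. by rewrite /D1/= in_itv/= andbT. Qed.

Let dy_gt0 y : D2 y -> 0 < d y.
Proof. by move=> /mem_itv_oo_cc/(gap_le x); exact: lt_le_trans. Qed.

Let f_le t y : D1 t -> D2 y -> `|f (t, y)| <= g t * k y.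
Proof.
move=> /D1P t0 yD; have dy := dy_gt0 yD.
rewrite /f /g /k /heat_integrand -/(d y) /heat_osc /= (heat_expE dy t0) (heat_expE d0_gt0 t0) !mul0r cos0 addr0 !mulr1.
rewrite -[leRHS]mulrA; apply: norm_leM; first by rewrite ger0_norm// sqr_ge0.
apply: norm_leM.
  rewrite ger0_norm ?expR_ge0// ler_expR lerN2; apply: ler_wpM2r; first by rewrite invr_ge0 ltW.
  by apply: ler_wpM2r => //; exact: (gap_le x (mem_itv_oo_cc yD)).
by rewrite -[`|u y|]mulr1 -[`|v y|]mulr1; apply: norm_leD; apply: norm_leM; rewrite ?cos_max ?sin_max.
Qed.

Let mf : measurable_fun setT f.
Proof.
have m2 (h : R -> R) : measurable_fun setT h -> measurable_fun setT (fun p : R * R => h p.2).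
  by move=> mh; exact: (measurableT_comp mh measurable_snd).
have mi : measurable_fun setT (fun p : R * R => p.1^-1).
  exact: (measurableT_comp (@measurable_inv R) measurable_fst).
have mc (c : R) : measurable_fun setT (fun _ : R => c) by exact: measurable_cst.
have mid : measurable_fun setT (fun y : R => y) by exact: measurable_id.
have md : measurable_fun setT d.
  exact: (measurable_funD (measurable_funX 2 (measurable_funB (mc x) mid)) (measurable_funB (mc _) (measurable_funX 2 mid))).
have msq : measurable_fun setT (@Num.sqrt R).
  by apply: continuous_measurable_fun; exact: sqrt_continuous.
have mcos : measurable_fun setT (@cos R) by apply: continuous_measurable_fun; exact: continuous_cos.
have msin : measurable_fun setT (@sin R) by apply: continuous_measurable_fun; exact: continuous_sin.
have me : measurable_fun setT (fun p : R * R => heat_exp (d p.2) p.1).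
  apply: measurable_funM; first exact: (measurableT_comp msq measurable_fst).
  by apply: measurable_hk; [exact: measurable_fst|exact: (m2 _ (measurableT_comp msq md))].
have mth : measurable_fun setT (fun p : R * R => al p.2 / 4 * p.1^-1).
  exact: (measurable_funM (m2 _ (measurable_funM mal (mc 4^-1))) mi).
exact: (measurable_funM (measurable_funX 2 mi) (measurable_funM me (measurable_funD
  (measurable_funM (m2 _ mu) (measurableT_comp mcos mth)) (measurable_funM (m2 _ mv) (measurableT_comp msin mth))))).
Qed.

(** By [gap_le] the integrand is dominated by t^-2 exp (- d0 / 4t) (|u| + |v|), and the first factor
    is integrable in t because d0 > 0. *)
Lemma heat_fubini :
  [/\ ((leb R) \x (leb R))%E.-integrable (`]0, +oo[ `*` `]- L0, L0[)
        (EFin \o (fun p => heat_integrand L0 u v al x p.1 p.2)),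
      (forall t, 0 < t -> (leb R).-integrable `]- L0, L0[ (EFin \o heat_integrand L0 u v al x t)),
      (leb R).-integrable `]0, +oo[
        (EFin \o (fun t => \int[leb R]_(y in `]- L0, L0[) heat_integrand L0 u v al x t y)) &
      \int[leb R]_(t in `]0, +oo[) (\int[leb R]_(y in `]- L0, L0[) heat_integrand L0 u v al x t y) =
      4 * \int[leb R]_(y in `]- L0, L0[) real_kernel L0 u v al x y /\
      (leb R).-integrable `]- L0, L0[ (EFin \o real_kernel L0 u v al x)].
Proof.
have [ig _] := heat_osc_integral 0 1 0 d0_gt0.
have [i1 i2 i3 e] := @fubini_dominated _ _ _ _ R (leb R) (leb R) D1 D2 f g k mD1 mD2
  (measurable_funTS mf) ig iuv f_le.
(* A second application with the variables exchanged yields the integrability in y of the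
   t-integrals, that is, of the kernel. *)
pose f' (p : R * R) := f (p.2, p.1).
have mf' : measurable_fun setT f'.
  by apply: (measurableT_comp mf (g := fun p : R * R => (p.2, p.1))); exact: measurable_swap.
have f_le' y t : D2 y -> D1 t -> `|f' (y, t)| <= k y * g t.
  by move=> yD tD; rewrite mulrC; exact: f_le.
have [_ _ j3 _] := @fubini_dominated _ _ _ _ R (leb R) (leb R) D2 D1 f' k g mD2 mD1
  (measurable_funTS mf') iuv ig f_le'.
have inner y : D2 y -> \int[leb R]_(t in D1) f (t, y) = 4 * real_kernel L0 u v al x y.
  move=> yD; have [_ ->] := heat_osc_integral (al y) (u y) (v y) (dy_gt0 yD).
  by rewrite /real_kernel -/(d y) mulrA.
have ik : (leb R).-integrable D2 (EFin \o (fun y => 4 * real_kernel L0 u v al x y)).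
  by apply: eq_integrable j3 => // y /set_mem yD /=; rewrite -inner.
have [ik' e'] := Rintegrable_scale 4^-1 mD2 ik.
have E : (fun y => 4^-1 * (4 * real_kernel L0 u v al x y)) = real_kernel L0 u v al x.
  by apply/funext => y; rewrite mulKf.
rewrite E in ik' e'; split; [exact: i1| |exact: i3|split; last exact: ik'].
  by move=> t t0; apply: i2; rewrite /D1/= in_itv/= andbT.
have four : 4 != 0 :> R by rewrite pnatr_eq0.
rewrite e' (mulVKf four) e.
apply: eq_Rintegral => y /set_mem yD.
exact: (inner y yD).
Qed.

End heat_fubini.

(** The exponents - (x - y)^2 / 4t and (y^2 - L0^2) / 4t add up to - d / 4t, and the prefactors
    t^(-1/2) and t^(-3/2) multiply to t^-2: the integrand is exactly of Laplace type. *)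
Lemma heat_source_kernel (R : realType) (L0 : R) (alpha : R -> R) (h : R -> R[i]) (t x y : R) :
  0 < t -> let d := (x - y) ^+ 2 + (L0 ^+ 2 - y ^+ 2) in 0 < d ->
  let c := (Num.sqrt (4 * pi))^-1 in
  (heat_kernel t (x - y))%:C * source L0 alpha h t y =
    (c * heat_osc d (alpha y) 2 (complex.Re (h y)) (complex.Im (h y)) t) +i*
    (c * heat_osc d (alpha y) 2 (complex.Im (h y)) (- complex.Re (h y)) t).
Proof.
move=> t0 d dgt0 c.
pose A := (y ^+ 2 - L0 ^+ 2) / (4 * t); pose B := alpha y / (4 * t).
have Ez : A%:C - 'i%C * B%:C = A +i* (- B).
  by apply: complex_ext => /=; ring.
have Ew : (Num.sqrt (4 * pi * t))^-1 * (t `^ (3 / 2))^-1 = c * t^-1 ^+ 2.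
  have p4 : 0 <= 4 * pi :> R by rewrite mulr_ge0// pi_ge0.
  have st : Num.sqrt t != 0 by rewrite gt_eqF// sqrtr_gt0.
  have -> : 3 / 2 = 1 + 2^-1 :> R by field.
  rewrite powRD; last by rewrite (gt_eqF t0) implybT.
  rewrite powRr1 ?ltW// powR12_sqrt ?ltW// sqrtrM// /c !invfM.
  have -> : t^-1 ^+ 2 = t^-1 * ((Num.sqrt t)^-1 * (Num.sqrt t)^-1).
    by rewrite -invfM -expr2 sqr_sqrtr ?ltW.
  by ring.
have Ee : expR (- ((x - y) ^+ 2 / (4 * t))) * expR A = heat_exp d t.
  rewrite heat_expE// -expRD; congr expR; rewrite /A /d; field; exact: lt0r_neq0.
have EB : B = alpha y / 4 * t^-1 by rewrite /B invfM mulrA.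
have -> : (heat_kernel t (x - y))%:C * source L0 alpha h t y =
  (c * (t^-1 ^+ 2 * heat_exp d t))%:C * ((cos B +i* (- sin B)) * h y).
  rewrite /source -/A -/B Ez /heat_kernel /cexp /= cosN sinN -Ee.
  have -> : c * (t^-1 ^+ 2 * (expR (- ((x - y) ^+ 2 / (4 * t))) * expR A)) =
    (Num.sqrt (4 * pi * t))^-1 * expR (- ((x - y) ^+ 2 / (4 * t))) * ((t `^ (3 / 2))^-1 * expR A).
    by rewrite mulrA -Ew; ring.
  by case: (h y) => a b; apply: complex_ext => /=; ring.
rewrite /heat_osc -EB; case: (h y) => a b; apply: complex_ext => /=; ring.
Qed.

Lemma complex_quotient (R : realType) (d a : R) (z : R[i]) : 0 < d ->
  d%:C + 'i%C * a%:C != 0 /\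
  z / (d%:C + 'i%C * a%:C) =
    ((complex.Re z * d + complex.Im z * a) / (d ^+ 2 + a ^+ 2)) +i*
    ((complex.Im z * d + - complex.Re z * a) / (d ^+ 2 + a ^+ 2)).
Proof.
move=> d0; have n0 : d ^+ 2 + a ^+ 2 != 0 by rewrite gt_eqF// ltr_wpDr ?sqr_ge0// exprn_gt0.
have E : d%:C + 'i%C * a%:C = d +i* a by apply: complex_ext => /=; ring.
have D0 : d%:C + 'i%C * a%:C != 0.
  rewrite E; apply/eqP => /(congr1 (@complex.Re R)) /= dE; by move: d0; rewrite dE ltxx.
split => //; apply: (mulIf D0); rewrite divfK// E.
by case: z => b c; apply: complex_ext => /=; field.
Qed.

Lemma product_integrable_scale d1 d2 (X : measurableType d1) (Y : measurableType d2)
    (R : realType) (m1 : {sigma_finite_measure set X -> \bar R})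
    (m2 : {sigma_finite_measure set Y -> \bar R}) (D1 : set X) (D2 : set Y) (c : R)
    (f g : X * Y -> R) : measurable D1 -> measurable D2 ->
  (m1 \x m2)%E.-integrable (D1 `*` D2) (EFin \o f) ->
  (forall x y, D1 x -> D2 y -> g (x, y) = c * f (x, y)) ->
  (m1 \x m2)%E.-integrable (D1 `*` D2) (EFin \o g).
Proof.
move=> mD1 mD2 fi fg; have mX := measurableX mD1 mD2.
apply: eq_integrable (integrableZl mX c fi) => // -[x y] /set_mem[xD yD] /=.
by rewrite fg.
Qed.

Section state.
Context {R : realType}.
Variables (L0 : R) (alpha : R -> R) (h : R -> R[i]).

Definition duhamel (x t y : R) : R[i] := (heat_kernel t (x - y))%:C * source L0 alpha h t y.

Definition final_state (x : R) : R[i] :=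
  cintegral (leb R) `]0, +oo[ (fun t => cintegral (leb R) `]- L0, L0[ (duhamel x t)).

Definition denominator (x y : R) : R[i] :=
  ((x - y) ^+ 2 + L0 ^+ 2 - y ^+ 2)%:C + 'i%C * (alpha y)%:C.

Hypothesis L0_gt0 : 0 < L0.

(** The data are controlled on the interval only. Extended by zero they are measurable on the whole
    line; alpha becomes bounded by compactness, and h is integrable because L^2 embeds in L^1 on a
    bounded interval. *)
Lemma extended_data :
  {within `[- L0, L0], continuous alpha} -> cL2 `]- L0, L0[ h ->
  exists (u v al : R -> R) (B : R),
  [/\ [/\ measurable_fun setT u, measurable_fun setT v & measurable_fun setT al],
      forall y, `|al y| <= B,
      (leb R).-integrable `]- L0, L0[ (EFin \o (fun y => `|u y| + `|v y|)) &
      forall y, y \in `]- L0, L0[ ->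
        [/\ complex.Re (h y) = u y, complex.Im (h y) = v y & alpha y = al y]].
Proof.
move=> ca [m1 m2 iS].
pose D : set R := `]- L0, L0[%classic; pose C : set R := `[- L0, L0]%classic.
have mD : measurable D by exact: measurable_itv.
have mC : measurable C by exact: measurable_itv.
have LL : - L0 <= L0 by rewrite ltW// gtrN.
have [c1 _ max] := EVT_max LL ca; have [c2 _ min] := EVT_min LL ca.
exists ((fun y => complex.Re (h y)) \_ D), ((fun y => complex.Im (h y)) \_ D), (alpha \_ C),
  (`|alpha c1| + `|alpha c2|).
split; [split| | |].
- exact/(measurable_restrictT _ mD).
- exact/(measurable_restrictT _ mD).
- by apply/(measurable_restrictT _ mC); exact: subspace_continuous_measurable_fun.
- move=> y; rewrite patchE; case: ifPn => [/set_mem yC|_]; last by rewrite normr0 addr_ge0.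
  have h1 := max y yC; have h2 := min y yC.
  rewrite ler_norml; apply/andP; split.
    by have := ler_norm (- alpha c2); rewrite normrN; have := normr_ge0 (alpha c1); lra.
  by have := ler_norm (alpha c1); have := normr_ge0 (alpha c2); lra.
- have l1 y : y \in `]- L0, L0[ -> complex.Re (h y) ^+ 2 <= sqmod (h y).
    by move=> _; rewrite /sqmod lerDl sqr_ge0.
  have l2 y : y \in `]- L0, L0[ -> complex.Im (h y) ^+ 2 <= sqmod (h y).
    by move=> _; rewrite /sqmod lerDr sqr_ge0.
  have i1 := @integrable_norm _ _ _ (leb R) _ _ (L2_integrable L0_gt0 m1 iS l1).
  have i2 := @integrable_norm _ _ _ (leb R) _ _ (L2_integrable L0_gt0 m2 iS l2).
  have [i12 _] := Rintegrable_add mD i1 i2.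
  apply: eq_integrable i12 => // y yD /=.
  by rewrite !patchE yD.
- move=> y yD; have yD' : y \in D by rewrite inE.
  have yC' : y \in C by rewrite inE /C/=; exact: mem_itv_oo_cc.
  by rewrite !patchE yD' yC'.
Qed.

Variables (u v al : R -> R).
Hypotheses (mu : measurable_fun setT u) (mv : measurable_fun setT v)
  (mal : measurable_fun setT al).
Hypothesis iuv : (leb R).-integrable `]- L0, L0[ (EFin \o (fun y => `|u y| + `|v y|)).
Hypothesis ext : forall y, y \in `]- L0, L0[ ->
  [/\ complex.Re (h y) = u y, complex.Im (h y) = v y & alpha y = al y].

Let D1 : set R := `]0, +oo[%classic.
Let D2 : set R := `]- L0, L0[%classic.
Let mD1 : measurable D1. Proof. exact: measurable_itv. Qed.
Let mD2 : measurable D2. Proof. exact: measurable_itv. Qed.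
Local Notation v' := (fun y => - u y).

(** Replacing h by - i h turns (u, v) into (v, - u). The imaginary part of each statement is the
    real part of the statement for these rotated data. *)
Lemma rotated_measurable : measurable_fun setT v'.
Proof. exact: measurable_funN. Qed.

Lemma rotated_integrable : (leb R).-integrable `]- L0, L0[ (EFin \o (fun y => `|v y| + `|v' y|)).
Proof. by apply: eq_integrable iuv => // y _ /=; rewrite normrN addrC. Qed.

Variable x : R.
Hypothesis xL0 : `|x| < L0.

Let c : R := (Num.sqrt (4 * pi))^-1.
Let F (u v : R -> R) := heat_integrand L0 u v al x.

Let KE t y : 0 < t -> D2 y -> duhamel x t y = (c * F u v t y) +i* (c * F v v' t y).
Proof.
move=> t0 yD; have [e1 e2 e3] := ext yD.
have d0 : 0 < (x - y) ^+ 2 + (L0 ^+ 2 - y ^+ 2).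
  by apply: lt_le_trans (gap_le x (mem_itv_oo_cc yD)); rewrite exprn_gt0// subr_gt0.
by rewrite /duhamel heat_source_kernel// e1 e2 e3.
Qed.

Let D1P t : D1 t -> 0 < t. Proof. by rewrite /D1/= in_itv/= andbT. Qed.

Let hf1 := heat_fubini xL0 mu mv mal iuv.
Let hf2 := heat_fubini xL0 mv rotated_measurable mal rotated_integrable.

Let inner t : D1 t -> cintegral (leb R) D2 (duhamel x t) =
  (c * \int[leb R]_(y in D2) F u v t y) +i* (c * \int[leb R]_(y in D2) F v v' t y).
Proof.
move=> /D1P t0; have [_ i1 _ _] := hf1; have [_ i2 _ _] := hf2.
have [_ <-] := Rintegrable_scale c mD2 (i1 t t0).
have [_ <-] := Rintegrable_scale c mD2 (i2 t t0).
by rewrite /cintegral; congr (_ +i* _); apply: eq_Rintegral => y /set_mem yD; rewrite KE.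
Qed.

Lemma state_integrable :
  [/\ forall t, 0 < t -> cintegrable (leb R) `]- L0, L0[ (duhamel x t),
      cintegrable (leb R) `]0, +oo[ (fun t => cintegral (leb R) `]- L0, L0[ (duhamel x t)) &
      cintegrable ((leb R) \x (leb R))%E (`]0, +oo[ `*` `]- L0, L0[) (fun p => duhamel x p.1 p.2)].
Proof.
have [j1 i1 k1 _] := hf1; have [j2 i2 k2 _] := hf2; split.
- move=> t t0; have [r1 _] := Rintegrable_scale c mD2 (i1 t t0).
  have [r2 _] := Rintegrable_scale c mD2 (i2 t t0).
  split; [apply: eq_integrable r1 => // y /set_mem yD|apply: eq_integrable r2 => // y /set_mem yD];
    by rewrite /= KE.
- have [r1 _] := Rintegrable_scale c mD1 k1; have [r2 _] := Rintegrable_scale c mD1 k2.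
  split; [apply: eq_integrable r1 => // t /set_mem tD|apply: eq_integrable r2 => // t /set_mem tD];
    by rewrite inner.
- have KEp t y : D1 t -> D2 y -> duhamel x t y = (c * F u v t y) +i* (c * F v v' t y).
    by move=> /D1P t0 yD; exact: KE.
  split.
    apply: (@product_integrable_scale _ _ _ _ R (leb R) (leb R) _ _ c _ _ mD1 mD2 j1).
    by move=> t y tD yD /=; rewrite KEp.
  apply: (@product_integrable_scale _ _ _ _ R (leb R) (leb R) _ _ c _ _ mD1 mD2 j2).
  by move=> t y tD yD /=; rewrite KEp.
Qed.

Lemma state_real_kernel : final_state x =
  (2 / Num.sqrt pi * \int[leb R]_(y in D2) real_kernel L0 u v al x y) +i*
  (2 / Num.sqrt pi * \int[leb R]_(y in D2) real_kernel L0 v v' al x y).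
Proof.
have [_ _ k1 [e1 _]] := hf1; have [_ _ k2 [e2 _]] := hf2.
(* The 4 of the Laplace integral times the 1 / sqrt (4 pi) of the heat kernel. *)
have c4 : 2 / Num.sqrt pi = c * 4.
  rewrite /c sqrtrM// (_ : 4 = 2 ^+ 2); last by ring.
  rewrite sqrtr_sqr ger0_norm//.
  have : Num.sqrt pi != 0 :> R by rewrite gt_eqF// sqrtr_gt0 pi_gt0.
  by move: (Num.sqrt pi) => s s0; field.
rewrite c4 -!mulrA -e1 -e2.
have [_ <-] := Rintegrable_scale c mD1 k1; have [_ <-] := Rintegrable_scale c mD1 k2.
by rewrite /final_state {1}/cintegral; congr (_ +i* _); apply: eq_Rintegral => t /set_mem tD; rewrite inner.
Qed.

Lemma state_quotient :
  [/\ forall y, y \in `[- L0, L0] -> denominator x y != 0,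
      cintegrable (leb R) `]- L0, L0[ (fun y => h y / denominator x y) &
      final_state x = (2 / Num.sqrt pi)%:C * cintegral (leb R) `]- L0, L0[ (fun y => h y / denominator x y)].
Proof.
have d0 y : y \in `[- L0, L0] -> 0 < (x - y) ^+ 2 + L0 ^+ 2 - y ^+ 2.
  by move=> yC; rewrite -addrA; apply: lt_le_trans (gap_le x yC); rewrite exprn_gt0// subr_gt0.
have E y : D2 y -> h y / denominator x y = real_kernel L0 u v al x y +i* real_kernel L0 v v' al x y.
  move=> yD; have [e1 e2 e3] := ext yD.
  have [_ ->] := complex_quotient (alpha y) (h y) (d0 y (mem_itv_oo_cc yD)).
  by rewrite e1 e2 e3 /real_kernel addrA.
have [_ _ _ [_ i1]] := hf1; have [_ _ _ [_ i2]] := hf2.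
split.
- by move=> y yC; have [] := complex_quotient (alpha y) 0 (d0 y yC).
- split; [apply: eq_integrable i1 => // y /set_mem yD|apply: eq_integrable i2 => // y /set_mem yD];
    by rewrite /= E.
- rewrite state_real_kernel /cintegral; apply: complex_ext => /=.
    rewrite mul0r subr0; congr (_ * _); apply: eq_Rintegral => y /set_mem yD; by rewrite E.
  rewrite mul0r addr0; congr (_ * _); apply: eq_Rintegral => y /set_mem yD; by rewrite E.
Qed.

End state.

Theorem theorem1p5 (R : realType) (L L0 : R) (alpha : R -> R) (h : R -> R[i])
    (L_gt0 : 0 < L) (L_lt_L0 : L < L0)
    (alpha_cont : {within `[- L0, L0], continuous alpha})
    (h_L2 : cL2 `]- L0, L0[ h) :
  let mu := @lebesgue_measure R in
  let K (x t y : R) : R[i] :=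
    (heat_kernel t (x - y))%:C * source L0 alpha h t y in
  let w0 (x : R) : R[i] :=
    cintegral mu `]0, +oo[ (fun t => cintegral mu `]- L0, L0[ (K x t)) in
  let D (x y : R) : R[i] :=
    ((x - y) ^+ 2 + L0 ^+ 2 - y ^+ 2)%:C + 'i%C * (alpha y)%:C in
  [/\ (* the integral defining w0 is well defined, both as an iterated and as
         an absolutely convergent double integral *)
      forall x, x \in `]- L, L[ ->
        [/\ forall t, 0 < t -> cintegrable mu `]- L0, L0[ (K x t),
            cintegrable mu `]0, +oo[
              (fun t => cintegral mu `]- L0, L0[ (K x t)) &
            cintegrable (mu \x mu)%E (`]0, +oo[ `*` `]- L0, L0[)
              (fun p => K x p.1 p.2)],
      reachable L w0 &
      forall x, x \in `]- L, L[ ->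
        [/\ forall y, y \in `[- L0, L0] -> D x y != 0,
            cintegrable mu `]- L0, L0[ (fun y => h y / D x y) &
            w0 x = (2 / Num.sqrt pi)%:C *
                   cintegral mu `]- L0, L0[ (fun y => h y / D x y)]].
Proof.
move=> mu K w0 D.
have L0_gt0 : 0 < L0 by exact: lt_trans L_lt_L0.
have [u [v [al [B [[mu_ mv_ mal] al_le iuv ext]]]]] := extended_data L0_gt0 alpha_cont h_L2.
have xL0 x : x \in `]- L, L[ -> `|x| < L0.
  by rewrite in_itv/= -ltr_norml => h1; exact: lt_trans L_lt_L0.
split.
- by move=> x /xL0 xL; exact: (state_integrable mu_ mv_ mal iuv ext xL).
- move=> T T_gt0.
  (* A threshold strictly inside ]L, L0[: above L for the distance of the centres, below L0 for the
     lower bound on p. *)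
  pose L' := (L + L0) / 2.
  have LL' : L < L' by rewrite /L'; move: L_lt_L0; lra.
  have L'L0 : L' < L0 by rewrite /L'; move: L_lt_L0; lra.
  have [M1 [U1 [T1 E1]]] := kernel_trajectory L_gt0 LL' L'L0 T_gt0 mu_ mv_ mal al_le iuv.
  have [M2 [U2 [T2 E2]]] := kernel_trajectory L_gt0 LL' L'L0 T_gt0 mv_ (rotated_measurable mu_) mal al_le
    (rotated_integrable iuv).
  pose c : R := 2 / Num.sqrt pi.
  have S1 := trajectoryZ L_gt0 c T1; have S2 := trajectoryZ L_gt0 c T2.
  have p1 := bounded_lipschitz_ge0 L_gt0 (ltW T_gt0) S1.1.
  have p2 := bounded_lipschitz_ge0 L_gt0 (ltW T_gt0) S2.1.
  (* [trajectory_reachable] takes one constant for both parts; the sum dominates each. *)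
  have W1 : trajectory L T (`|c| * M1 + `|c| * M2) 0 (fun t x => c * U1 t x).
    by apply: trajectory_weaken S1; rewrite lerDl.
  have W2 : trajectory L T (`|c| * M1 + `|c| * M2) 0 (fun t x => c * U2 t x).
    by apply: trajectory_weaken S2; rewrite lerDr.
  apply: (trajectory_reachable L_gt0 T_gt0 W1 W2) => x xL.
  have xC := mem_itv_oo_cc xL.
  rewrite (E1 x xC).2 (E2 x xC).2.
  exact: (state_real_kernel mu_ mv_ mal iuv ext (xL0 x xL)).
- by move=> x /xL0 xL; exact: (state_quotient mu_ mv_ mal iuv ext xL).
Qed.
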